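(* Let $1\leq p\leq\infty$. For every dispersed subspace $E\subseteq L_p[0,1]$ there exists a closed subspace $E'\subseteq L_p[0,1]$ which is isomorphic to $E$ (as a Banach space) and does stable phase retrieval in $L_p[0,1]$. The same result holds with $L_p[0,1]$ replaced by $C[0,1]$, by $C(\Delta)$, by $c$, or by any order continuous atomic Banach lattice.
   Context: All spaces are over the reals. $\Delta$ is the Cantor set and $c$ is the Banach lattice of convergent real sequences with supremum norm. A closed subspace $E$ of a Banach lattice $X$ is dispersed if it contains no normalized almost disjoint sequence, i.e. there is no sequence $(x_n)$ in $E$ with $\|x_n\|=1$ for all $n$ for which there is a sequence $(d_n)$ of pairwise disjoint elements of $X$ (i.e. $|d_n|\wedge|d_m|=0$ for $n\neq m$) with $\|x_n-d_n\|\to0$. A subspace $E$ of a real Banach lattice $X$ does stable phase retrieval (SPR) if there is a constant $C$ such that $\min_{\lambda\in\{1,-1\}}\|f-\lambda g\|\leq C\big\||f|-|g|\big\|$ for all $f,g\in E$. A Banach lattice $X$ is order continuous if every net decreasing to infimum $0$ in $X$ converges to $0$ in norm. An atom of $X$ is a nonzero $a\in X_+$ such that $0\leq b\leq a$ implies $b$ is a scalar multiple of $a$; $X$ is atomic if for every nonzero $x\in X_+$ there is an atom $a$ with $a\leq x$.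
   Formalization: The order continuous atomic Banach lattice is assumed infinite dimensional; without this the claim fails, e.g. for the plane R^2 with E the whole space, since (1,1) and (1,-1) have equal modulus. *)

(* Defs.v *)
From HB Require Import structures.
From mathcomp Require Import all_boot all_order all_algebra.
From mathcomp Require Import all_classical all_reals all_analysis.
From mathcomp Require Import measurable_realfun ess_sup_inf.

Set Implicit Arguments.
Unset Strict Implicit.
Unset Printing Implicit Defensive.

Import Order.TTheory GRing.Theory Num.Theory.
Import numFieldNormedType.Exports.

Local Open Scope classical_set_scope.
Local Open Scope ring_scope.

(* Order.Lattice is not reused: Hierarchy-Builder rejects a structure joining  *)
(* it with GRing.Zmodule once Num.RealDomain, which inherits from both, has    *)
(* been declared.                                                              *)
HB.mixin Record NormedModule_isNormedLattice (R : realType) V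
    & NormedModule R V := {
  lat_le : V -> V -> Prop ;
  lat_join : V -> V -> V ;
  lat_meet : V -> V -> V ;
  lat_le_refl : forall x, lat_le x x ;
  lat_le_anti : forall x y, lat_le x y -> lat_le y x -> x = y ;
  lat_le_trans : forall x y z, lat_le x y -> lat_le y z -> lat_le x z ;
  lat_joinP : forall x y z,
    lat_le (lat_join x y) z <-> lat_le x z /\ lat_le y z ;
  lat_meetP : forall x y z,
    lat_le z (lat_meet x y) <-> lat_le z x /\ lat_le z y ;
  lat_leD2l : forall z x y, lat_le x y -> lat_le (z + x) (z + y) ;
  lat_scale_ge0 : forall (a : R) x, 0 <= a -> lat_le 0 x -> lat_le 0 (a *: x) ;
  lat_norm_le : forall x y,
    lat_le (lat_join x (- x)) (lat_join y (- y)) -> `|x| <= `|y|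
}.

#[short(type="normedLatticeType")]
HB.structure Definition NormedLattice (R : realType) :=
  {V of NormedModule R V & NormedModule_isNormedLattice R V}.

#[short(type="banachLatticeType")]
HB.structure Definition BanachLattice (R : realType) :=
  {V of NormedLattice R V & CompleteNormedModule R V}.

Definition modulus (R : realType) (X : normedLatticeType R) (x : X) : X :=
  lat_join x (- x).

Record sup_lattice (R : realType) (T : Type) := SupLattice {
  supl_set : set (T -> R) ;
  supl_submod : submod_closed [in supl_set] ;
  supl_max : forall f g, supl_set f -> supl_set g -> supl_set (f \max g) ;
  supl_bounded : forall f, supl_set f -> has_ubound (range (fun x => `|f x|))
}.

Definition supl_pred R T (S : sup_lattice R T) : {pred T -> R} :=
  [in supl_set S].

HB.instance Definition _ R T (S : sup_lattice R T) :=
  GRing.isSubmodClosed.Build R (T -> R) (supl_pred S) (supl_submod S).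

Record sup_space R T (S : sup_lattice R T) := SupSpace {
  sup_fun :> T -> R ;
  sup_funP : sup_fun \in supl_pred S
}.

Section sup_space.
Context (R : realType) (T : Type) (S : sup_lattice R T).
Implicit Types f g : sup_space S.

HB.instance Definition _ := [isSub for @sup_fun R T S].
HB.instance Definition _ := [Choice of sup_space S by <:].
HB.instance Definition _ := [SubChoice_isSubLmodule of sup_space S by <:].

Definition sup_norm f : R := sup (range (fun x => `|f x|)).

Lemma sup_norm_ubound f x : `|f x| <= sup_norm f.
Proof.
apply: sup_upper_bound; last by exists x.
split; first by exists `|f x|, x.
by apply: (@supl_bounded _ _ S); exact: set_mem (sup_funP f).
Qed.

Lemma sup_norm_le f M : 0 <= M -> (forall x, `|f x| <= M) -> sup_norm f <= M.
Proof.
move=> M0 fM; rewrite /sup_norm.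
have [->|/set0P ne] := eqVneq (range (fun x => `|f x|)) set0.
  by rewrite sup0.
by apply: ge_sup => // _ [x _ <-].
Qed.

Lemma sup_norm_ge0 f : 0 <= sup_norm f.
Proof.
rewrite /sup_norm; have [->|/set0P[_ [x _ _]]] :=
  eqVneq (range (fun x => `|f x|)) set0; first by rewrite sup0.
exact: le_trans (sup_norm_ubound f x).
Qed.

Lemma sup_funD f g x : (f + g) x = f x + g x. Proof. by []. Qed.
Lemma sup_funN f x : (- f) x = - f x. Proof. by []. Qed.
Lemma sup_funZ (a : R) f x : (a *: f) x = a * f x. Proof. by []. Qed.

Lemma sup_spaceP f g : f =1 g -> f = g.
Proof. by move=> fg; apply/val_inj/funext. Qed.

Let sup_normD f g : sup_norm (f + g) <= sup_norm f + sup_norm g.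
Proof.
apply: sup_norm_le => [|x]; first by rewrite addr_ge0// sup_norm_ge0.
by rewrite sup_funD (le_trans (ler_normD _ _))// lerD// sup_norm_ubound.
Qed.

Let sup_normZ (a : R) f : sup_norm (a *: f) = `|a| * sup_norm f.
Proof.
have le b h : sup_norm (b *: h) <= `|b| * sup_norm h.
  apply: sup_norm_le => [|x]; first by rewrite mulr_ge0// sup_norm_ge0.
  by rewrite sup_funZ normrM ler_wpM2l// sup_norm_ubound.
apply/eqP; rewrite eq_le le/=.
have [->|a0] := eqVneq a 0; first by rewrite normr0 mul0r sup_norm_ge0.
rewrite -ler_pdivlMl ?normr_gt0// -normfV.
by rewrite -[f in leLHS](scalerK a0) le.
Qed.

Let sup_norm0_eq0 f : sup_norm f = 0 -> f = 0.
Proof.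
move=> f0; apply: sup_spaceP => x; apply/eqP.
by rewrite -[X in _ == X]/(0 : R) -normr_le0 -f0 sup_norm_ubound.
Qed.

HB.instance Definition _ := Lmodule_isNormed.Build R (sup_space S)
  sup_normD sup_normZ sup_norm0_eq0.

Definition sup_le f g : Prop := forall x, f x <= g x.

Let sup_join_subproof f g : (f \max g) \in supl_pred S.
Proof.
by apply/mem_set/supl_max; exact: set_mem (sup_funP _).
Qed.

Definition sup_join f g : sup_space S := SupSpace (sup_join_subproof f g).

Definition sup_meet f g : sup_space S := - sup_join (- f) (- g).

Let sup_meetE f g x : sup_meet f g x = Num.min (f x) (g x).
Proof. by rewrite [LHS]oppr_max -!sup_funN !opprK. Qed.

Let sup_le_refl f : sup_le f f. Proof. by move=> x. Qed.

Let sup_le_anti f g : sup_le f g -> sup_le g f -> f = g.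
Proof. by move=> fg gf; apply: sup_spaceP => x; apply/le_anti; rewrite fg gf. Qed.

Let sup_le_trans f g h : sup_le f g -> sup_le g h -> sup_le f h.
Proof. by move=> fg gh x; exact: le_trans (gh x). Qed.

Let sup_joinP f g h : sup_le (sup_join f g) h <-> sup_le f h /\ sup_le g h.
Proof.
split=> [fgh|[fh gh] x]; last by rewrite /= ge_max fh gh.
by split=> x; have := fgh x; rewrite /= ge_max => /andP[].
Qed.

Let sup_meetP f g h : sup_le h (sup_meet f g) <-> sup_le h f /\ sup_le h g.
Proof.
split=> [hfg|[hf hg] x]; last by rewrite sup_meetE le_min hf hg.
by split=> x; have := hfg x; rewrite sup_meetE le_min => /andP[].
Qed.

Let sup_leD2l h f g : sup_le f g -> sup_le (h + f) (h + g).
Proof. by move=> fg x; rewrite !sup_funD lerD2l. Qed.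

Let sup_scale_ge0 (a : R) f : 0 <= a -> sup_le 0 f -> sup_le 0 (a *: f).
Proof. by move=> a0 f0 x; rewrite sup_funZ mulr_ge0//; exact: f0. Qed.

Let sup_norm_mono f g :
  sup_le (sup_join f (- f)) (sup_join g (- g)) -> `|f| <= `|g|.
Proof.
move=> fg; apply: sup_norm_le => [|x]; first exact: sup_norm_ge0.
apply: le_trans (sup_norm_ubound g x).
by rewrite -maxrN -[leRHS]maxrN; exact: fg.
Qed.

HB.instance Definition _ := NormedModule_isNormedLattice.Build R (sup_space S)
  sup_le_refl sup_le_anti sup_le_trans sup_joinP sup_meetP sup_leD2l
  sup_scale_ge0 sup_norm_mono.

End sup_space.

Section continuous_functions.
Context (R : realType) (K : topologicalType) (cK : compact [set: K]).

Let cont_submod : submod_closed [in [set f : K -> R | continuous f]].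
Proof.
split=> [|a f g]; rewrite !inE /=; first by move=> x; exact: cvg_cst.
by move=> cf cg x; apply: cvgD; [apply: cvgZl_tmp; exact: cf|exact: cg].
Qed.

Let cont_max (f g : K -> R) :
  continuous f -> continuous g -> continuous (f \max g).
Proof. by move=> cf cg x; apply: continuous_max; [exact: cf|exact: cg]. Qed.

Let cont_bounded (f : K -> R) :
  continuous f -> has_ubound (range (fun x => `|f x|)).
Proof.
move=> cf; have : compact (range f).
  by apply: continuous_compact => //; exact: continuous_subspaceT.
move=> /compact_bounded[M [_ MM]]; exists (M + 1) => _ [x _ <-].
by apply: MM; [rewrite ltrDl|exists x].
Qed.

Definition cont_lattice : sup_lattice R K :=
  SupLattice cont_submod cont_max cont_bounded.

Definition contC := sup_space cont_lattice.

End continuous_functions.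

Section convergent_sequences.
Context (R : realType).

Let cvgn_submod : submod_closed [in [set u : nat -> R | cvgn u]].
Proof.
split=> [|a u v]; rewrite !inE /=; first exact: is_cvg_cst.
by move=> cu cv; apply: is_cvgD => //; exact: is_cvgZl_tmp.
Qed.

Let cvgn_max (u v : nat -> R) : cvgn u -> cvgn v -> cvgn (u \max v).
Proof.
move=> /cvg_ex[l ul] /cvg_ex[m vm]; apply/cvg_ex; exists (Num.max l m).
have -> : u \max v = (fun n => Num.max (u n) (v n)) by [].
have max_cont : continuous (fun z : R * R => Num.max z.1 z.2).
  by move=> z; apply: continuous_max; [exact: cvg_fst|exact: cvg_snd].
exact: (cvg_comp2 ul vm (max_cont (l, m))).
Qed.

Let cvgn_bounded (u : nat -> R) :
  cvgn u -> has_ubound (range (fun n => `|u n|)).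
Proof.
move=> /cvg_seq_bounded[M [_ MM]]; exists (M + 1) => _ [n _ <-].
by apply: MM; rewrite // ltrDl.
Qed.

Definition cvg_lattice : sup_lattice R nat :=
  SupLattice cvgn_submod cvgn_max cvgn_bounded.

Definition cvg_seq_space := sup_space cvg_lattice.

End convergent_sequences.

Lemma ae_eq_Lnorm d (T : measurableType d) (R : realType)
    (mu : {measure set T -> \bar R}) (p : \bar R) (f g : T -> R) :
  measurable_fun [set: T] f -> measurable_fun [set: T] g ->
  f = g %[ae mu] -> ('N[mu]_p[EFin \o f] = 'N[mu]_p[EFin \o g])%E.
Proof.
move=> mf mg fg; rewrite unlock /Lnorm; case: p => [r||].
- congr poweR; apply: ae_eq_integral => //.
  + apply: (measurableT_comp (measurable_poweR _)); apply: measurableT_comp => //.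
    exact: measurableT_comp.
  + apply: (measurableT_comp (measurable_poweR _)); apply: measurableT_comp => //.
    exact: measurableT_comp.
  + by apply: filterS fg => x /[apply] /= ->.
- by case: ifPn => // _; apply: eq_ess_sup; apply: filterS fg => x /= ->.
- by case: ifPn => // _; apply: eq_ess_inf; apply: filterS fg => x /= ->.
Qed.

Lemma ae_le_Lnorm d (T : measurableType d) (R : realType)
    (mu : {measure set T -> \bar R}) (p : \bar R) (f g : T -> R) :
  (1 <= p)%E -> measurable_fun [set: T] f -> measurable_fun [set: T] g ->
  {ae mu, forall x, `|f x| <= `|g x|} ->
  ('N[mu]_p[EFin \o f] <= 'N[mu]_p[EFin \o g])%E.
Proof.
have mpow (h : T -> R) r : measurable_fun [set: T] h ->
    measurable_fun [set: T] (fun x => `|(EFin \o h) x| `^ r)%E.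
  move=> mh; apply: (measurableT_comp (measurable_poweR _)).
  by apply: measurableT_comp => //; exact: measurableT_comp.
move=> p1 mf mg fg; rewrite unlock /Lnorm; case: p p1 => [r r1|_|//].
- have r0 : 0 <= r by rewrite (le_trans ler01).
  have leP (a b : \bar R) s : 0 <= s -> (0 <= a -> a <= b -> a `^ s <= b `^ s)%E.
    move=> s0 a0 ab; apply: gt0_ler_poweR => //; rewrite in_itv/= leey andbT//.
    exact: le_trans ab.
  apply: leP; rewrite ?invr_ge0//.
    by apply: integral_ge0 => x _; exact: poweR_ge0.
  apply: ae_ge0_le_integral => //; [by move=> x _; exact: poweR_ge0|exact: mpow|
    by move=> x _; exact: poweR_ge0|exact: mpow|].
  by apply: filterS fg => x fgx _; rewrite /= lee_fin ge0_ler_powR ?nnegrE.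
- case: ifPn => // _; apply: le_ess_sup.
  by apply: filterS fg => x; rewrite /= lee_fin.
Qed.

Section Lspace_lattice.
Context d (T : measurableType d) (R : realType).
Context (mu : {measure set T -> \bar R}) (p : \bar R) (p1 : (1 <= p)%E).
Local Notation L := (LspaceType mu p1).
Local Notation Lf := (LfunType mu p1).
Local Open Scope quotient_scope.

(* Retyping: the quotient underlying LspaceType takes measurableTypeR R as     *)
(* codomain where LfunType takes R.                                            *)
Definition Lfun_mfun (f : Lf) : T -> measurableTypeR R := f.

HB.instance Definition _ (f : Lf) :=
  @isMeasurableFun.Build _ _ T (measurableTypeR R) (Lfun_mfun f)
    (measurable_funPT f).

Definition Lclass_mfun (f : Lf) : {mfun_ mu, T >-> measurableTypeR R} :=
  \pi_({mfun_ mu, T >-> measurableTypeR R})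
    (Lfun_mfun f : {mfun T >-> measurableTypeR R}).

Let Lclass_mfunP (f : Lf) : (Lclass_mfun f : T -> R) = f %[ae mu].
Proof.
have /eqmodP/asboolP := reprK (Lclass_mfun f).
exact.
Qed.

Let repr_measurable (f : {mfun_ mu, T >-> measurableTypeR R}) :
  measurable_fun [set: T] (f : T -> R).
Proof. exact: (@measurable_funPT _ _ T (measurableTypeR R) (repr f)). Qed.

Let Lclass_subproof (f : Lf) : finite_norm mu p (Lclass_mfun f : T -> R).
Proof.
rewrite /finite_norm (ae_eq_Lnorm p _ _ (Lclass_mfunP f))//.
exact: Lfunction_finite.
Qed.

HB.instance Definition _ (f : Lf) :=
  isFinLebesgue.Build d T R mu p p1 (Lclass_mfun f) (Lclass_subproof f).

Definition Lclass (f : Lf) : L := Lclass_mfun f.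

Definition Lrepr_fun (f : L) : T -> R := f.

HB.instance Definition _ (f : L) :=
  @isMeasurableFun.Build _ _ T R (Lrepr_fun f) (repr_measurable f).

HB.instance Definition _ (f : L) :=
  @isLfunction.Build d T R mu p p1 (Lrepr_fun f)
    (@Lebesgue_finite _ _ _ _ _ _ f).

Definition Lrepr (f : L) : Lf := Lrepr_fun f.

Lemma LclassK (f : Lf) : Lrepr (Lclass f) = f %[ae mu].
Proof. exact: Lclass_mfunP. Qed.

Lemma Lspace_eqP (f g : L) : f = g <-> Lrepr f = Lrepr g %[ae mu].
Proof.
split=> [->|fg]; first exact: ae_eq_refl.
have : LebesgueSpace.sort f = LebesgueSpace.sort g.
  by rewrite -[LHS]reprK -[RHS]reprK; apply/eqmodP/asboolP.
case: f g {fg} => [f [[ff]]] [g [[gf]]] /= fg.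
by rewrite fg in ff *; congr LebesgueSpace.Pack; congr LebesgueSpace.Class;
  congr isFinLebesgue.Axioms_; exact: Prop_irrelevance.
Qed.

Lemma eq_Lclass (f g : Lf) : f = g %[ae mu] -> Lclass f = Lclass g.
Proof.
move=> fg; apply/Lspace_eqP; apply: ae_eq_trans (LclassK f) _.
by apply: ae_eq_trans fg _; apply: ae_eq_sym; exact: LclassK.
Qed.

Lemma LreprK (f : L) : Lclass (Lrepr f) = f.
Proof. by apply/Lspace_eqP; exact: LclassK. Qed.

HB.instance Definition _ := gen_eqMixin L.
HB.instance Definition _ := gen_choiceMixin L.

Let Ladd (f g : L) : L := Lclass (Lrepr f + Lrepr g).
Let Lopp (f : L) : L := Lclass (- Lrepr f).
Let Lscale (a : R) (f : L) : L := Lclass (a *: Lrepr f).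

Let LaddE (f g : Lf) : Ladd (Lclass f) (Lclass g) = Lclass (f + g).
Proof.
apply: eq_Lclass; apply: filterS2 (LclassK f) (LclassK g).
by move=> x fx gx xT; congr (_ + _); [exact: fx|exact: gx].
Qed.

Let LoppE (f : Lf) : Lopp (Lclass f) = Lclass (- f).
Proof.
apply: eq_Lclass; apply: filterS (LclassK f).
by move=> x fx xT; congr (- _); exact: fx.
Qed.

Let LscaleE (a : R) (f : Lf) : Lscale a (Lclass f) = Lclass (a *: f).
Proof.
apply: eq_Lclass; apply: filterS (LclassK f).
by move=> x fx xT; congr (_ * _); exact: fx.
Qed.

Let LaddA : associative Ladd.
Proof.
move=> f g h; rewrite -(LreprK f) -(LreprK g) -(LreprK h).
by rewrite !LaddE addrA.
Qed.

Let LaddC : commutative Ladd.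
Proof. by move=> f g; rewrite /Ladd addrC. Qed.

Let Ladd0 : left_id (Lclass 0) Ladd.
Proof. by move=> f; rewrite -(LreprK f) LaddE add0r. Qed.

Let LaddN : left_inverse (Lclass 0) Lopp Ladd.
Proof. by move=> f; rewrite -(LreprK f) LoppE LaddE addNr. Qed.

HB.instance Definition _ := GRing.isZmodule.Build L LaddA LaddC Ladd0 LaddN.

Let LscaleA (a b : R) f : Lscale a (Lscale b f) = Lscale (a * b) f.
Proof. by rewrite -(LreprK f) !LscaleE scalerA. Qed.

Let Lscale1 : left_id 1 Lscale.
Proof. by move=> f; rewrite -(LreprK f) LscaleE scale1r. Qed.

Lemma LclassD (f g : Lf) : Lclass (f + g) = Lclass f + Lclass g.
Proof. by rewrite -LaddE. Qed.

Lemma LclassN (f : Lf) : Lclass (- f) = - Lclass f.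
Proof. by rewrite -LoppE. Qed.

Let LscaleDr : right_distributive Lscale +%R.
Proof.
move=> a f g; rewrite -(LreprK f) -(LreprK g) -LclassD.
by rewrite 3!LscaleE scalerDr LclassD.
Qed.

Let LscaleDl f : {morph Lscale^~ f : a b / a + b}.
Proof.
by move=> a b; rewrite -(LreprK f) 3!LscaleE scalerDl LclassD.
Qed.

HB.instance Definition _ := GRing.Zmodule_isLmodule.Build R L
  LscaleA Lscale1 LscaleDr LscaleDl.

Lemma LclassZ (a : R) (f : Lf) : Lclass (a *: f) = a *: Lclass f.
Proof. by rewrite -LscaleE. Qed.

Definition Lspace_norm (f : L) : R := fine ('N[mu]_p[EFin \o Lrepr f])%E.

Lemma Lspace_normE (f : Lf) :
  Lspace_norm (Lclass f) = fine ('N[mu]_p[EFin \o f])%E.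
Proof. by rewrite /Lspace_norm (ae_eq_Lnorm p _ _ (LclassK f)). Qed.

Let Lspace_normD f g : Lspace_norm (f + g) <= Lspace_norm f + Lspace_norm g.
Proof.
rewrite -(LreprK f) -(LreprK g) -LclassD !Lspace_normE.
exact: ler_LnormD.
Qed.

Let Lspace_normZ (a : R) f : Lspace_norm (a *: f) = `|a| * Lspace_norm f.
Proof.
rewrite -(LreprK f) -LclassZ !Lspace_normE.
by apply: EFin_inj; rewrite EFinM !finite_norm_fine -LnormZ.
Qed.

Let Lspace_norm0_eq0 f : Lspace_norm f = 0 -> f = 0.
Proof.
move=> /fine_Lnormr_eq0 f0; apply/Lspace_eqP.
by apply: ae_eq_trans f0 _; apply: ae_eq_sym; exact: LclassK.
Qed.

HB.instance Definition _ := Lmodule_isNormed.Build R L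
  Lspace_normD Lspace_normZ Lspace_norm0_eq0.

Definition Lspace_le (f g : L) : Prop :=
  {ae mu, forall x, Lrepr f x <= Lrepr g x}.

Lemma Lspace_leE (f g : Lf) :
  Lspace_le (Lclass f) (Lclass g) <-> {ae mu, forall x, f x <= g x}.
Proof.
split; apply: filterS3 (LclassK f) (LclassK g) => x /(_ I) -> /(_ I) ->;
  exact.
Qed.

Let Lmax_mfun (f g : Lf) : measurable_fun [set: T] (f \max g).
Proof. by apply: measurable_maxr; exact: measurable_funPT. Qed.

Let Lmax_finite (f g : Lf) : finite_norm mu p (f \max g).
Proof.
pose h : T -> R := (Num.norm \o f) \+ (Num.norm \o g).
have mh : measurable_fun [set: T] h.
  by apply: measurable_funD; apply: measurableT_comp => //;
    exact: measurable_funPT.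
have -> : finite_norm mu p (f \max g) = ('N[mu]_p[EFin \o (f \max g)] < +oo)%E.
  by [].
apply: (@le_lt_trans _ _ 'N[mu]_p[EFin \o h]%E).
  apply: ae_le_Lnorm => //.
  apply: nearW => x; rewrite /h /= [leRHS]ger0_norm ?addr_ge0//.
  by rewrite maxEle; case: ifP => _; rewrite ?lerDl ?lerDr normr_ge0.
have mn (u : Lf) : measurable_fun [set: T] (Num.norm \o u).
  by apply: measurableT_comp => //; exact: measurable_funPT.
have fn (u : Lf) : ('N[mu]_p[EFin \o (Num.norm \o u)] < +oo)%E.
  rewrite (_ : EFin \o _ = abse \o (EFin \o u))%E//.
  by rewrite Lnorm_abse; exact: Lfunction_finite.
apply: le_lt_trans (eminkowski mu (mn f) (mn g) p1) _.
by rewrite lte_add_pinfty.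
Qed.

Definition Lmax_fun (f g : Lf) : T -> R := f \max g.

HB.instance Definition _ f g :=
  @isMeasurableFun.Build _ _ T R (Lmax_fun f g) (Lmax_mfun f g).

HB.instance Definition _ f g :=
  @isLfunction.Build d T R mu p p1 (Lmax_fun f g) (Lmax_finite f g).

Definition Lmax (f g : Lf) : Lf := Lmax_fun f g.

Definition Lspace_join (f g : L) : L := Lclass (Lmax (Lrepr f) (Lrepr g)).

Lemma Lspace_joinE (f g : Lf) :
  Lspace_join (Lclass f) (Lclass g) = Lclass (Lmax f g).
Proof.
apply: eq_Lclass; apply: filterS2 (LclassK f) (LclassK g).
by move=> x fx gx xT; congr Num.max; [exact: fx|exact: gx].
Qed.

Definition Lspace_meet (f g : L) : L := - Lspace_join (- f) (- g).

Let Lspace_le_refl f : Lspace_le f f.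
Proof. by apply: nearW => x. Qed.

Let Lspace_le_anti f g : Lspace_le f g -> Lspace_le g f -> f = g.
Proof.
move=> fg gf; apply/Lspace_eqP; apply: filterS2 fg gf => x fg gf _.
by apply/le_anti; rewrite fg gf.
Qed.

Let Lspace_le_trans f g h : Lspace_le f g -> Lspace_le g h -> Lspace_le f h.
Proof. by apply: filterS2 => x; exact: le_trans. Qed.

Let Lspace_joinP f g h :
  Lspace_le (Lspace_join f g) h <-> Lspace_le f h /\ Lspace_le g h.
Proof.
rewrite -(LreprK f) -(LreprK g) -(LreprK h) Lspace_joinE !Lspace_leE.
split=> [fgh|[]].
  by split; apply: filterS fgh => x /=; rewrite /Lmax_fun /= ge_max => /andP[].
by apply: filterS2 => x fh gh; rewrite /Lmax /Lmax_fun /= ge_max fh gh.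
Qed.

Let Lspace_leD2l h f g : Lspace_le f g -> Lspace_le (h + f) (h + g).
Proof.
rewrite -(LreprK f) -(LreprK g) -(LreprK h) -!LclassD !Lspace_leE.
by apply: filterS => x fg; rewrite lerD2l.
Qed.

Let Lspace_leN f g : Lspace_le f g -> Lspace_le (- g) (- f).
Proof.
by move=> /(Lspace_leD2l (- f - g)); rewrite addrAC addNr add0r addrNK.
Qed.

Let Lspace_meetP f g h :
  Lspace_le h (Lspace_meet f g) <-> Lspace_le h f /\ Lspace_le h g.
Proof.
have leN u v : Lspace_le u (- v) <-> Lspace_le v (- u).
  by split=> /Lspace_leN; rewrite opprK.
rewrite leN Lspace_joinP; split=> -[]; move=> /Lspace_leN + /Lspace_leN;
  by rewrite ?opprK.
Qed.

Let Lspace_scale_ge0 (a : R) f :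
  0 <= a -> Lspace_le 0 f -> Lspace_le 0 (a *: f).
Proof.
move=> a0; rewrite -(LreprK f) -LclassZ !Lspace_leE.
by apply: filterS => x fx; apply: mulr_ge0.
Qed.

Let Lspace_norm_mono f g :
  Lspace_le (Lspace_join f (- f)) (Lspace_join g (- g)) -> `|f| <= `|g|.
Proof.
rewrite -(LreprK f) -(LreprK g) -!LclassN !Lspace_joinE Lspace_leE => fg.
rewrite [leLHS]Lspace_normE [leRHS]Lspace_normE -lee_fin !finite_norm_fine.
apply: ae_le_Lnorm => //.
by apply: filterS fg => x; rewrite -!maxrN.
Qed.

HB.instance Definition _ := NormedModule_isNormedLattice.Build R L
  Lspace_le_refl Lspace_le_anti Lspace_le_trans Lspace_joinP Lspace_meetP
  Lspace_leD2l Lspace_scale_ge0 Lspace_norm_mono.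

End Lspace_lattice.

Section unit_interval.
Context (R : realType).

Definition unit_interval : topologicalType := set_type `[0 : R, 1].

Let clamp (x : R) : R := Num.max 0 (Num.min x 1).

Let clamp_in x : clamp x \in `[0 : R, 1]%classic.
Proof.
by rewrite inE /= in_itv /= le_max lexx ge_max ler01 ge_min lexx orbT.
Qed.

Let to_unit (x : R) : unit_interval := exist _ (clamp x) (clamp_in x).

Let to_unit_continuous : continuous to_unit.
Proof.
apply: continuous_comp_initial => x.
have cmin : {for x, continuous (@idfun R \min cst 1)}.
  by apply: continuous_min; [exact: cvg_id|exact: cvg_cst].
by apply: (@continuous_max _ _ (cst 0)) cmin; exact: cvg_cst.
Qed.

Lemma unit_interval_compact : compact [set: unit_interval].
Proof.
have -> : [set: unit_interval] = to_unit @` `[0, 1].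
  apply/seteqP; split=> // -[x xP] _; have x01 := set_mem xP.
  exists x => //; apply/val_inj => /=.
  move: x01; rewrite /= in_itv /= => /andP[x0 x1].
  by rewrite /clamp (min_idPl x1) (max_idPr x0).
apply: continuous_compact; last exact: segment_compact.
by apply: continuous_subspaceT; exact: to_unit_continuous.
Qed.

End unit_interval.

(* L_p of the real line for the restriction of Lebesgue measure to [0, 1]:     *)
(* values outside [0, 1] are negligible.                                       *)
Definition Lp01 (R : realType) (p : \bar R) (p1 : (1 <= p)%E) :
    normedLatticeType R :=
  LspaceType (mrestr lebesgue_measure (measurable_itv `[0 : R, 1])) p1.

Definition C01 (R : realType) : normedLatticeType R :=
  contC R (@unit_interval_compact R).

Definition CCantor (R : realType) : normedLatticeType R :=
  contC R cantor_space_compact.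

Definition c_space (R : realType) : normedLatticeType R := cvg_seq_space R.

Definition closed_subspace (R : realType) (X : normedModType R) (E : set X) :=
  submod_closed [in E] /\ closed E.

Definition isomorphic_subspaces (R : realType) (X Y : normedModType R)
    (E : set X) (F : set Y) : Prop :=
  exists (f : X -> Y) (g : Y -> X),
    [/\ forall (a : R) x y, E x -> E y -> f (a *: x + y) = a *: f x + f y,
        (forall x, E x -> F (f x)) /\ (forall y, F y -> E (g y)),
        (forall x, E x -> g (f x) = x) /\ (forall y, F y -> f (g y) = y),
        {within E, continuous f} &
        {within F, continuous g}].

Section dispersed_and_SPR.
Context (R : realType) (X : normedLatticeType R).
Implicit Types (E : set X) (x d : nat -> X).

Definition disjoint_seq d : Prop :=
  forall n m, n <> m -> lat_meet (modulus (d n)) (modulus (d m)) = 0.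

Definition normalized_almost_disjoint x : Prop :=
  (forall n, `|x n| = 1) /\
  exists2 d, disjoint_seq d & `|x n - d n| @[n --> \oo] --> (0 : R).

Definition dispersed_subspace E : Prop :=
  closed_subspace E /\
  ~ exists2 x, (forall n, E (x n)) & normalized_almost_disjoint x.

Definition stable_phase_retrieval E : Prop :=
  exists C : R, forall f g, E f -> E g ->
    Num.min `|f - g| `|f + g| <= C * `|modulus f - modulus g|.

End dispersed_and_SPR.

Definition dispersed_have_SPR_copies (R : realType) (X : normedLatticeType R) :
    Prop :=
  forall E : set X, dispersed_subspace E ->
  exists E' : set X,
    [/\ closed_subspace E', isomorphic_subspaces E E' &
        stable_phase_retrieval E'].

Definition directed (I : Type) (le : I -> I -> Prop) : Prop :=
  [/\ inhabited I,
      forall i, le i i,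
      forall i j k, le i j -> le j k -> le i k &
      forall i j, exists2 k, le i k & le j k].

Section order_continuous_atomic.
Context (R : realType) (X : normedLatticeType R).
Implicit Types a b x : X.

Definition decreasing_to0 (I : Type) (le : I -> I -> Prop) (x : I -> X) :
    Prop :=
  [/\ forall i j, le i j -> lat_le (x j) (x i),
      forall i, lat_le 0 (x i) &
      forall y, (forall i, lat_le y (x i)) -> lat_le y 0].

Definition order_continuous : Prop :=
  forall (I : Type) (le : I -> I -> Prop) (x : I -> X),
    directed le -> decreasing_to0 le x ->
    forall e : R, 0 < e -> exists i, forall j, le i j -> `|x j| < e.

Definition atom a : Prop :=
  [/\ a <> 0, lat_le 0 a &
      forall b, lat_le 0 b -> lat_le b a -> exists r : R, b = r *: a].

Definition atomic : Prop :=
  forall x, x <> 0 -> lat_le 0 x -> exists2 a, atom a & lat_le a x.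

(* In the order continuous atomic case the theorem fails in finite dimension:  *)
(* R^2 is a dispersed subspace of itself, and is its only 2-dimensional        *)
(* subspace, but (1, 1) and (1, -1) have the same modulus.                     *)
Definition infinite_dimensional : Prop :=
  forall (n : nat) (e : 'I_n -> X),
    exists x, forall c : 'I_n -> R, x <> \sum_(i < n) c i *: e i.

End order_continuous_atomic.

(* Main.v *)
Require Import Defs.
From mathcomp Require Import all_boot all_order all_algebra.
From mathcomp Require Import all_classical all_reals all_analysis.
From mathcomp Require Import measurable_realfun ess_sup_inf.
From mathcomp Require Import ring lra.

Set Implicit Arguments.
Unset Strict Implicit.
Unset Printing Implicit Defensive.

Import Order.TTheory GRing.Theory Num.Theory.
Import numFieldNormedType.Exports.

Local Open Scope classical_set_scope.
Local Open Scope ring_scope.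

(** With real scalars, put [u = f + g] and [v = f - g]. The modulus of
    [|f| - |g|] dominates [|u| /\ |v|] ([meet_modulus_le]), so a subspace does
    stable phase retrieval as soon as the norm of [|u| /\ |v|] is bounded below
    for [u] and [v] in its unit sphere. The copy of [E] is therefore the image
    of [E] under a bounded linear map [T] for which [|T u| /\ |T v|] stays away
    from [0] ([SPR_copy]).

    In a space of functions on [K], let [T f = f o s + f o t] for a path
    [x |-> (s x, t x)] filling [K x K]. If [|u|] is large at [a] and [|v|] at
    [b], then both are large at [a], or both at [b], or neither [u a + u b] nor
    [v a + v b] is small ([large_on_pair]): so [T u] and [T v] are both large at
    some point above [(a, a)], [(b, b)] or [(a, b)]. If moreover [s o k = id]
    and [t o k = id], then [T f o k = 2 f], so [T] has a left inverse and its
    image is closed. On the Cantor set [s] and [t] separate the even from the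
    odd terms; on the unit interval they run along the diagonal and then along
    a Peano curve ([peano_curve]).

    In [L_p] the same [T] works, because the coordinates of the Peano curve are
    independent and uniformly distributed ([peano_independent]), so that a
    rectangle is met on a set of proportional measure. For [p] finite, the
    argument of Kadec and Pelczynski gives an [e > 0] such that every unit
    vector of a dispersed subspace is at least [e] on a set of measure at least
    [e] ([dispersed_levels]).

    In [c] and in order continuous atomic lattices, a gliding hump
    ([gliding_hump]) shows that a dispersed subspace meets the common kernel of
    finitely many coordinates trivially, hence has finite dimension. There [T]
    places the sums [c i + c j] of the coordinates of a vector on the members
    of a normalized disjoint sequence ([finite_dim_SPR_copy]), which an atomic
    lattice contains when its dimension is infinite
    ([disjoint_unit_sequence]). *)

(** * Vector lattices *)

Arguments lat_le_trans {R s x y z}.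
Arguments lat_leD2l {R s} z {x y}.
Arguments lat_joinP {R s x y z}.
Arguments lat_meetP {R s x y z}.
Arguments lat_scale_ge0 {R s a x}.
Arguments lat_norm_le {R s x y}.
Arguments lat_le_anti {R s x y}.

Section vector_lattice.
Context (R : realType) (X : normedLatticeType R).
Implicit Types (x y z w f g a : X) (c e : R).

Lemma lat_le_join x y : lat_le x (lat_join x y) /\ lat_le y (lat_join x y).
Proof. by apply/lat_joinP; exact: lat_le_refl. Qed.

Lemma lat_meet_le x y : lat_le (lat_meet x y) x /\ lat_le (lat_meet x y) y.
Proof. by apply/lat_meetP; exact: lat_le_refl. Qed.

Lemma lat_leD2r z x y : lat_le x y -> lat_le (x + z) (y + z).
Proof. by rewrite ![_ + z]addrC; exact: lat_leD2l. Qed.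

Lemma lat_leD x y z w : lat_le x y -> lat_le z w -> lat_le (x + z) (y + w).
Proof.
by move=> xy zw; apply: lat_le_trans (lat_leD2l x zw) _; exact: lat_leD2r.
Qed.

Lemma lat_subr_ge0 x y : lat_le 0 (y - x) <-> lat_le x y.
Proof.
split=> [/(lat_leD2l x)|/(lat_leD2l (- x))]; first by rewrite addr0 subrKC.
by rewrite addNr addrC.
Qed.

Lemma lat_leN2 x y : lat_le (- x) (- y) <-> lat_le y x.
Proof. by rewrite -lat_subr_ge0 -(lat_subr_ge0 y x) opprK addrC. Qed.

Lemma lat_leBlDr x y z : lat_le (x - y) z <-> lat_le x (z + y).
Proof. by rewrite -lat_subr_ge0 -(lat_subr_ge0 x) opprB addrA. Qed.

Lemma lat_leBrDr x y z : lat_le x (y - z) <-> lat_le (x + z) y.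
Proof. by rewrite -lat_subr_ge0 -(lat_subr_ge0 _ y) opprD addrA addrAC. Qed.

Lemma lat_leZ2l c x y : 0 <= c -> lat_le x y -> lat_le (c *: x) (c *: y).
Proof.
move=> c0 /lat_subr_ge0 xy; apply/lat_subr_ge0.
by rewrite -scalerBr; exact: lat_scale_ge0.
Qed.

Lemma lat_leZ2r c e x : lat_le 0 x -> c <= e -> lat_le (c *: x) (e *: x).
Proof.
move=> x0 ce; apply/lat_subr_ge0; rewrite -scalerBl.
by apply: lat_scale_ge0; rewrite ?subr_ge0.
Qed.

Lemma lat_joinC x y : lat_join x y = lat_join y x.
Proof.
by apply: lat_le_anti; apply/lat_joinP; split; apply lat_le_join.
Qed.

Lemma lat_meetC x y : lat_meet x y = lat_meet y x.
Proof.
by apply: lat_le_anti; apply/lat_meetP; split; apply lat_meet_le.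
Qed.

Lemma lat_joinDl z x y : lat_join (z + x) (z + y) = z + lat_join x y.
Proof.
apply: lat_le_anti.
  by apply/lat_joinP; split; apply: lat_leD2l; apply lat_le_join.
have [zx zy] := lat_le_join (z + x) (z + y).
rewrite -[X in lat_le _ X](subrKC z); apply: lat_leD2l; apply/lat_joinP.
by split; [move: zx|move: zy] => /(lat_leD2l (- z)); rewrite addKr addrC.
Qed.

Lemma lat_meetN x y : lat_meet (- x) (- y) = - lat_join x y.
Proof.
apply: lat_le_anti.
  apply/lat_leN2; rewrite opprK; apply/lat_joinP.
  by split; apply/lat_leN2; rewrite opprK; apply lat_meet_le.
by apply/lat_meetP; split; apply/lat_leN2; apply lat_le_join.
Qed.

Lemma lat_joinZ c x y : 0 <= c ->
  lat_join (c *: x) (c *: y) = c *: lat_join x y.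
Proof.
rewrite le_eqVlt => /predU1P[<-|c0].
  rewrite !scale0r; apply: lat_le_anti; last by apply lat_le_join.
  by apply/lat_joinP; split; exact: lat_le_refl.
apply: lat_le_anti.
  by apply/lat_joinP; split; apply: lat_leZ2l (ltW c0) _; apply lat_le_join.
have [cx cy] := lat_le_join (c *: x) (c *: y).
rewrite -[X in lat_le _ X](scalerKV (lt0r_neq0 c0)).
apply: lat_leZ2l (ltW c0) _; apply/lat_joinP.
by split; rewrite -[X in lat_le X _](scalerK (lt0r_neq0 c0));
  apply: lat_leZ2l => //; rewrite invr_ge0 ltW.
Qed.

(** The identity [x + y = (x /\ y) + (x \/ y)], which makes the lattice of any
    lattice-ordered group distributive. *)
Lemma lat_meetE x y : lat_meet x y = x + y - lat_join x y.
Proof.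
rewrite -[in LHS](opprK x) -[in LHS](opprK y) lat_meetN.
have -> : - x = - (x + y) + y by rewrite opprD addrNK.
have -> : - y = - (x + y) + x by rewrite opprD addrC addrA subrr add0r.
by rewrite lat_joinDl opprD opprK lat_joinC.
Qed.

Lemma lat_meet_join_le x y z :
  lat_le (lat_meet x (lat_join y z)) (lat_join (lat_meet x y) (lat_meet x z)).
Proof.
set m := lat_join (lat_meet x y) _; set j := lat_join x (lat_join y z).
have bound w : lat_le w (lat_join y z) -> lat_le (lat_meet x w) m ->
    lat_le w (m + j - x).
  move=> wyz wm; have -> : w = lat_meet x w + lat_join x w - x.
    by rewrite lat_meetE subrK addrC addKr.
  rewrite -!addrA; apply: lat_leD wm _; rewrite ![_ - x]addrC.
  apply/lat_leD2l/lat_joinP.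
  split; [by apply lat_le_join|apply: lat_le_trans wyz _].
  by apply lat_le_join.
rewrite lat_meetE -/j; apply/lat_leBlDr.
have : lat_le (lat_join y z) (m + j - x).
  by apply/lat_joinP; split; apply: bound; apply lat_le_join.
by move/(lat_leD2l x); rewrite addrCA subrr addr0.
Qed.

Lemma modulusP x y : lat_le (modulus x) y <-> lat_le x y /\ lat_le (- x) y.
Proof. exact: lat_joinP. Qed.

Lemma le_modulus x : lat_le x (modulus x) /\ lat_le (- x) (modulus x).
Proof. exact: lat_le_join. Qed.

Lemma modulusN x : modulus (- x) = modulus x.
Proof. by rewrite /modulus opprK lat_joinC. Qed.

Lemma modulus_ge0 x : lat_le 0 (modulus x).
Proof.
have [xm nxm] := le_modulus x.
have : lat_le 0 (modulus x + modulus x) by rewrite -(subrr x); apply: lat_leD.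
rewrite -mulr2n -scaler_nat => /(lat_leZ2l (c := 2^-1)).
by rewrite scaler0 scalerA mulVf ?pnatr_eq0// scale1r; apply; rewrite invr_ge0.
Qed.

Lemma modulus_pos x : lat_le 0 x -> modulus x = x.
Proof.
move=> x0; apply: lat_le_anti; last by apply le_modulus.
apply/modulusP; split; first exact: lat_le_refl.
by apply: (lat_le_trans _ x0); rewrite -[X in lat_le _ X]oppr0; apply/lat_leN2.
Qed.

Lemma modulusD x y : lat_le (modulus (x + y)) (modulus x + modulus y).
Proof.
by apply/modulusP; rewrite opprD; split; apply: lat_leD; apply le_modulus.
Qed.

Lemma modulusZ c x : modulus (c *: x) = `|c| *: modulus x.
Proof.
wlog c0 : c / 0 <= c => [wl|].
  have [|c0] := leP 0 c; first exact: wl.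
  by rewrite -modulusN -normrN -scaleNr wl// oppr_ge0 ltW.
by rewrite ger0_norm// /modulus -scalerN lat_joinZ.
Qed.

Lemma lat_meet_ge0 x y : lat_le 0 x -> lat_le 0 y -> lat_le 0 (lat_meet x y).
Proof. by move=> *; apply/lat_meetP. Qed.

Lemma lat_leS_meet x y z w : lat_le x y -> lat_le z w ->
  lat_le (lat_meet x z) (lat_meet y w).
Proof.
move=> xy zw; have [mx mz] := lat_meet_le x z.
by apply/lat_meetP; split; [exact: lat_le_trans xy|exact: lat_le_trans zw].
Qed.

Lemma lat_norm_modulus x : `|modulus x| = `|x|.
Proof.
have e : modulus (modulus x) = modulus x by rewrite modulus_pos//; exact: modulus_ge0.
by apply/eqP; rewrite eq_le; apply/andP; split; apply: lat_norm_le;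
  rewrite -!/(modulus _) e; exact: lat_le_refl.
Qed.

Lemma lat_norm_mono x y : lat_le (modulus x) y -> `|x| <= `|y|.
Proof.
move=> xy; apply: lat_norm_le; rewrite -!/(modulus _) (modulus_pos (x := y))//.
by apply: (lat_le_trans _ xy); exact: modulus_ge0.
Qed.

Lemma lat_norm_mono_pos x y : lat_le 0 x -> lat_le x y -> `|x| <= `|y|.
Proof. by move=> x0 xy; apply: lat_norm_mono; rewrite modulus_pos. Qed.

(** Distributing the meet of [(f + g) \/ - (f + g)] and [(f - g) \/ - (f - g)]
    leaves four meets such as [(f + g) /\ (f - g) = f - |g|], each of them at
    most [| |f| - |g| |]. So a lower bound on [|u| /\ |v|], for [u = f + g] and
    [v = f - g], is one for the difference of the moduli of [f] and [g]. *)
Lemma meet_modulus_le f g :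
  lat_le (lat_meet (modulus (f + g)) (modulus (f - g)))
         (modulus (modulus f - modulus g)).
Proof.
pose D := modulus (modulus f - modulus g).
have [Dl Dr] := le_modulus (modulus f - modulus g).
rewrite opprB in Dr; rewrite -/D in Dl Dr *.
have meetD z x y : lat_meet (z + x) (z + y) = z + lat_meet x y.
  rewrite !lat_meetE lat_joinDl opprD -!addrA; congr (_ + _).
  by rewrite (addrCA y) (addrA z) subrr add0r.
have mN x : lat_meet x (- x) = - modulus x.
  by rewrite -{1}(opprK x) lat_meetN lat_joinC.
apply: lat_le_trans (lat_meet_join_le _ _ _) _; apply/lat_joinP; split.
  rewrite lat_meetC; apply: lat_le_trans (lat_meet_join_le _ _ _) _.
  apply/lat_joinP; split.
    rewrite lat_meetC meetD mN; apply: (lat_le_trans _ Dl).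
    by apply: lat_leD2r; apply le_modulus.
  rewrite opprD (addrC (- f)) (addrC f) meetD mN; apply: (lat_le_trans _ Dr).
  by apply: lat_leD2r; apply le_modulus.
rewrite opprB lat_meetC; apply: lat_le_trans (lat_meet_join_le _ _ _) _.
apply/lat_joinP; split.
  rewrite (addrC f) meetD lat_meetC mN; apply: (lat_le_trans _ Dr).
  by apply: lat_leD2r; apply le_modulus.
rewrite opprD (addrC g) meetD mN; apply: (lat_le_trans _ Dl).
by apply: lat_leD2r; apply le_modulus.
Qed.

End vector_lattice.

(** * Stable phase retrieval for linear images *)

Lemma within_continuous_lipschitz (R : realType) (V W : normedModType R)
    (A : set V) (f : V -> W) (C : R) :
  (forall x y, A x -> A y -> `|f x - f y| <= C * `|x - y|) ->
  {within A, continuous f}.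
Proof.
move=> fC; apply/subspace_continuousP => x Ax.
apply/cvgrPdist_le => e e0; rewrite near_withinE.
have D0 : 0 < `|C| + 1 by rewrite ltr_wpDl.
near=> y => Ay; apply: le_trans (fC _ _ Ax Ay) _.
have xy : `|x - y| <= e / (`|C| + 1).
  near: y; apply: cvgr_dist_le; first exact: cvg_id.
  by rewrite divr_gt0.
apply: le_trans (_ : (`|C| + 1) * `|x - y| <= e).
  by rewrite ler_wpM2r// (le_trans (ler_norm C))// lerDl.
by rewrite mulrC -ler_pdivlMr.
Unshelve. all: by end_near. Qed.

Section transfer.
Context (R : realType) (X : normedLatticeType R).
Implicit Types (E : set X) (T : X -> X).

Lemma closed_subspaceD E x y : closed_subspace E -> E x -> E y -> E (x + y).
Proof.
move=> [[_ El] _] Ex Ey; have := El 1 x y.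
by rewrite scale1r !inE; exact.
Qed.

Lemma closed_subspaceZ E a x : closed_subspace E -> E x -> E (a *: x).
Proof.
move=> [[E0 El] _] Ex; have := El a x 0; rewrite addr0 !inE; apply => //.
by move: E0; rewrite inE.
Qed.

Lemma closed_subspaceB E x y : closed_subspace E -> E x -> E y -> E (x - y).
Proof.
move=> cE Ex Ey; apply: closed_subspaceD => //.
by rewrite -scaleN1r; exact: closed_subspaceZ.
Qed.

(** For [u = f + g] and [v = f - g] the smaller of [|T u|], [|T v|] is
    controlled by [|T u| /\ |T v|], and that by [| |T f| - |T g| |]. Taking
    [u = v] in the separation hypothesis shows that [T] is bounded below. *)
Lemma SPR_copy E T (C c : R) : closed_subspace E ->
  (forall a x y, E x -> E y -> T (a *: x + y) = a *: T x + T y) ->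
  0 <= C -> (forall x, E x -> `|T x| <= C * `|x|) ->
  0 < c ->
  (forall u v, E u -> E v -> `|u| = 1 -> `|v| = 1 ->
    c <= `|lat_meet (modulus (T u)) (modulus (T v))|) ->
  closed (T @` E) ->
  exists E' : set X, [/\ closed_subspace E', isomorphic_subspaces E E' &
                         stable_phase_retrieval E'].
Proof.
move=> cE Tlin C0 TC c0 Tsep TEcl.
have E0 : E 0 by case: (cE) => [[+ _] _]; rewrite inE.
have T0 : T 0 = 0.
  by have := Tlin (-1) 0 0 E0 E0; rewrite scaler0 addr0 scaleN1r addNr.
have TD x y : E x -> E y -> T (x + y) = T x + T y.
  by move=> Ex Ey; have := Tlin 1 x y Ex Ey; rewrite !scale1r.
have TZ a x : E x -> T (a *: x) = a *: T x.
  by move=> Ex; have := Tlin a x 0 Ex E0; rewrite T0 !addr0.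
have TB x y : E x -> E y -> T (x - y) = T x - T y.
  move=> Ex Ey; rewrite -scaleN1r TD ?TZ ?scaleN1r//.
  by rewrite -scaleN1r; exact: closed_subspaceZ.
have sep u v : E u -> E v ->
    c * Num.min `|u| `|v| <= `|lat_meet (modulus (T u)) (modulus (T v))|.
  move=> Eu Ev; have [->|u0] := eqVneq u 0.
    by rewrite normr0 min_l// mulr0.
  have [->|v0] := eqVneq v 0.
    by rewrite normr0 min_r// mulr0.
  set m := Num.min _ _; have m0 : 0 < m by rewrite lt_min !normr_gt0 u0.
  have unit (w : X) : w != 0 -> `| `|w|^-1 *: w| = 1.
    by move=> w0; rewrite normrZ normfV normr_id mulVf// normr_eq0.
  have Enorm w : E w -> E (`|w|^-1 *: w) by move=> ?; exact: closed_subspaceZ.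
  have below w : E w -> w != 0 -> m <= `|w| ->
      lat_le (m *: modulus (T (`|w|^-1 *: w))) (modulus (T w)).
    move=> Ew w0 mw; rewrite TZ// modulusZ scalerA -[X in lat_le _ X]scale1r.
    apply: lat_leZ2r; first exact: modulus_ge0.
    by rewrite normfV normr_id ler_pdivrMr ?normr_gt0// mul1r.
  have := Tsep _ _ (Enorm _ Eu) (Enorm _ Ev) (unit _ u0) (unit _ v0).
  rewrite -(ler_pM2r m0) => /le_trans; apply.
  rewrite mulrC -[X in X * _](gtr0_norm m0) -normrZ; apply: lat_norm_mono_pos.
    by apply: lat_scale_ge0 (ltW m0) _; apply: lat_meet_ge0; exact: modulus_ge0.
  apply/lat_meetP; split.
    apply: lat_le_trans (below u Eu u0 _); last by rewrite ge_min lexx.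
    by apply: lat_leZ2l (ltW m0) _; apply lat_meet_le.
  apply: lat_le_trans (below v Ev v0 _); last by rewrite ge_min lexx orbT.
  by apply: lat_leZ2l (ltW m0) _; apply lat_meet_le.
have Tlow u : E u -> c * `|u| <= `|T u|.
  move=> Eu; have := sep u u Eu Eu; rewrite minxx => /le_trans; apply.
  rewrite -[leRHS]lat_norm_modulus; apply: lat_norm_mono_pos.
    by apply: lat_meet_ge0; exact: modulus_ge0.
  by apply lat_meet_le.
have Tinj x y : E x -> E y -> T x = T y -> x = y.
  move=> Ex Ey Txy; apply/eqP; rewrite -subr_eq0 -normr_le0.
  have := Tlow _ (closed_subspaceB cE Ex Ey).
  by rewrite TB// Txy subrr normr0 pmulr_rle0.
pose S y := if pselect (exists2 x, E x & T x = y) is left h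
            then projT1 (cid2 h) else 0.
have SP y : (T @` E) y -> E (S y) /\ T (S y) = y.
  by rewrite /S => TEy; case: pselect => // h; case: (cid2 h).
exists (T @` E); split; first split => //.
- split; first by rewrite inE; exists 0.
  move=> a _ _ /set_mem[x Ex <-] /set_mem[y Ey <-]; rewrite inE.
  exists (a *: x + y); last exact: Tlin.
  by apply: closed_subspaceD => //; exact: closed_subspaceZ.
- exists T, S; split => //.
  + by split => [x Ex|y /SP[]//]; exists x.
  + split=> [x Ex|y /SP[]//].
    by have [ESx TSx] := SP (T x) (ex_intro2 _ _ x Ex erefl); exact: Tinj.
  + apply: (@within_continuous_lipschitz _ _ _ _ _ C) => x y Ex Ey.
    by rewrite -TB//; apply: TC; exact: closed_subspaceB.
  + apply: (@within_continuous_lipschitz _ _ _ _ _ c^-1) => x y /SP[Ex Tx].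
    move=> /SP[Ey Ty]; rewrite ler_pdivlMl// -[X in _ <= `|X - _|]Tx.
    rewrite -[X in _ <= `|_ - X|]Ty -TB//.
    by apply: Tlow; exact: closed_subspaceB.
- exists (C / c) => _ _ [f Ef <-] [g Eg <-].
  have EB := closed_subspaceB cE Ef Eg; have ED := closed_subspaceD cE Ef Eg.
  rewrite mulrAC ler_pdivlMr//.
  apply: (@le_trans _ _ (c * (C * Num.min `|f + g| `|f - g|))).
    rewrite mulrC (ler_pM2l c0) -TB// -TD// ge_min; apply/orP.
    have [fg|fg] := leP `|f + g| `|f - g|; last by left; exact: TC.
    by right; exact: TC.
  rewrite mulrCA; apply: (ler_wpM2l C0); apply: le_trans (sep _ _ ED EB) _.
  rewrite TB// TD// -[leRHS]lat_norm_modulus; apply: lat_norm_mono_pos.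
    by apply: lat_meet_ge0; exact: modulus_ge0.
  exact: meet_modulus_le.
Qed.

End transfer.

(** * Continuous functions on a compact space *)

(** The left inverse exhibits the image of [E] as the set of those fixed points of
    [T \o L] that [L] maps into [E], which is closed. *)
Lemma SPR_copy_retract (R : realType) (X : normedLatticeType R)
    (E : set X) (T L : X -> X) (C c : R) : closed_subspace E ->
  (forall a x y, T (a *: x + y) = a *: T x + T y) ->
  (forall x y, L (x - y) = L x - L y) ->
  0 <= C -> (forall x, `|T x| <= C * `|x|) -> (forall x, `|L x| <= C * `|x|) ->
  (forall x, L (T x) = x) ->
  0 < c ->
  (forall u v, E u -> E v -> `|u| = 1 -> `|v| = 1 ->
    c <= `|lat_meet (modulus (T u)) (modulus (T v))|) ->
  exists E' : set X, [/\ closed_subspace E', isomorphic_subspaces E E' &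
                         stable_phase_retrieval E'].
Proof.
move=> cE Tlin LB C0 TC LC LT c0 Tsep.
apply: (@SPR_copy _ _ E T C c) => //.
have cont f : (forall x y, f (x - y) = f x - f y) ->
    (forall x : X, `|f x : X| <= C * `|x|) -> continuous f.
  move=> fB fC; apply/continuous_subspace_setT.
  by apply: (@within_continuous_lipschitz _ _ _ _ _ C) => x y _ _; rewrite -fB.
have TB x y : T (x - y) = T x - T y.
  by rewrite addrC -scaleN1r Tlin scaleN1r addrC.
have cT := cont T TB TC; have cL := cont L LB LC.
have -> : T @` E = L @^-1` E `&` [set y | T (L y) - y = 0].
  apply/seteqP; split=> [_ [x Ex <-]|y [/= EL /eqP]].
    by rewrite /= LT; split => //; exact: subrr.
  by rewrite subr_eq0 => /eqP Ty; exists (L y).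
apply: closedI; first by move/continuous_closedP: cL; apply; exact: cE.2.
have cd : continuous (fun y => T (L y) - y).
  by move=> y; apply: cvgB; [exact: cvg_comp (cL y) (cT _)|exact: cvg_id].
have -> : [set y | T (L y) - y = 0] = (fun y => T (L y) - y) @^-1` [set 0] by [].
move/continuous_closedP: cd; apply.
by apply: accessible_closed_set1; apply: hausdorff_accessible; exact: norm_hausdorff.
Qed.

(** When [v] is small at [s] and [u] is small at [t], each of the sums over [s]
    and [t] has one dominant term, which is not cancelled. *)
Lemma large_on_pair (R : realType) (e us ut vs vt : R) :
  e <= `|us| -> e <= `|vt| ->
  [\/ e / 3 <= `|vs|, e / 3 <= `|ut| |
      e / 3 <= `|us + ut| /\ e / 3 <= `|vs + vt| ].
Proof.
move=> eu ev; have [vse|vse] := leP (e / 3) `|vs|; first exact: Or31.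
have [ute|ute] := leP (e / 3) `|ut|; first exact: Or32.
apply: Or33; split.
  have := ler_normB (us + ut) ut; rewrite addrK => h.
  by have := normr_ge0 ut; lra.
have := ler_normB (vs + vt) vs; rewrite [vs + vt]addrC addrK => h.
by have := normr_ge0 vs; lra.
Qed.

Section sup_spaces.
Context (R : realType) (T : Type) (S : sup_lattice R T).

Lemma modulus_supE (f : sup_space S) x :
  modulus f x = `|f x|.
Proof. by rewrite -maxrN. Qed.

Lemma meet_supE (f g : sup_space S) x :
  lat_meet f g x = Num.min (f x) (g x).
Proof. by rewrite [LHS]oppr_max -!sup_funN !opprK. Qed.

Lemma sup_norm1_large (f : sup_space S) :
  `|f| = 1 -> exists x, 1 / 2 <= `|f x|.
Proof.
move=> f1; apply: contrapT => /forallNP fs.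
suff : `|f| <= 1 / 2 by rewrite f1; lra.
apply: sup_norm_le => [|x]; first by rewrite divr_ge0.
by have /negP := fs x; rewrite -ltNge => /ltW.
Qed.

End sup_spaces.

Section continuous_functions.
Context (R : realType) (K : topologicalType) (cK : compact [set: K]).
Local Notation C := (contC R cK).
Implicit Types f g u v : C.

Lemma sup_space_continuous f : continuous f.
Proof. by have /set_mem := sup_funP f. Qed.

Section composition.
Variables (s : K -> K) (cs : continuous s).

Lemma contC_comp_subproof f : (f \o s) \in supl_pred (cont_lattice R cK).
Proof.
apply/mem_set; suff : continuous (f \o s) by [].
by move=> x; apply: continuous_comp; [exact: cs|exact: sup_space_continuous].
Qed.

Definition contC_comp f : C := SupSpace (contC_comp_subproof f).

Lemma contC_comp_linear a f g :
  contC_comp (a *: f + g) = a *: contC_comp f + contC_comp g.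
Proof. exact: sup_spaceP. Qed.

Lemma contC_comp_norm f : `|contC_comp f| <= `|f|.
Proof.
by apply: sup_norm_le => [|x]; [exact: sup_norm_ge0|exact: (sup_norm_ubound f (s x))].
Qed.

End composition.

(** At a point of the path above [(a, b)] the image of [f] is [f a + f b], so
    [large_on_pair] yields a point where both images are large. Composing with
    the section [k] of the diagonal doubles [f], which inverts the map. *)
Lemma contC_SPR_copies (s t k : K -> K) :
  continuous s -> continuous t -> continuous k -> cancel k s -> cancel k t ->
  (forall a b, exists x, s x = a /\ t x = b) ->
  dispersed_have_SPR_copies C.
Proof.
move=> cs ct ck ks kt st E [cE _].
pose T f : C := contC_comp cs f + contC_comp ct f.
pose L f : C := 2^-1 *: contC_comp ck f.
have TE f x : T f x = f (s x) + f (t x) by [].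
have LE f x : L f x = 2^-1 * f (k x) by [].
apply: (@SPR_copy_retract _ _ E T L 2 (1 / 6)) => //.
- by move=> a f g; rewrite /T !contC_comp_linear scalerDr addrACA.
- by move=> f g; apply: sup_spaceP => x; rewrite /L -scalerBr.
- move=> f; rewrite /T mulr_natl mulr2n; apply: le_trans (ler_normD _ _) _.
  by apply: lerD; exact: contC_comp_norm.
- move=> f; rewrite /L normrZ; apply: ler_pM => //; last exact: contC_comp_norm.
  by rewrite ger0_norm ?invr_ge0//; lra.
- move=> f; apply: sup_spaceP => x.
  by rewrite LE TE ks kt; lra.
- move=> u v _ _ /sup_norm1_large[a ua] /sup_norm1_large[b vb].
  have far x : 1 / 6 <= `|T u x| -> 1 / 6 <= `|T v x| ->
      1 / 6 <= `|lat_meet (modulus (T u)) (modulus (T v))|.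
    move=> ux vx; apply: le_trans (sup_norm_ubound _ x).
    rewrite meet_supE !modulus_supE (le_trans _ (ler_norm _))//.
    by rewrite le_min ux vx.
  have diag a' : 1 / 6 <= `|u a'| -> 1 / 6 <= `|v a'| ->
      1 / 6 <= `|lat_meet (modulus (T u)) (modulus (T v))|.
    move=> ux vx; apply: (far (k a')); rewrite TE ks kt -mulr2n;
      rewrite normrMn mulr2n; lra.
  have [h|h|[h1 h2]] := large_on_pair (u b) (v a) ua vb.
  + by apply: (diag a); lra.
  + by apply: (diag b); lra.
  + have [x [sx tx]] := st a b.
    by apply: (far x); rewrite TE sx tx; lra.
Qed.

End continuous_functions.

(** * The Cantor set *)

Lemma cantor_reindex_continuous (h : nat -> nat) :
  continuous (fun x : cantor_space => (x \o h : cantor_space)).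
Proof.
move=> x; apply/cvg_sup => i U [/= _ [[W oW <-]]] /= Wx /filterS; apply.
have := @proj_continuous nat (fun=> bool) (h i) x W; apply.
exact: open_nbhs_nbhs.
Qed.

(** Splitting a binary sequence into its even and odd terms fills the square of
    the Cantor set, and repeating every term is the diagonal. *)
Lemma CCantor_SPR_copies (R : realType) : dispersed_have_SPR_copies (CCantor R).
Proof.
apply: (@contC_SPR_copies R cantor_space cantor_space_compact
  (fun x => x \o double) (fun x => x \o (fun n => n.*2.+1)) (fun x => x \o half)).
- exact: cantor_reindex_continuous.
- exact: cantor_reindex_continuous.
- exact: cantor_reindex_continuous.
- by move=> x; apply/funext => n /=; rewrite doubleK.
- by move=> x; apply/funext => n /=; rewrite uphalf_double.
- move=> a b; exists (fun n => if odd n then b n./2 else a n./2).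
  by split; apply/funext => n /=; rewrite odd_double ?uphalf_double// doubleK.
Qed.

(** * Uniform limits *)

Lemma geometric_limit (R : realType) (T : Type) (u : nat -> T -> R) (C r : R) :
  0 <= r < 1 -> (forall n x, `|u n.+1 x - u n x| <= C * r ^+ n) ->
  exists U : T -> R, forall e : R, 0 < e ->
    \forall n \near \oo, forall x, `|U x - u n x| <= e.
Proof.
move=> /andP[r0 r1] uC.
have C0 (x : T) : 0 <= C by have := uC 0 x; rewrite expr0 mulr1; exact: le_trans.
have r1' : 0 < 1 - r by rewrite subr_gt0.
have tail n m (x : T) : `|u (n + m)%N x - u n x| <= C * r ^+ n / (1 - r).
  apply: (@le_trans _ _ (C * r ^+ n * ((1 - r ^+ m) / (1 - r)))); last first.
    rewrite ler_wpM2l ?mulr_ge0 ?(C0 x) ?exprn_ge0//.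
    by rewrite -[leRHS]mul1r ler_pM2r ?invr_gt0// gerBl exprn_ge0.
  elim: m => [|m IH]; first by rewrite addn0 subrr normr0 expr0 subrr mul0r mulr0.
  rewrite addnS; apply: le_trans (ler_distD (u (n + m)%N x) _ _) _.
  apply: le_trans (lerD (uC _ _) IH) _.
  rewrite exprD -mulrA -mulrA -mulrDr -mulrDr ler_wpM2l ?(C0 x)//.
  rewrite ler_wpM2l ?exprn_ge0// le_eqVlt; apply/orP; left; apply/eqP.
  by rewrite exprS; field; rewrite gt_eqF.
have small (e : R) : 0 < e -> \forall n \near \oo, forall x : T, C * r ^+ n / (1 - r) <= e.
  move=> e0; have e'0 : 0 < e * (1 - r) / (`|C| + 1).
    by rewrite divr_gt0 ?mulr_gt0// ltr_wpDl.
  near=> n => x; rewrite ler_pdivrMr//.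
  have : `|0 - r ^+ n| <= e * (1 - r) / (`|C| + 1).
    near: n; apply: cvgr_dist_le e'0; apply: cvg_expr.
    by rewrite ger0_norm.
  rewrite sub0r normrN ger0_norm ?exprn_ge0// ler_pdivlMr ?ltr_wpDl//.
  apply: le_trans; rewrite mulrC ler_wpM2l ?exprn_ge0//.
  by rewrite (le_trans (ler_norm C))// lerDl.
have cv (x : T) : cvg (u ^~ x @ \oo).
  apply: cauchy_cvg; apply: cauchy_exP => e e0.
  have e20 : 0 < e / 2 by rewrite divr_gt0.
  have [N _ /(_ N (leqnn N)) /(_ x) NP] := small _ e20.
  exists (u N x); exists N => // m /= Nm; rewrite /ball /= distrC.
  rewrite -(subnKC Nm); apply: le_lt_trans (tail N _ x) _.
  by apply: le_lt_trans NP _; rewrite ltr_pdivrMr// ltr_pMr// ltrDl.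
exists (fun x => lim (u ^~ x @ \oo)) => e e0.
have := small _ e0; apply: filterS => n nP x.
apply: le_trans (nP x); apply/ler_addgt0Pr => d d0.
have /cvgrPdist_le /(_ d d0) [N _ NP] := cv x.
apply: le_trans (ler_distD (u (n + N)%N x) _ _) _.
rewrite addrC lerD ?tail//; apply: NP; exact: leq_addl.
Unshelve. all: by end_near. Qed.

Lemma uniform_limit_continuous_dist (R : realType) (T : topologicalType)
    (u : nat -> T -> R) (U : T -> R) : (forall n, continuous (u n)) ->
  (forall e : R, 0 < e -> \forall n \near \oo, forall x, `|U x - u n x| <= e) ->
  continuous U.
Proof.
move=> cu uU x; apply/cvgrPdist_le => e e0.
have e30 : 0 < e / 3 by rewrite divr_gt0.
have [N _ /(_ N (leqnn N)) NP] := uU _ e30.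
near=> y; have h1 := NP x; have h2 := NP y.
have h3 : `|u N x - u N y| <= e / 3.
  by near: y; apply: cvgr_dist_le e30; exact: cu.
have -> : U x - U y = (U x - u N x) + (u N x - u N y) - (U y - u N y) by ring.
apply: le_trans (ler_normB _ _) _.
apply: le_trans (lerD (ler_normD _ _) (lexx _)) _; lra.
Unshelve. all: by end_near. Qed.

(** * The Peano curve *)

Section peano_curve.
Context (R : realType).
Implicit Types (f g : R -> R) (w : (R -> R) * (R -> R)).

Definition clamp (x : R) : R := Num.max 0 (Num.min x 1).

(** Functions constant outside the unit interval, so that triadic pieces of a
    path can be glued by plain addition. *)
Definition ramp f := [/\ continuous f, forall x, x <= 0 -> f x = 0,
  forall x, 1 <= x -> f x = 1 & forall x, 0 <= f x <= 1].

Lemma ramp_clamp : ramp clamp.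
Proof.
rewrite /clamp; split=> [x|x x0|x x1|x].
- have cmin : {for x, continuous (@idfun R \min cst 1)}.
    by apply: continuous_min; [exact: cvg_id|exact: cvg_cst].
  by apply: (@continuous_max _ _ (cst 0)) cmin; exact: cvg_cst.
- by rewrite max_l// ge_min x0.
- by rewrite (min_r x1) max_r.
- by rewrite le_max lexx ge_max ler01 ge_min lexx orbT.
Qed.

Lemma thirdsP (x : R) : [\/ x <= 1 / 3, 1 / 3 <= x <= 2 / 3 | 2 / 3 <= x].
Proof.
have [h|h] := leP x (1 / 3); first exact: Or31.
have [h'|h'] := leP (2 / 3) x; first exact: Or33.
by apply: Or32; rewrite !ltW.
Qed.

(** The three terms are the pieces of a path over the thirds of the unit
    interval; outside its own third every term is constant. *)
Definition glue_sum f x := f (3 * x) + f (3 * x - 1) + f (3 * x - 2).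
Definition glue_alt f x := f (3 * x) - f (3 * x - 1) + f (3 * x - 2).

Lemma glueE f x : ramp f ->
  [/\ x <= 1 / 3 -> glue_sum f x = f (3 * x) /\ glue_alt f x = f (3 * x),
      1 / 3 <= x <= 2 / 3 -> glue_sum f x = 1 + f (3 * x - 1) /\
                             glue_alt f x = 1 - f (3 * x - 1) &
      2 / 3 <= x -> glue_sum f x = 2 + f (3 * x - 2) /\
                    glue_alt f x = f (3 * x - 2)].
Proof.
move=> [_ f0 f1 _]; rewrite /glue_sum /glue_alt; split=> h.
- by rewrite (f0 (3 * x - 1)) ?(f0 (3 * x - 2)); try lra; split; ring.
- case/andP: h => h h'.
  by rewrite (f1 (3 * x)) ?(f0 (3 * x - 2)); try lra; split; ring.
- by rewrite (f1 (3 * x)) ?(f1 (3 * x - 1)); try lra; split; ring.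
Qed.

Lemma glue_dist f g d : ramp f -> ramp g -> (forall x, `|f x - g x| <= d) ->
  forall x, `|glue_sum f x - glue_sum g x| <= d /\
            `|glue_alt f x - glue_alt g x| <= d.
Proof.
move=> rf rg fg x; have [f1 f2 f3] := glueE x rf; have [g1 g2 g3] := glueE x rg.
have [/[dup]/f1[-> ->]/g1[-> ->]|/[dup]/f2[-> ->]/g2[-> ->]|
      /[dup]/f3[-> ->]/g3[-> ->]] := thirdsP x.
- by split.
- split; first by rewrite opprD addrACA subrr add0r.
  by rewrite opprB addrC addrA subrK distrC.
- split => //.
  by have -> : 2 + f (3 * x - 2) - (2 + g (3 * x - 2)) = f (3 * x - 2) - g (3 * x - 2)
    by ring.
Qed.

Lemma continuous_piece f c : continuous f -> continuous (fun x : R => f (3 * x - c)).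
Proof.
move=> cf x; apply: (@continuous_comp _ _ _ (fun x : R => 3 * x - c)); last exact: cf.
by apply: cvgB; [apply: cvgM; [exact: cvg_cst|exact: cvg_id]|exact: cvg_cst].
Qed.

Lemma ramp_glue_sum f : ramp f -> ramp (fun x => glue_sum f x / 3).
Proof.
move=> /[dup] rf [cf f0 f1 f01].
have cfc c := @continuous_piece f c cf.
split=> [x|x x0|x x1|x].
- apply: cvgM; last exact: cvg_cst.
  have -> : glue_sum f = fun x => f (3 * x - 0) + f (3 * x - 1) + f (3 * x - 2).
    by apply/funext => y; rewrite subr0.
  by apply: cvgD; [apply: cvgD|]; exact: cfc.
- by have [+ _ _] := glueE x rf; case=> [|-> _]; [lra|rewrite f0 ?mul0r//; lra].
- by have [_ _] := glueE x rf; case=> [|-> _]; [lra|rewrite f1; lra].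
- have [f1' f2' f3'] := glueE x rf.
  have [/f1'[-> _]|/f2'[-> _]|/f3'[-> _]] := thirdsP x.
  + by have := f01 (3 * x); lra.
  + by have := f01 (3 * x - 1); lra.
  + by have := f01 (3 * x - 2); lra.
Qed.

Lemma ramp_glue_alt f : ramp f -> ramp (glue_alt f).
Proof.
move=> /[dup] rf [cf f0 f1 f01].
have cfc c := @continuous_piece f c cf.
split=> [x|x x0|x x1|x].
- have -> : glue_alt f = fun x => f (3 * x - 0) - f (3 * x - 1) + f (3 * x - 2).
    by apply/funext => y; rewrite subr0.
  by apply: cvgD; [apply: cvgB|]; exact: cfc.
- by have [+ _ _] := glueE x rf; case=> [|_ ->]; [lra|rewrite f0//; lra].
- by have [_ _] := glueE x rf; case=> [|_ ->]; [lra|rewrite f1; lra].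
- have [f1' f2' f3'] := glueE x rf.
  have [/f1'[_ ->]|/f2'[_ ->]|/f3'[_ ->]] := thirdsP x.
  + by have := f01 (3 * x); lra.
  + by have := f01 (3 * x - 1); lra.
  + by have := f01 (3 * x - 2); lra.
Qed.

Definition peano_step w : (R -> R) * (R -> R) :=
  (fun x => glue_sum w.2 x / 3, glue_alt w.1).

(** The Peano curve: a path [(u, v)] from one corner of the unit square to the
    opposite one whose three thirds are copies of itself with the coordinates
    exchanged, each filling a vertical strip, the middle one upside down. The
    approximations converge because the exchange contracts the first coordinate
    by [3], hence both by [3 / 2] for a suitable weight. *)
Lemma peano_curve : exists u v : R -> R, [/\ ramp u, ramp v,
  forall x, u x = glue_sum v x / 3 & forall x, v x = glue_alt u x].
Proof.
pose P n := iter n peano_step (clamp, clamp).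
pose a n := (P n).1; pose b n := (P n).2.
have aS n : a n.+1 = fun x => glue_sum (b n) x / 3 by [].
have bS n : b n.+1 = glue_alt (a n) by [].
have ramps n : ramp (a n) /\ ramp (b n).
  elim: n => [|n [ra rb]]; first by split; exact: ramp_clamp.
  by rewrite aS bS; split; [exact: ramp_glue_sum|exact: ramp_glue_alt].
(* The ratio of the two constants makes each step contract both by [2 / 3]. *)
have dist n : (forall x, `|a n.+1 x - a n x| <= 3 / 2 * (2 / 3) ^+ n) /\
              (forall x, `|b n.+1 x - b n x| <= 9 / 4 * (2 / 3) ^+ n).
  elim: n => [|n [IHa IHb]].
    rewrite expr0; have [[_ _ _ a0] [_ _ _ b0]] := ramps 0.
    have [[_ _ _ a1] [_ _ _ b1]] := ramps 1.
    by split=> x; rewrite ler_norml;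
      have := a0 x; have := b0 x; have := a1 x; have := b1 x; lra.
  have [ra rb] := ramps n; have [ra' rb'] := ramps n.+1.
  split=> x; last first.
    rewrite (bS n.+1) (bS n); have [_ /le_trans] := glue_dist ra' ra IHa x.
    by apply; rewrite exprS; lra.
  rewrite (aS n.+1) (aS n) -mulrBl normrM [X in _ * X]ger0_norm ?invr_ge0//.
  have r0 : 0 <= (2 / 3 : R) ^+ n by apply: exprn_ge0; lra.
  by have [+ _] := glue_dist rb' rb IHb x; rewrite exprS; lra.
have r01 : 0 <= (2 / 3 : R) < 1 by lra.
have [u uP] := geometric_limit r01 (fun n => (dist n).1).
have [v vP] := geometric_limit r01 (fun n => (dist n).2).
have ptw (f : nat -> R -> R) F : (forall e : R, 0 < e ->
    \forall n \near \oo, forall x, `|F x - f n x| <= e) ->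
    forall x, f n x @[n --> \oo] --> F x.
  move=> fF x; apply/cvgrPdist_le => e e0.
  by have := fF e e0; apply: filterS => n; exact.
have ua := ptw _ _ uP; have vb := ptw _ _ vP.
have rlim (f : nat -> R -> R) F : (forall n, ramp (f n)) -> (forall e : R, 0 < e ->
    \forall n \near \oo, forall x, `|F x - f n x| <= e) -> ramp F.
  move=> rf fF; have fFx := ptw _ _ fF; split.
  - by apply: uniform_limit_continuous_dist fF => n; have [] := rf n.
  - move=> x x0; apply: (cvg_unique _ (fFx x)) => //=.
    have -> : (fun n => f n x) = fun=> 0.
      by apply/funext => n; have [_ ->] := rf n.
    exact: cvg_cst.
  - move=> x x0; apply: (cvg_unique _ (fFx x)) => //=.
    have -> : (fun n => f n x) = fun=> 1.
      by apply/funext => n; have [_ _ ->] := rf n.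
    exact: cvg_cst.
  - move=> x; have F01 n : 0 <= f n x <= 1 by have [_ _ _] := rf n; exact.
    apply/andP; split.
      apply: (cvgr_to_ge (fFx x)).
      by apply: nearW => n; case/andP: (F01 n).
    apply: (cvgr_to_le (fFx x)).
    by apply: nearW => n; case/andP: (F01 n).
have ru : ramp u by apply: rlim uP => n; case: (ramps n).
have rv : ramp v by apply: rlim vP => n; case: (ramps n).
exists u, v; split => // x.
- apply: (cvg_unique _ (cvg_comp _ _ (cvg_addnr 1) (ua x))) => //.
  have -> : a ^~ x \o addn^~ 1%N = fun n => glue_sum (b n) x / 3.
    by apply/funext => n /=; rewrite addn1.
  by apply: cvgM (cvg_cst _); apply: cvgD (vb _); apply: cvgD.
- apply: (cvg_unique _ (cvg_comp _ _ (cvg_addnr 1) (vb x))) => //.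
  have -> : b ^~ x \o addn^~ 1%N = fun n => glue_alt (a n) x.
    by apply/funext => n /=; rewrite addn1.
  by apply: cvgD (ua _); apply: cvgB.
Qed.

End peano_curve.

(** * Continuous functions on the unit interval *)

Section filling_paths.
Context (R : realType).
Variables (u v : R -> R) (ru : ramp u) (rv : ramp v).
Hypotheses (uE : forall x, u x = glue_sum v x / 3)
           (vE : forall x, v x = glue_alt u x).

Lemma peano_thirds x : 0 <= x <= 1 ->
  [/\ u (x / 3) = v x / 3 /\ v (x / 3) = u x,
      u ((1 + x) / 3) = (1 + v x) / 3 /\ v ((1 + x) / 3) = 1 - u x &
      u ((2 + x) / 3) = (2 + v x) / 3 /\ v ((2 + x) / 3) = u x].
Proof.
move=> x01; have e0 : 3 * (x / 3) = x by field.
have e1 : 3 * ((1 + x) / 3) - 1 = x by field.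
have e2 : 3 * ((2 + x) / 3) - 2 = x by field.
have [hv _ _] := glueE (x / 3) rv; have [hu _ _] := glueE (x / 3) ru.
have [_ hv1 _] := glueE ((1 + x) / 3) rv; have [_ hu1 _] := glueE ((1 + x) / 3) ru.
have [_ _ hv2] := glueE ((2 + x) / 3) rv; have [_ _ hu2] := glueE ((2 + x) / 3) ru.
rewrite e0 in hv hu; rewrite e1 in hv1 hu1; rewrite e2 in hv2 hu2.
split; rewrite (uE (_ / 3)) (vE (_ / 3)).
- by have [|-> _] := hv _; [lra|have [|_ ->] := hu _; [lra|]].
- by have [|-> _] := hv1 _; [lra|have [|_ ->] := hu1 _; [lra|]].
- by have [|-> _] := hv2 _; [lra|have [|_ ->] := hu2 _; [lra|]].
Qed.

(** Following, [n] times, the third whose strip contains the target divides the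
    error by [3 / 2] at each step. *)
Lemma peano_dense n (a b : R) : 0 <= a <= 1 -> 0 <= b <= 1 ->
  exists2 x, 0 <= x <= 1 &
    `|u x - a| <= 3 / 2 * (2 / 3) ^+ n /\ `|v x - b| <= 9 / 4 * (2 / 3) ^+ n.
Proof.
elim: n a b => [|n IH] a b a01 b01.
  exists 0; first by rewrite lexx ler01.
  have [_ u0 _ _] := ru; have [_ v0 _ _] := rv.
  by rewrite u0// v0// !ler_norml; lra.
have step (x y c d : R) : `|x - c| <= 3 / 2 * (2 / 3) ^+ n ->
    `|y - d| <= 9 / 4 * (2 / 3) ^+ n ->
    `|y / 3 - d / 3| <= 3 / 2 * (2 / 3) ^+ n.+1 /\
    `|x - c| <= 9 / 4 * (2 / 3) ^+ n.+1.
  have r0 : 0 <= (2 / 3 : R) ^+ n by apply: exprn_ge0; lra.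
  by rewrite exprS !ler_norml; lra.
have [a1|a2|a3] := thirdsP a.
- have [||x /[dup] x01 /peano_thirds[[ux vx] _ _] xP] := IH b (3 * a); [lra..|].
  exists (x / 3); rewrite ?ux ?vx; first lra.
  by have -> : a = 3 * a / 3 by [field]; apply: step; case: xP.
- have [||x /[dup] x01 /peano_thirds[_ [ux vx] _] xP] := IH (1 - b) (3 * a - 1); [lra..|].
  exists ((1 + x) / 3); rewrite ?ux ?vx; first lra.
  have -> : (1 + v x) / 3 - a = v x / 3 - (3 * a - 1) / 3 by field.
  have -> : 1 - u x - b = - (u x - (1 - b)) by ring.
  by rewrite normrN; apply: step; case: xP.
- have [||x /[dup] x01 /peano_thirds[_ _ [ux vx]] xP] := IH b (3 * a - 2); [lra..|].
  exists ((2 + x) / 3); rewrite ?ux ?vx; first lra.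
  have -> : (2 + v x) / 3 - a = v x / 3 - (3 * a - 2) / 3 by field.
  by apply: step; case: xP.
Qed.

Lemma peano_surj (a b : R) : 0 <= a <= 1 -> 0 <= b <= 1 ->
  exists2 x, 0 <= x <= 1 & u x = a /\ v x = b.
Proof.
move=> a01 b01; pose d (x : R) := `|u x - a| + `|v x - b|.
have cd : continuous d.
  have [cu _ _ _] := ru; have [cv _ _ _] := rv.
  by move=> x; apply: cvgD; apply: cvg_norm; apply: cvgB;
    [exact: cu|exact: cvg_cst|exact: cv|exact: cvg_cst].
have [|c c01 dc] := @EVT_min R d 0 1 ler01.
  exact: continuous_subspaceT.
exists c; first by move: c01; rewrite in_itv.
have d0 : d c <= 0.
  have lim0 : (15 / 4 * (2 / 3) ^+ n : R) @[n --> \oo] --> (15 / 4 * 0 : R).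
    by apply: cvgM (cvg_cst _) _; apply: cvg_expr; rewrite ger0_norm; lra.
  rewrite mulr0 in lim0; apply: (cvgr_to_ge lim0); apply: nearW => n.
  have [x x01 [ux vx]] := peano_dense n a01 b01.
  by apply: le_trans (dc x _) _; rewrite ?in_itv// /d; lra.
have h1 := normr_ge0 (u c - a); have h2 := normr_ge0 (v c - b).
by split; apply/eqP; rewrite -subr_eq0 -normr_le0; rewrite /d in d0; lra.
Qed.

End filling_paths.

Section diagonal_then.
Context (R : realType) (f : R -> R).

(** A path running along the diagonal at double speed before it continues with
    the reversed coordinate [f] of a square-filling curve. *)
Definition diagonal_then (x : R) :=
  clamp (2 * x) + f (2 - 2 * x) - 1.

Hypothesis rf : ramp f.

Lemma diagonal_thenE x :
  (0 <= x <= 1 -> diagonal_then (x / 2) = x) /\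
  (0 <= x <= 1 -> diagonal_then (1 - x / 2) = f x).
Proof.
have [_ _ f1 _] := rf; rewrite /diagonal_then /clamp; split=> /andP[x0 x1].
  have -> : 2 * (x / 2) = x by field.
  by rewrite (min_l x1) max_r// f1; lra.
have -> : 2 * (1 - x / 2) = 2 - x by field.
rewrite min_r; last lra.
by rewrite max_r//; have -> : 2 - (2 - x) = x by [ring]; ring.
Qed.

Lemma diagonal_then_continuous : continuous (diagonal_then).
Proof.
have [cf _ _ _] := rf; have [cc _ _ _] := ramp_clamp R.
move=> x; apply: cvgB (cvg_cst _); apply: cvgD.
  apply: (@continuous_comp _ _ _ (fun x : R => 2 * x) _ _ _ (cc _)).
  by apply: cvgM (cvg_cst _) _; exact: cvg_id.
apply: (@continuous_comp _ _ _ (fun x : R => 2 - 2 * x) _ _ _ (cf _)).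
by apply: cvgB; [exact: cvg_cst|apply: cvgM (cvg_cst _) _; exact: cvg_id].
Qed.

Lemma diagonal_then01 x : 0 <= diagonal_then x <= 1.
Proof.
have [_ f0 f1 f01] := rf; rewrite /diagonal_then.
have [c c0 c1 c01] := ramp_clamp R.
have := f01 (2 - 2 * x); have := c01 (2 * x).
have [h|h] := leP x (1 / 2); first by rewrite (f1 (2 - 2 * x)); lra.
by rewrite (c1 (2 * x)); lra.
Qed.

End diagonal_then.

Section unit_interval.
Context (R : realType).
Local Notation I := (unit_interval R).

Lemma unit_intervalP (x : I) : 0 <= set_val x <= 1.
Proof. by have := set_valP x; rewrite /= in_itv. Qed.

Section lift.
Variables (f : R -> R) (cf : continuous f) (f01 : forall x, 0 <= f x <= 1).

Lemma unit_lift_subproof (x : I) : f (set_val x) \in `[0 : R, 1]%classic.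
Proof. by rewrite inE /= in_itv /= f01. Qed.

Definition unit_lift (x : I) : I := exist _ (f (set_val x)) (unit_lift_subproof x).

Lemma unit_lift_continuous : continuous unit_lift.
Proof.
apply: continuous_comp_initial => x.
apply: (@continuous_comp _ _ _ (set_val : I -> R) f); last exact: cf.
exact: initial_continuous.
Qed.

End lift.

Lemma C01_SPR_copies : dispersed_have_SPR_copies (C01 R).
Proof.
have [u [v [ru rv uE vE]]] := peano_curve R.
have [cc _ _ c01] := ramp_clamp R.
pose k (x : R) := clamp x / 2.
have ck : continuous k by move=> x; apply: cvgM (cvg_cst _); exact: cc.
have k01 x : 0 <= k x <= 1 by have := c01 x; rewrite /k; lra.
have kE (x : I) : k (set_val x) = set_val x / 2.
  have /andP[x0 x1] := unit_intervalP x.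
  by rewrite /k /clamp (min_l x1) (max_r x0).
pose s := unit_lift (diagonal_then01 ru).
pose t := unit_lift (diagonal_then01 rv).
apply: (@contC_SPR_copies R I (@unit_interval_compact R) s t (unit_lift k01)).
- by apply: unit_lift_continuous; exact: diagonal_then_continuous.
- by apply: unit_lift_continuous; exact: diagonal_then_continuous.
- exact: unit_lift_continuous.
- move=> x; apply/val_inj; rewrite -[LHS]/(diagonal_then u (k (set_val x))) kE.
  by apply (diagonal_thenE ru); exact: unit_intervalP.
- move=> x; apply/val_inj; rewrite -[LHS]/(diagonal_then v (k (set_val x))) kE.
  by apply (diagonal_thenE rv); exact: unit_intervalP.
- move=> a b.
  have [x x01 [ux vx]] := peano_surj ru rv uE vE (unit_intervalP a) (unit_intervalP b).
  have y01 : (1 - x / 2) \in `[0 : R, 1]%classic.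
    by rewrite inE /= in_itv /=; lra.
  exists (exist _ (1 - x / 2) y01); split; apply/val_inj => /=.
    by rewrite (diagonal_thenE ru x).2.
  by rewrite (diagonal_thenE rv x).2.
Qed.

End unit_interval.

(** * Lebesgue measure on the unit interval *)

Section lebesgue01.
Context (R : realType).
Local Notation T := (measurableTypeR R).
Local Open Scope ereal_scope.

(** Rays are stable under intersection and generate the Borel sets. *)
Lemma measure_unique_rays (m1 m2 : {measure set T -> \bar R}) :
  m1 setT < +oo -> (forall x : R, m1 `]-oo, x[%classic = m2 `]-oo, x[%classic) ->
  forall A, measurable A -> m1 A = m2 A.
Proof.
move=> m1fin m12; apply: (@measure_unique _ R T (@RGenInftyO.G R)
    (fun n => [set` `]-oo, n%:R[])).
- exact: RGenInftyO.measurableE.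
- move=> _ _ [x ->] [y ->]; exists (Num.min x y).
  by apply/seteqP; split=> z /=; rewrite !in_itv/= lt_min; [case=> -> ->|case/andP].
- by move=> n; exists n%:R.
- apply/seteqP; split=> // x _; exists (Num.truncn `|x|).+1 => //=.
  by rewrite in_itv/= (le_lt_trans (ler_norm x))// truncnS_gt.
- by move=> _ [x ->].
- by move=> n; apply: le_lt_trans m1fin; apply: le_measure; rewrite ?inE//=.
Qed.

Definition lebesgue01 : {measure set T -> \bar R} :=
  mrestr lebesgue_measure (measurable_itv `[0%R : R, 1%R]).
Local Notation mu := lebesgue01.

Lemma lebesgue01E (A : set R) :
  mu A = (@lebesgue_measure R) (A `&` `[0%R, 1%R]%classic).
Proof. by []. Qed.

Lemma lebesgue01_ray b (x : R) :
  mu [set` Interval -oo%O (BSide b x)] = (clamp x)%:E.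
Proof.
rewrite lebesgue01E /clamp; have [x1|x1] := leP x 1%R.
  have -> : [set` Interval -oo%O (BSide b x)] `&` `[0%R, 1%R]%classic =
            [set` Interval (BLeft 0%R) (BSide b x)].
    apply/seteqP; split=> y /=; rewrite !in_itv/=.
      by move=> [-> /andP[-> _]].
    move=> /andP[-> /[dup] yx ->]; split=> //=.
    by case: b yx => /= yx; [rewrite ltW// (lt_le_trans yx)|rewrite (le_trans yx)].
  by rewrite lebesgue_measure_itv/= lte_fin; case: ltP => // _; rewrite oppr0 adde0.
have -> : [set` Interval -oo%O (BSide b x)] `&` `[0%R, 1%R]%classic =
          `[0%R, 1%R]%classic.
  apply/seteqP; split=> y /=; rewrite !in_itv/=; first by case.
  move=> /[dup] yy /andP[y0 y1]; split => //.
  by case: b => /=; [rewrite (le_lt_trans y1)|rewrite ltW// (le_lt_trans y1)].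
by rewrite lebesgue_measure_itv/= lte_fin ltr01 oppr0 adde0 max_r.
Qed.

Lemma lebesgue01_setT : mu setT = 1.
Proof.
rewrite lebesgue01E setTI lebesgue_measure_itv/=.
by rewrite lte_fin ltr01 oppr0 adde0.
Qed.

Lemma lebesgue01_congr (A B : set R) :
  (forall x : R, (0 <= x <= 1)%R -> A x <-> B x) -> mu A = mu B.
Proof.
move=> AB; rewrite !lebesgue01E; congr lebesgue_measure.
apply/seteqP; split=> x [Ax /= x01]; split=> //;
  by apply AB => //; move: x01; rewrite in_itv.
Qed.

Lemma lebesgue01_le1 (A : set T) : measurable A -> mu A <= 1.
Proof. by move=> mA; rewrite -lebesgue01_setT; apply: le_measure; rewrite ?inE. Qed.

End lebesgue01.

Definition image_measure d (T : measurableType d) (R : realType)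
    (mu : {measure set T -> \bar R}) (f : T -> T)
    (mf : measurable_fun [set: T] f) : {measure set T -> \bar R} :=
  measure_function_pushforward__canonical__measure_function_Measure mu mf.

Section unit_volume.
Context (R : realType).
Local Notation T := (measurableTypeR R).
Local Notation mu := (@lebesgue01 R).
Implicit Types A B : set T.

Definition vol A : R := fine (mu A).

Definition ray b (x : R) : set T := [set` Interval -oo%O (BSide b x)].

Lemma rayE b x y : ray b x y <-> (y < x ?<= if ~~ b).
Proof. by rewrite /ray /= in_itv. Qed.

Lemma measurable_ray b x : measurable (ray b x).
Proof. exact: measurable_itv. Qed.

Lemma clampP (x : R) : [\/ x <= 0 /\ clamp x = 0, 0 <= x <= 1 /\ clamp x = x |
  1 <= x /\ clamp x = 1].
Proof.
rewrite /clamp; have [x0|x0] := leP x 0.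
  by apply: Or31; split => //; rewrite max_l// ge_min x0.
have [x1|x1] := leP x 1; first by apply: Or32; rewrite (max_r (ltW x0)) ltW.
by apply: Or33; rewrite max_r// ltW.
Qed.

Lemma volE A : measurable A -> (vol A)%:E = mu A.
Proof.
move=> mA; rewrite fineK// ge0_fin_numE; last exact: measure_ge0.
by apply: le_lt_trans (lebesgue01_le1 mA) _; exact: ltry.
Qed.

Lemma vol_ray b x : vol (ray b x) = clamp x.
Proof. by rewrite /vol lebesgue01_ray. Qed.

Lemma volT : vol setT = 1.
Proof. by rewrite /vol lebesgue01_setT. Qed.

Lemma vol_congr A B : (forall x : R, 0 <= x <= 1 -> A x <-> B x) ->
  vol A = vol B.
Proof. by move=> AB; rewrite /vol (lebesgue01_congr AB). Qed.

Lemma vol_ge0 A : measurable A -> 0 <= vol A.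
Proof. by move=> mA; rewrite -lee_fin volE. Qed.

Lemma vol_le1 A : measurable A -> vol A <= 1.
Proof. by move=> mA; rewrite -lee_fin volE// lebesgue01_le1. Qed.

Lemma volD A B : measurable A -> measurable B ->
  vol (A `&` ~` B) = vol A - vol (A `&` B).
Proof.
move=> mA mB; have mC := measurableC mB.
suff -> : vol A = vol (A `&` B) + vol (A `&` ~` B) by rewrite addrC addKr.
have mI := measurableI _ _ mA mB; have mD := measurableI _ _ mA mC.
apply: EFin_inj; rewrite EFinD !volE// -measureU//.
  by rewrite -setIUr setUv setIT.
by rewrite setIACA setICr setI0.
Qed.

Lemma affine_measurable (a b : R) : measurable_fun [set: T] (fun y => a * y + b : T).
Proof.
apply: continuous_measurable_fun => y; apply: cvgD (cvg_cst _).
by apply: cvgM (cvg_cst _) _; exact: cvg_id.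
Qed.

Lemma preimage_measurable (f : T -> T) A : measurable_fun [set: T] f ->
  measurable A -> measurable (f @^-1` A).
Proof. by move=> mf mA; rewrite -[X in measurable X]setTI; exact: mf. Qed.

Lemma vol_unique (m : {measure set T -> \bar R}) :
  (m setT < +oo)%E -> (forall x : R, m (ray true x) = (clamp x)%:E) ->
  forall A, measurable A -> m A = mu A.
Proof.
by move=> mT mr A; apply: measure_unique_rays => // x; rewrite mr lebesgue01_ray.
Qed.

Lemma vol_thirds A : measurable A ->
  vol A = 3^-1 * (vol [set y : R | A (y / 3)] + (vol [set y : R | A ((1 + y) / 3)] +
                  vol [set y : R | A ((2 + y) / 3)])).
Proof.
move=> mA.
have mf q : measurable_fun [set: T] (fun y => (q + y) / 3 : T).
  have -> : (fun y => (q + y) / 3 : T) = (fun y => 3^-1 * y + q / 3).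
    by apply/funext => y; field.
  exact: affine_measurable.
have mf0 : measurable_fun [set: T] (fun y => y / 3 : T).
  have -> : (fun y => y / 3 : T) = (fun y => 3^-1 * y + 0).
    by apply/funext => y; ring.
  exact: affine_measurable.
have c0 : 0 <= (3^-1 : R) by rewrite invr_ge0.
pose m : {measure set T -> \bar R} := mscale (NngNum c0)
  (measure_add (image_measure mu mf0)
  (measure_add (image_measure mu (mf 1)) (image_measure mu (mf 2)))).
have mE B : measurable B -> m B = (3^-1 * (vol [set y : R | B (y / 3)] +
    (vol [set y : R | B ((1 + y) / 3)] + vol [set y : R | B ((2 + y) / 3)])))%:E.
  move=> mB; rewrite -[LHS]/((3^-1)%:E * measure_add (image_measure mu mf0)
    (measure_add (image_measure mu (mf 1%R)) (image_measure mu (mf 2%R))) B)%E.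
  have m0 := preimage_measurable mf0 mB; have m1 := preimage_measurable (mf 1) mB.
  have m2 := preimage_measurable (mf 2) mB.
  rewrite measure_addE [X in (_ + X)%E]measure_addE EFinM !EFinD.
  by rewrite (volE m0) (volE m1) (volE m2).
apply: EFin_inj; rewrite -mE// volE//; apply/esym; apply: vol_unique => //.
  by rewrite mE// ltry.
move=> x; rewrite mE; last exact: measurable_ray.
have e q : [set y : R | ray true x ((q + y) / 3)] = ray true (3 * x - q).
  by apply/seteqP; split=> y; rewrite /= !rayE/=; lra.
have e0 : [set y : R | ray true x (y / 3)] = ray true (3 * x).
  by apply/seteqP; split=> y; rewrite /= !rayE/=; lra.
rewrite !e e0 !vol_ray; congr _%:E.
have [[h ->]|[h ->]|[h ->]] := clampP x; have [[h0 ->]|[h0 ->]|[h0 ->]] := clampP (3 * x);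
have [[h1 ->]|[h1 ->]|[h1 ->]] := clampP (3 * x - 1);
have [[h2 ->]|[h2 ->]|[h2 ->]] := clampP (3 * x - 2); lra.
Qed.

Lemma vol_halves A : measurable A ->
  vol A = 2^-1 * (vol [set y : R | A (y / 2)] + vol [set y : R | A (1 - y / 2)]).
Proof.
move=> mA.
have mf0 : measurable_fun [set: T] (fun y => y / 2 : T).
  have -> : (fun y => y / 2 : T) = (fun y => 2^-1 * y + 0).
    by apply/funext => y; ring.
  exact: affine_measurable.
have mf1 : measurable_fun [set: T] (fun y => 1 - y / 2 : T).
  have -> : (fun y => 1 - y / 2 : T) = (fun y => - 2^-1 * y + 1).
    by apply/funext => y; ring.
  exact: affine_measurable.
have c0 : 0 <= (2^-1 : R) by rewrite invr_ge0.
pose m : {measure set T -> \bar R} := mscale (NngNum c0)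
  (measure_add (image_measure mu mf0) (image_measure mu mf1)).
have mE B : measurable B -> m B =
    (2^-1 * (vol [set y : R | B (y / 2)] + vol [set y : R | B (1 - y / 2)]))%:E.
  move=> mB; rewrite -[LHS]/((2^-1)%:E * measure_add (image_measure mu mf0)
    (image_measure mu mf1) B)%E measure_addE EFinM !EFinD.
  have m0 := preimage_measurable mf0 mB; have m1 := preimage_measurable mf1 mB.
  by rewrite (volE m0) (volE m1).
apply: EFin_inj; rewrite -mE// volE//; apply/esym; apply: vol_unique => //.
  by rewrite mE// ltry.
move=> x; rewrite mE; last exact: measurable_ray.
have e0 : [set y : R | ray true x (y / 2)] = ray true (2 * x).
  by apply/seteqP; split=> y; rewrite /= !rayE/=; lra.
have e1 : [set y : R | ray true x (1 - y / 2)] = setT `&` ~` ray false (2 - 2 * x).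
  apply/seteqP; split=> y; rewrite /= !rayE/=.
    by move=> h; split => //; apply/negP; rewrite -ltNge; lra.
  by move=> [_ /negP]; rewrite -ltNge; lra.
rewrite e0 e1 volD// ?setTI ?volT ?vol_ray; last exact: measurable_ray.
congr _%:E.
have [[h ->]|[h ->]|[h ->]] := clampP x; have [[h0 ->]|[h0 ->]|[h0 ->]] := clampP (2 * x);
have [[h1 ->]|[h1 ->]|[h1 ->]] := clampP (2 - 2 * x); lra.
Qed.

End unit_volume.

(** * The joint law of the coordinates of the Peano curve *)

Section peano_law.
Context (R : realType).
Local Notation T := (measurableTypeR R).
Implicit Types A B : set T.

Lemma geometric_small_eq0 (a : R) : (forall n, `|a| <= (2 / 3) ^+ n) -> a = 0.
Proof.
move=> ha; apply/eqP; rewrite -normr_le0.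
have lim0 : ((2 / 3) ^+ n : R) @[n --> \oo] --> (0 : R).
  by apply: cvg_expr; rewrite ger0_norm; lra.
by apply: (cvgr_to_ge lim0); apply: nearW.
Qed.

Lemma clamp_thirds (x : R) :
  clamp x = 3^-1 * (clamp (3 * x - 0) + (clamp (3 * x - 1) + clamp (3 * x - 2))).
Proof.
have [[h ->]|[h ->]|[h ->]] := clampP x; have [[h0 ->]|[h0 ->]|[h0 ->]] := clampP (3 * x - 0);
have [[h1 ->]|[h1 ->]|[h1 ->]] := clampP (3 * x - 1);
have [[h2 ->]|[h2 ->]|[h2 ->]] := clampP (3 * x - 2); lra.
Qed.

Lemma clamp01 (x : R) : 0 <= clamp x <= 1.
Proof. by have [[h ->]|[h ->]|[h ->]] := clampP x; lra. Qed.

Lemma clamp_flip (x : R) : clamp x = 1 - clamp (1 - x).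
Proof.
by have [[h ->]|[h ->]|[h ->]] := clampP x;
  have [[h1 ->]|[h1 ->]|[h1 ->]] := clampP (1 - x); lra.
Qed.

Lemma ray_piece b (x q : R) :
  [set y : R | ray b x ((q + y) / 3)] = ray b (3 * x - q) :> set T.
Proof. by apply/seteqP; split=> y; case: b; rewrite /= !rayE/=; lra. Qed.

Lemma ray_piece0 b (x : R) :
  [set y : R | ray b x (y / 3)] = ray b (3 * x - 0) :> set T.
Proof. by apply/seteqP; split=> y; case: b; rewrite /= !rayE/=; lra. Qed.

Lemma ray_flip b (x : R) :
  [set y : R | ray b x (1 - y)] = ~` ray (~~ b) (1 - x) :> set T.
Proof.
apply/seteqP; split=> y; case: b; rewrite /= !rayE/=.
- by move=> h; apply/negP; rewrite -ltNge; lra.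
- by move=> h; apply/negP; rewrite -leNgt; lra.
- by move/negP; rewrite -ltNge; lra.
- by move/negP; rewrite -leNgt; lra.
Qed.

Lemma ramp_ray_trivial (f : R -> R) b (x : R) : ramp f -> ~~ (0 <= x <= 1) ->
  (clamp x = 0 /\ f @^-1` (ray b x) = set0) \/
  (clamp x = 1 /\ f @^-1` (ray b x) = setT).
Proof.
move=> [_ _ _ f01]; rewrite negb_and -!ltNge => x01.
have [[h ->]|[h ->]|[h ->]] := clampP x.
- left; split => //; apply/seteqP; split=> y //=; rewrite rayE.
  by have := f01 y; case/orP: x01; case: b => /=; lra.
- by exfalso; case/orP: x01; lra.
- right; split => //; apply/seteqP; split=> y //= _; rewrite rayE.
  by have := f01 y; case/orP: x01; case: b => /=; lra.
Qed.

(** Of the three numbers [3 x - q] at most two lie in the unit interval,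
    so that at most two of the errors are nonzero. *)
Lemma third_error (x d e0 e1 e2 : R) :
  `|e0| <= d -> `|e1| <= d -> `|e2| <= d ->
  (~~ (0 <= 3 * x - 0 <= 1) -> e0 = 0) -> (~~ (0 <= 3 * x - 2 <= 1) -> e2 = 0) ->
  `|3^-1 * (e0 + (e1 + e2))| <= 2 / 3 * d.
Proof.
move=> h0 h1 h2 z0 z2; have d0 : 0 <= d by apply: le_trans h0.
have [x0|/z0 e00] := boolP (0 <= 3 * x - 0 <= 1).
  have e20 : e2 = 0 by apply: z2; apply/negP; move: x0; lra.
  by move: h0 h1; rewrite e20 !ler_norml; lra.
by move: h1 h2; rewrite e00 !ler_norml; lra.
Qed.

Lemma third_subr (a b c p q r k : R) :
  3^-1 * (a + (b + c)) - 3^-1 * (p + (q + r)) * k =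
  3^-1 * ((a - p * k) + ((b - q * k) + (c - r * k))).
Proof. by ring. Qed.

Variables (u v : R -> R) (ru : ramp u) (rv : ramp v).
Hypotheses (uE : forall x, u x = glue_sum v x / 3)
           (vE : forall x, v x = glue_alt u x).

Let mu_ : measurable_fun [set: T] (u : T -> T).
Proof. by apply: continuous_measurable_fun; case: ru. Qed.

Let mv_ : measurable_fun [set: T] (v : T -> T).
Proof. by apply: continuous_measurable_fun; case: rv. Qed.

Definition joint A B : R := vol (u @^-1` A `&` v @^-1` B : set T).

Lemma joint_measurable A B : measurable A -> measurable B ->
  measurable (u @^-1` A `&` v @^-1` B : set T).
Proof.
move=> mA mB; apply: measurableI.
  exact: (preimage_measurable mu_ mA).
exact: (preimage_measurable mv_ mB).
Qed.

(** Self-similarity of the curve: the part over each third, with its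
    coordinates exchanged. *)
Lemma joint_step A B : measurable A -> measurable B ->
  joint A B = 3^-1 * (joint B [set y : R | A (y / 3)] +
    (joint [set y : R | B (1 - y)] [set y : R | A ((1 + y) / 3)] +
     joint B [set y : R | A ((2 + y) / 3)])).
Proof.
move=> mA mB; rewrite /joint vol_thirds; last exact: joint_measurable.
congr (_ * (_ + (_ + _))); apply: vol_congr => x x01;
  have [[ux0 vx0] [ux1 vx1] [ux2 vx2]] := peano_thirds ru rv uE vE x01.
- by rewrite /= ux0 vx0; split=> -[].
- by rewrite /= ux1 vx1; split=> -[].
- by rewrite /= ux2 vx2; split=> -[].
Qed.

Lemma joint_compl A B : measurable A -> measurable B ->
  joint (~` A) B = joint setT B - joint A B.
Proof.
move=> mA mB; have mA' := preimage_measurable mu_ mA.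
have mB' := preimage_measurable mv_ mB.
rewrite /joint preimage_setC preimage_setT setTI.
by rewrite setIC (volD mB' mA') [in X in _ - X]setIC.
Qed.

(** The law of [u] is expressed by that of [v] on three pieces, which contracts
    the distance to the uniform law by [2 / 3]; the law of [v] is expressed by
    that of [u] and its reflection, which does not increase it. *)
Lemma joint_margin b x : joint (ray b x) setT = clamp x /\
  joint setT (ray b x) = clamp x.
Proof.
have mr c y := measurable_ray c (y : R).
have J01 A B : measurable A -> measurable B -> 0 <= joint A B <= 1.
  move=> mA mB; have mJ := joint_measurable mA mB.
  by rewrite vol_ge0 ?vol_le1.
suff bound n : (forall b x, `|joint (ray b x) setT - clamp x| <= (2 / 3) ^+ n) /\
               (forall b x, `|joint setT (ray b x) - clamp x| <= (2 / 3) ^+ n).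
  by split; apply/eqP; rewrite -subr_eq0; apply/eqP;
    apply: geometric_small_eq0 => n; have [] := bound n.
elim: n => [|n [_ IHv]].
  split=> c y; rewrite expr0 ler_norml.
    by have := J01 _ _ (mr c y) measurableT; have := clamp01 y; lra.
  by have := J01 _ _ measurableT (mr c y); have := clamp01 y; lra.
have stepu c y : `|joint (ray c y) setT - clamp y| <= (2 / 3) ^+ n.+1.
  rewrite (joint_step (mr c y) measurableT) ray_piece0 !ray_piece (clamp_thirds y).
  rewrite -[X in _ - X]mulr1 third_subr !mulr1 exprS.
  have triv z : ~~ (0 <= z <= 1) -> joint setT (ray c z) - clamp z = 0.
    move=> /(ramp_ray_trivial c rv)[[-> e]|[-> e]]; rewrite /joint e setTI.
      by rewrite /vol measure0 subrr.
    by rewrite volT subrr.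
  by apply: third_error; [exact: IHv|exact: IHv|exact: IHv|exact: triv|exact: triv].
split=> // c y; rewrite (joint_step measurableT (mr c y)).
rewrite ray_flip (joint_compl (mr _ _) measurableT).
have -> : joint setT setT = 1 by rewrite /joint setTI volT.
have h1 := stepu c y; have h2 := stepu (~~ c) (1 - y).
by have := clamp_flip y; move: h1 h2; rewrite !ler_norml; lra.
Qed.

Lemma joint_rays b x c y : joint (ray b x) (ray c y) = clamp x * clamp y.
Proof.
have mr d z := measurable_ray d (z : R).
apply/eqP; rewrite -subr_eq0; apply/eqP; apply: geometric_small_eq0 => n.
elim: n b x c y => [|n IH] b x c y.
  have mJ := joint_measurable (mr b x) (mr c y).
  have h1 := vol_ge0 mJ; have h2 := vol_le1 mJ.
  have h3 := clamp01 x; have h4 := clamp01 y.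
  have h5 : 0 <= clamp x * clamp y <= 1.
    by case/andP: h3 => *; case/andP: h4 => *; rewrite mulr_ge0//= mulr_ile1.
  by rewrite expr0 ler_norml /joint; move: h5; lra.
rewrite (joint_step (mr b x) (mr c y)) ray_piece0 !ray_piece ray_flip.
rewrite (joint_compl (mr _ _) (mr _ _)) (joint_margin b _).2.
rewrite (clamp_thirds x) third_subr exprS.
have triv z : ~~ (0 <= z <= 1) ->
    joint (ray c y) (ray b z) - clamp z * clamp y = 0.
  move=> /(ramp_ray_trivial b rv)[[-> e]|[-> e]].
    by rewrite /joint e setI0 /vol measure0 mul0r subrr.
  have := (joint_margin c y).1; rewrite /joint e preimage_setT => ->.
  by rewrite mul1r subrr.
have IH' z : `|joint (ray c y) (ray b z) - clamp z * clamp y| <= (2 / 3) ^+ n.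
  by rewrite (mulrC (clamp z)); exact: IH.
apply: third_error; [exact: IH'| |exact: IH'|exact: triv|exact: triv].
have := IH (~~ c) (1 - y) b (3 * x - 1); rewrite (clamp_flip y) !ler_norml.
set j := joint _ _; set p := clamp (1 - y); set q := clamp (3 * x - 1).
rewrite mulrBr mulr1 (mulrC q); lra.
Qed.

(** The coordinates of the Peano curve are independent and uniform: their joint
    law solves the same equation as the area, and on pairs of rays the error is
    contracted by [2 / 3]. *)
Lemma peano_independent A B : measurable A -> measurable B ->
  joint A B = vol A * vol B.
Proof.
have mr c y := measurable_ray c (y : R).
have fin (m : {measure set T -> \bar R}) (D : set T) (mD : measurable D) :
    (m setT <= 1 -> mrestr m mD setT < +oo)%E.
  move=> m1; apply: (@le_lt_trans _ _ (m setT)).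
    by rewrite /mrestr setTI; apply: le_measure; rewrite ?inE.
  by apply: le_lt_trans m1 _; exact: ltry.
have muT1 : (@lebesgue01 R setT <= 1)%E by rewrite lebesgue01_setT.
have scaleE (r : {nonneg R}) (D : set T) : measurable D ->
    mscale r (@lebesgue01 R) D = (r%:num * vol D)%:E.
  by move=> mD; rewrite /mscale EFinM volE.
have ray_case A' c y : measurable A' -> joint A' (ray c y) = vol A' * clamp y.
  move=> mA'; have mD := preimage_measurable mv_ (mr c y).
  have c0 : 0 <= clamp y by case/andP: (clamp01 y).
  apply: EFin_inj; rewrite [in RHS]mulrC -[clamp y]/((NngNum c0)%:num) -scaleE//.
  rewrite /joint volE; last exact: joint_measurable.
  rewrite -[LHS]/(image_measure (mrestr (@lebesgue01 R) mD) mu_ A').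
  apply: measure_unique_rays => //; first exact: fin.
  move=> x; apply: etrans (esym (scaleE (NngNum c0) _ (mr true x))).
  rewrite [(NngNum c0)%:num]/= vol_ray mulrC -(joint_rays true x c y).
  by rewrite /joint volE//; exact: joint_measurable.
move=> mA mB; have mD := preimage_measurable mu_ mA.
have c0 := vol_ge0 mA.
apply: EFin_inj; rewrite -[vol A]/((NngNum c0)%:num) -scaleE//.
rewrite /joint volE; last exact: joint_measurable.
rewrite setIC -[LHS]/(image_measure (mrestr (@lebesgue01 R) mD) mv_ B).
apply: measure_unique_rays => //; first exact: fin.
move=> x; apply: etrans (esym (scaleE (NngNum c0) _ (mr true x))).
rewrite [(NngNum c0)%:num]/= vol_ray -(ray_case A true x mA).
rewrite /joint volE; last exact: joint_measurable.
by rewrite setIC.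
Qed.

End peano_law.

(** * Norms of measurable functions *)

Section Lnorm_lemmas.
Context d (T : measurableType d) (R : realType).
Variable mu : {measure set T -> \bar R}.
Local Open Scope ereal_scope.
Implicit Types (f g : T -> R) (p : \bar R).

Lemma measurable_abs_poweR f (r : R) : measurable_fun [set: T] f ->
  measurable_fun [set: T] (fun x => `|(f x)%:E| `^ r).
Proof.
move=> mf; apply: (measurableT_comp (measurable_poweR _)).
by apply: measurableT_comp => //; exact: measurableT_comp.
Qed.

Lemma LnormE f (r : R) :
  'N[mu]_r%:E[EFin \o f] = (\int[mu]_x (`|(f x)%:E| `^ r)) `^ r^-1.
Proof. by rewrite unlock. Qed.

Lemma LnormyE f : 0 < mu setT ->
  'N[mu]_+oo[EFin \o f] = ess_sup mu (abse \o (EFin \o f)).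
Proof. by move=> mu0; rewrite unlock /Lnorm mu0. Qed.

Lemma ae_preimage (s : T -> T) (P : set T) : measurable_fun [set: T] s ->
  (forall A, measurable A -> mu A = 0 -> mu (s @^-1` A) = 0) ->
  {ae mu, forall x, P x} -> {ae mu, forall x, P (s x)}.
Proof.
move=> ms nul [A [mA A0 PA]]; exists (s @^-1` A); split.
- by rewrite -[X in measurable X]setTI; exact: ms.
- exact: nul.
- by move=> x /= nP; exact: PA.
Qed.

Lemma poweR_le_pos (a b : \bar R) (r : R) : (0 <= r)%R -> 0 <= a -> a <= b ->
  a `^ r <= b `^ r.
Proof.
move=> r0 a0 ab; apply: gt0_ler_poweR => //; rewrite in_itv/= leey andbT//.
exact: le_trans ab.
Qed.

Lemma Lnorm_comp_le (s : T -> T) (C : R) p f : 1 <= p -> (1 <= C)%R ->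
  measurable_fun [set: T] s -> measurable_fun [set: T] f ->
  (forall A, measurable A -> mu (s @^-1` A) <= C%:E * mu A) ->
  'N[mu]_p[EFin \o (f \o s)] <= C%:E * 'N[mu]_p[EFin \o f].
Proof.
move=> p1 C1 ms mf sC; have C0 : (0 <= C)%R by apply: le_trans C1.
case: p p1 => [r r1|_|//].
- have r1' : (1 <= r)%R by rewrite -lee_fin.
  have r0 : (0 < r)%R by apply: lt_le_trans r1'.
  rewrite !LnormE; pose g x := `|(f x)%:E| `^ r.
  have mg : measurable_fun [set: T] g by exact: measurable_abs_poweR.
  have g0 x : 0 <= g x by exact: poweR_ge0.
  have int_le : \int[mu]_x g (s x) <= C%:E * \int[mu]_x g x.
    have := @ge0_integral_pushforward _ _ _ _ _ _ ms mu setT g measurableT mg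
      (fun x _ => g0 x).
    rewrite preimage_setT => <-.
    rewrite -[C%:E]/((NngNum C0)%:num%:E) -ge0_integral_mscale//.
    exact: (@ge0_le_measure_integral _ _ _ (image_measure mu ms)
      (mscale (NngNum C0) mu) sC).
  apply: le_trans (_ : (C%:E * \int[mu]_x g x) `^ r^-1 <= _).
    apply: poweR_le_pos int_le; first by rewrite invr_ge0 ltW.
    by apply: integral_ge0 => x _; exact: poweR_ge0.
  rewrite poweRM ?lee_fin ?integral_ge0// lee_wpmul2r ?poweR_ge0//.
  rewrite poweR_EFin lee_fin; apply: le_trans (_ : (C `^ 1 <= _)%R).
    by apply: ler_powR => //; rewrite invf_le1.
  by rewrite powRr1.
- rewrite unlock; case: ifPn => [mu0|_]; last by rewrite mule0.
  apply: (@le_trans _ _ (ess_sup mu (abse \o (EFin \o f)))).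
    apply/ess_supP; apply: (@ae_preimage s
      [set x | (abse \o (EFin \o f)) x <= ess_sup mu (abse \o (EFin \o f))]) => //.
      move=> A mA A0; apply/eqP; rewrite -measure_le0.
      by apply: le_trans (sC A mA) _; rewrite A0 mule0.
    exact: ess_sup_ge.
  have ess0 : 0 <= ess_sup mu (abse \o (EFin \o f)).
    by apply: ess_sup_gee => //; apply: nearW => x; exact: abse_ge0.
  by rewrite -[leLHS]mul1e; apply: lee_wpmul2r; rewrite ?lee_fin.
Qed.

Lemma Lnorm_level_ge f (A : set T) (e r : R) : (0 <= e)%R -> (1 <= r)%R ->
  measurable A -> measurable_fun [set: T] f -> mu A <= 1 ->
  (forall x, A x -> (e <= `|f x|)%R) ->
  e%:E * mu A <= 'N[mu]_r%:E[EFin \o f].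
Proof.
move=> e0 r1 mA mf A1 Af; have r0 : (0 < r)%R by apply: lt_le_trans r1.
rewrite LnormE; pose g x := `|(f x)%:E| `^ r.
have mg : measurable_fun [set: T] g by exact: measurable_abs_poweR.
have g0 x : 0 <= g x by exact: poweR_ge0.
have int_ge : (e `^ r)%:E * mu A <= \int[mu]_x g x.
  apply: (@le_trans _ _ (\int[mu]_(x in A) g x)); last first.
    by apply: ge0_subset_integral.
  rewrite -integral_cst//; apply: ge0_le_integral => //.
  - by move=> x _; rewrite lee_fin powR_ge0.
  - exact: measurable_funTS.
  - by move=> x Ax; rewrite /g/= lee_fin ge0_ler_powR ?nnegrE ?Af ?(ltW r0).
apply: le_trans (_ : ((e `^ r)%:E * mu A) `^ r^-1 <= _); last first.
  apply: poweR_le_pos => //; first by rewrite invr_ge0 ltW.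
  by rewrite mule_ge0 ?lee_fin ?powR_ge0.
rewrite poweRM ?lee_fin ?powR_ge0// poweR_EFin -powRrM mulfV ?gt_eqF// powRr1//.
rewrite lee_wpmul2l ?lee_fin//.
have Afin : mu A \is a fin_num.
  by rewrite ge0_fin_numE// (le_lt_trans A1)// ltry.
rewrite -(fineK Afin) poweR_EFin lee_fin.
have a0 : (0 <= fine (mu A))%R by rewrite fine_ge0.
have a1 : (fine (mu A) <= 1)%R by rewrite -lee_fin fineK.
move: a0; rewrite le_eqVlt => /predU1P[<-|a0]; first exact: powR_ge0.
rewrite -[leLHS](powRr1 (ltW a0)); apply: ger_powR; first by rewrite a0.
by rewrite invf_le1.
Qed.

Lemma Lnormy_level_ge f (A : set T) (e : R) : (0 <= e)%R ->
  measurable A -> 0 < mu A ->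
  (forall x, A x -> (e <= `|f x|)%R) ->
  e%:E <= 'N[mu]_+oo[EFin \o f].
Proof.
move=> e0 mA A0 Af; rewrite LnormyE; last first.
  by apply: lt_le_trans A0 _; apply: le_measure; rewrite ?inE.
rewrite leNgt; apply/negP => lt_e.
have [N [mN N0 fN]] := ess_sup_ge mu (abse \o (EFin \o f)).
have : mu A <= mu N.
  apply: le_measure; rewrite ?inE// => x Ax; apply: fN => /= fx.
  by have := le_lt_trans fx lt_e; rewrite lte_fin ltNge Af.
by rewrite N0 leNgt A0.
Qed.

Lemma Lnorm_le_cst f (e : R) p : 1 <= p -> (0 <= e)%R -> mu setT <= 1 ->
  measurable_fun [set: T] f -> {ae mu, forall x, (`|f x| <= e)%R} ->
  'N[mu]_p[EFin \o f] <= e%:E.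
Proof.
move=> p1 e0 mu1 mf fe; apply: (@le_trans _ _ 'N[mu]_p[EFin \o (cst e)]).
  apply: ae_le_Lnorm => //; apply: filterS fe => x fx.
  by rewrite /= (ger0_norm e0).
case: p p1 => [r r1|_|//].
- have r1' : (1 <= r)%R by rewrite -lee_fin.
  have r0 : (0 < r)%R by apply: lt_le_trans r1'.
  rewrite LnormE /= (ger0_norm e0).
  rewrite integral_cst// poweRM ?lee_fin ?powR_ge0// poweR_EFin -powRrM.
  rewrite mulfV ?gt_eqF// powRr1// -[leRHS]mule1 lee_wpmul2l ?lee_fin//.
  by rewrite -[leRHS](poweR1r r^-1); apply: poweR_le_pos => //; rewrite invr_ge0 ltW.
- rewrite unlock; case: ifPn => _; last by rewrite lee_fin.
  by apply/ess_supP; apply: nearW => x; rewrite /= (ger0_norm e0).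
Qed.

(** Absolute continuity of the integral of [|f| ^ r]. *)
Lemma Lnorm_small_set f (r : R) (e : R) : (1 <= r)%R -> (0 < e)%R ->
  measurable_fun [set: T] f -> 'N[mu]_r%:E[EFin \o f] < +oo ->
  exists2 c : R, (0 < c)%R & forall A, measurable A -> mu A < c%:E ->
    'N[mu]_r%:E[EFin \o (f \* \1_A)%R] <= e%:E.
Proof.
move=> r1 e0 mf; have r0 : (0 < r)%R by apply: lt_le_trans r1.
rewrite LnormE => fin; pose h x := (`|f x| `^ r)%R.
have mh : measurable_fun [set: T] h.
  exact/measurable_EFinP/(measurable_abs_poweR r mf).
have h0 x : (0 <= h x)%R by exact: powR_ge0.
have inth : mu.-integrable setT (EFin \o h).
  apply/integrableP; split; first exact/measurable_EFinP.
  rewrite (eq_integral (fun x => `|(f x)%:E| `^ r)).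
    apply: contraTT fin; rewrite -!leNgt !leye_eq => /eqP ->.
    by rewrite poweRyr// invr_neq0// gt_eqF.
  by move=> x _; rewrite /= ger0_norm.
have er0 : (0 < e `^ r)%R by rewrite powR_gt0.
have [c [c0 cP]] := integral_normr_continuous inth er0.
exists c => // A mA Ac; rewrite LnormE.
have e_r : e%:E = ((e `^ r)%:E) `^ r^-1.
  by rewrite poweR_EFin -powRrM mulfV ?gt_eqF// powRr1// ltW.
rewrite e_r; apply: poweR_le_pos; first by rewrite invr_ge0 ltW.
  by apply: integral_ge0 => x _; exact: poweR_ge0.
have := cP A mA Ac; rewrite /Rintegral => lt_e.
have -> : \int[mu]_x (`|((f \* \1_A)%R x)%:E| `^ r) = \int[mu]_(x in A) (`|h x|)%:E.
  rewrite [RHS]integral_mkcond; apply: eq_integral => x _.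
  rewrite patchE /= indicE; case: ifPn => xA.
    by rewrite mulr1 (ger0_norm (h0 x)).
  by rewrite mulr0 normr0 powR0// gt_eqF.
have finA : \int[mu]_(x in A) (`|h x|)%:E \is a fin_num.
  have /integrableP[_ lt] : mu.-integrable A (EFin \o h).
    exact: integrableS inth.
  rewrite ge0_fin_numE//; apply: integral_ge0 => x _; by rewrite lee_fin.
by rewrite -(fineK finA) lee_fin ltW.
Qed.

End Lnorm_lemmas.

(** * Elements of [L_p] as functions *)

Section Lspace_representatives.
Context d (T : measurableType d) (R : realType).
Variables (mu : {measure set T -> \bar R}) (p : \bar R) (p1 : (1 <= p)%E).
Local Notation L := (LspaceType mu p1).
Implicit Types (F G : L) (f g : T -> R).

Lemma Lrepr_measurable F : measurable_fun [set: T] (Lrepr F).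
Proof. exact: measurable_funPT. Qed.

Lemma LreprD F G :
  {ae mu, forall x, Lrepr (F + G) x = Lrepr F x + Lrepr G x}.
Proof. by apply: filterS (LclassK (Lrepr F + Lrepr G)) => x /(_ I). Qed.

Lemma LreprN F : {ae mu, forall x, Lrepr (- F) x = - Lrepr F x}.
Proof. by apply: filterS (LclassK (- Lrepr F)) => x /(_ I). Qed.

Lemma LreprZ (a : R) F : {ae mu, forall x, Lrepr (a *: F) x = a * Lrepr F x}.
Proof. by apply: filterS (LclassK (a *: Lrepr F)) => x /(_ I). Qed.

Lemma Lrepr_join F G :
  {ae mu, forall x, Lrepr (lat_join F G) x = Num.max (Lrepr F x) (Lrepr G x)}.
Proof. by apply: filterS (LclassK (Lmax (Lrepr F) (Lrepr G))) => x /(_ I). Qed.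

Lemma Lrepr_modulus F : {ae mu, forall x, Lrepr (modulus F) x = `|Lrepr F x|}.
Proof.
by apply: filterS2 (Lrepr_join F (- F)) (LreprN F) => x -> ->; rewrite maxrN.
Qed.

Lemma Lrepr_meet F G :
  {ae mu, forall x, Lrepr (lat_meet F G) x = Num.min (Lrepr F x) (Lrepr G x)}.
Proof.
apply: filterS3 (LreprN (lat_join (- F) (- G))) (Lrepr_join (- F) (- G))
  (filterI (LreprN F) (LreprN G)) => x.
by move=> -> -> [-> ->]; rewrite oppr_max !opprK.
Qed.

Lemma Lspace_ext F G : {ae mu, forall x, Lrepr F x = Lrepr G x} -> F = G.
Proof. by move=> FG; apply/Lspace_eqP; apply: filterS FG => x FGx _. Qed.

Definition Lgood f := measurable_fun [set: T] f /\ finite_norm mu p f.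

Lemma Lgood_Lfun f : Lgood f -> f \in @Lfun _ T R mu p.
Proof. by case=> mf ff; apply/andP; split; rewrite inE. Qed.

(** Total, so that a class can be named before its function is shown to lie in
    [L_p]; outside [L_p] the value [0] is a default. *)
Definition Lof f : L :=
  if pselect (Lgood f) is left h then Lclass (Lfun_Sub p1 (Lgood_Lfun h)) else 0.

Lemma LofK f : Lgood f -> {ae mu, forall x, Lrepr (Lof f) x = f x}.
Proof.
rewrite /Lof => gf; case: pselect => // h.
by apply: filterS (LclassK (Lfun_Sub p1 (Lgood_Lfun h))) => x /(_ I).
Qed.

Lemma Lgood_repr F : Lgood (Lrepr F).
Proof. by split; [exact: Lrepr_measurable|exact: Lfunction_finite]. Qed.

Lemma Lspace_norm_Lrepr F : (`|F|%:E = 'N[mu]_p[EFin \o Lrepr F])%E.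
Proof. exact: finite_norm_fine. Qed.

Lemma Lspace_norm_repr F f : measurable_fun [set: T] f ->
  {ae mu, forall x, Lrepr F x = f x} -> (`|F|%:E = 'N[mu]_p[EFin \o f])%E.
Proof.
move=> mf Ff; rewrite Lspace_norm_Lrepr.
apply: ae_eq_Lnorm => //.
by apply: filterS Ff => x Ffx _.
Qed.

Lemma Lgood_le f g : Lgood g -> measurable_fun [set: T] f ->
  {ae mu, forall x, `|f x| <= `|g x|} -> Lgood f.
Proof.
move=> [mg fg] mf lefg; split => //; apply: le_lt_trans fg.
exact: ae_le_Lnorm.
Qed.

Definition Lcomp (s : T -> T) F : L := Lof (Lrepr F \o s).

Section comp.
Variables (s : T -> T) (C : R).
Hypotheses (ms : measurable_fun [set: T] s) (C1 : 1 <= C).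
Hypothesis sC : forall A, measurable A -> (mu (s @^-1` A) <= C%:E * mu A)%E.

Lemma Lgood_comp F : Lgood (Lrepr F \o s).
Proof.
split; first by apply: measurableT_comp ms; exact: Lrepr_measurable.
apply: le_lt_trans (Lnorm_comp_le p1 C1 ms (Lrepr_measurable F) sC) _.
by rewrite -Lspace_norm_Lrepr -EFinM ltry.
Qed.

Lemma ae_comp (P : set T) : {ae mu, forall x, P x} -> {ae mu, forall x, P (s x)}.
Proof.
apply: ae_preimage => // A mA A0; apply/eqP; rewrite -measure_le0.
by apply: le_trans (sC mA) _; rewrite A0 mule0.
Qed.

Lemma LcompK F : {ae mu, forall x, Lrepr (Lcomp s F) x = Lrepr F (s x)}.
Proof. exact: LofK (Lgood_comp F). Qed.

Lemma Lcomp_linear a F G : Lcomp s (a *: F + G) = a *: Lcomp s F + Lcomp s G.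
Proof.
apply: Lspace_ext.
apply: filterS3 (LcompK (a *: F + G))
  (filterI (ae_comp (LreprD (a *: F) G)) (ae_comp (LreprZ a F)))
  (filterI (filterI (LreprD (a *: Lcomp s F) (Lcomp s G)) (LreprZ a (Lcomp s F)))
           (filterI (LcompK F) (LcompK G))).
by move=> x -> [-> ->] [[-> ->] [-> ->]].
Qed.

Lemma Lcomp_norm F : `|Lcomp s F| <= C * `|F|.
Proof.
rewrite -lee_fin EFinM (Lspace_norm_repr _ (LcompK F)); last by case: (Lgood_comp F).
rewrite Lspace_norm_Lrepr; exact: (Lnorm_comp_le p1 C1 ms (Lrepr_measurable F) sC).
Qed.

End comp.

Definition level (e : R) f := [set x | e <= `|f x|].

Lemma level_measurable e f : measurable_fun [set: T] f -> measurable (level e f).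
Proof.
move=> mf; have -> : level e f = [set: T] `&` (Num.norm \o f) @^-1` `[e, +oo[.
  by apply/seteqP; split=> x /=; rewrite in_itv/= andbT /level/=; tauto.
have mn : measurable_fun [set: T] (Num.norm \o f) by exact: measurableT_comp.
exact: mn.
Qed.

End Lspace_representatives.

(** * Stable phase retrieval in [L_p] *)

Section Lspace_SPR.
Context d (T : measurableType d) (R : realType).
Variables (mu : {measure set T -> \bar R}) (p : \bar R) (p1 : (1 <= p)%E).
Hypothesis mu1 : (mu setT <= 1)%E.
Local Notation L := (LspaceType mu p1).
Implicit Types (F G : L) (f g : T -> R).

Variables (s t k : T -> T) (C : R).
Hypotheses (ms : measurable_fun [set: T] s) (mt : measurable_fun [set: T] t)
  (mk : measurable_fun [set: T] k) (C1 : 1 <= C).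
Hypotheses
  (sC : forall A, measurable A -> (mu (s @^-1` A) <= C%:E * mu A)%E)
  (tC : forall A, measurable A -> (mu (t @^-1` A) <= C%:E * mu A)%E)
  (kC : forall A, measurable A -> (mu (k @^-1` A) <= C%:E * mu A)%E)
  (ks : {ae mu, forall x, s (k x) = x}) (kt : {ae mu, forall x, t (k x) = x})
  (stC : forall A B, measurable A -> measurable B ->
    (mu A * mu B <= C%:E * mu (s @^-1` A `&` t @^-1` B))%E).

Let fin A : measurable A -> mu A \is a fin_num.
Proof.
move=> mA; rewrite ge0_fin_numE//; apply: le_lt_trans (ltry 1).
by apply: le_trans mu1; apply: le_measure; rewrite ?inE.
Qed.

Let mpre (h : T -> T) A : measurable_fun [set: T] h -> measurable A ->
  measurable (h @^-1` A).
Proof. by move=> mh mA; rewrite -[X in measurable X]setTI; exact: mh. Qed.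

Definition sums f (x : T) : R := f (s x) + f (t x).

Lemma sums_measurable f : measurable_fun [set: T] f -> measurable_fun [set: T] (sums f).
Proof.
by move=> mf; apply: measurable_funD;
  [exact: measurableT_comp mf ms|exact: measurableT_comp mf mt].
Qed.

(** The set where [f] is large at [s] and [g] is large at [t] is covered by
    three sets, by [large_on_pair]. Where both functions are
    large at the same point, the section [k] of [(s, t)] makes both sums large. *)
Lemma large_sums f g (e : R) : 0 <= e ->
  measurable_fun [set: T] f -> measurable_fun [set: T] g ->
  (mu (level e f) * mu (level e g) <= (C * (2 * C ^+ 2 + 1))%:E *
   mu (level (e / 3)%R (sums f) `&` level (e / 3)%R (sums g)))%E.
Proof.
move=> e0 mf mg; set Q := _ `&` level _ _; set Z := level (e / 3) f `&` level (e / 3) g.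
have mZ : measurable Z by apply: measurableI; exact: level_measurable.
have mQ : measurable Q by apply: measurableI; apply: level_measurable; exact: sums_measurable.
have mA := level_measurable e mf; have mB := level_measurable e mg.
have mI : measurable (s @^-1` (level e f) `&` t @^-1` (level e g)).
  by apply: measurableI; exact: mpre.
have C0 : 0 <= C by apply: le_trans C1.
apply: le_trans (stC mA mB) _; rewrite EFinM -muleA lee_wpmul2l ?lee_fin//.
have cover : s @^-1` (level e f) `&` t @^-1` (level e g) `<=`
    s @^-1` Z `|` t @^-1` Z `|` Q.
  move=> x [/= fe ge].
  have [h|h|[h1 h2]] := large_on_pair (f (t x)) (g (s x)) fe ge.
  - by left; left; split => //=; rewrite /level/=; move: fe; rewrite /level/=; lra.
  - by left; right; split => //=; rewrite /level/=; move: ge; rewrite /level/=; lra.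
  - by right; split.
have ZQ : (mu Z <= C%:E * mu Q)%E.
  apply: le_trans (kC mQ); apply: le_trans (_ : (mu (k @^-1` Q) <= _)%E) => //.
  have [N [mN N0 NP]] := filterI ks kt.
  apply: (@le_trans _ _ (mu (k @^-1` Q `|` N))).
    apply: le_measure; rewrite ?inE//; first by apply: measurableU => //; exact: mpre.
    move=> x Zx; have [sktk|nsk] := pselect (s (k x) = x /\ t (k x) = x); last first.
      by right; exact: NP.
    left; case: sktk Zx => sk tk [+ +]; rewrite /level/= => fx gx.
    split; rewrite /level /= /sums sk tk -mulr2n normrMn mulr2n.
      by have := normr_ge0 (f x); lra.
    by have := normr_ge0 (g x); lra.
  apply: le_trans (measureU2 _ _ _) _ => //; first exact: mpre.
  by rewrite -[leRHS]adde0; apply: leeD => //; rewrite le_eqVlt; apply/orP; left; exact/eqP.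
have q0 : 0 <= fine (mu Q) by rewrite fine_ge0.
apply: (@le_trans _ _ (mu (s @^-1` Z) + mu (t @^-1` Z) + mu Q)%E).
  apply: le_trans (_ : mu (s @^-1` Z `|` t @^-1` Z `|` Q) <= _)%E.
    apply: le_measure; rewrite ?inE//.
    by apply: measurableU => //; apply: measurableU; exact: mpre.
  apply: le_trans (measureU2 _ _ _) _ => //; first by apply: measurableU; exact: mpre.
  by rewrite leeD2r//; apply: measureU2; exact: mpre.
have big h : (mu (h @^-1` Z) <= C%:E * mu Z)%E -> (mu (h @^-1` Z) <= (C ^+ 2)%:E * mu Q)%E.
  move=> /le_trans; apply; rewrite expr2 EFinM -muleA.
  by apply: lee_wpmul2l; rewrite ?lee_fin.
apply: le_trans (leeD (leeD (big s (sC mZ)) (big t (tC mZ))) (lexx _)) _.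
rewrite -(fineK (fin mQ)) -!EFinM -!EFinD lee_fin; lra.
Qed.

Definition sum_along F : L := Lcomp s F + Lcomp t F.

Lemma sum_alongK F :
  {ae mu, forall x, Lrepr (sum_along F) x = sums (Lrepr F) x}.
Proof.
apply: filterS3 (LreprD (Lcomp s F) (Lcomp t F))
  (LcompK ms C1 sC F) (LcompK mt C1 tC F).
by move=> x -> -> ->.
Qed.

Lemma meet_sum_along_norm F G : exists2 h : T -> R,
  measurable_fun [set: T] h /\
  (forall (e : R) x, (level e (sums (Lrepr F)) `&` level e (sums (Lrepr G))) x ->
     e <= `|h x|) &
  (`|lat_meet (modulus (sum_along F)) (modulus (sum_along G))|%:E =
   'N[mu]_p[EFin \o h])%E.
Proof.
have mS H := sums_measurable (Lrepr_measurable H).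
exists (fun x => Num.min `|sums (Lrepr F) x| `|sums (Lrepr G) x|).
  split.
    by apply: measurable_minr; apply: measurableT_comp => //; exact: mS.
  move=> e x [/= Fx Gx]; apply: le_trans (ler_norm _).
  by rewrite le_min; apply/andP; split.
apply: Lspace_norm_repr.
  by apply: measurable_minr; apply: measurableT_comp => //; exact: mS.
apply: filterS3 (Lrepr_meet (modulus (sum_along F)) (modulus (sum_along G)))
  (filterI (Lrepr_modulus (sum_along F)) (Lrepr_modulus (sum_along G)))
  (filterI (sum_alongK F) (sum_alongK G)).
by move=> x -> [-> ->] [-> ->].
Qed.

Lemma Lspace_SPR_copy (E : set L) (c : R) : closed_subspace E -> 0 < c ->
  (forall F G, E F -> E G -> `|F| = 1 -> `|G| = 1 ->
    c <= `|lat_meet (modulus (sum_along F)) (modulus (sum_along G))|) ->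
  exists E' : set L, [/\ closed_subspace E', isomorphic_subspaces E E' &
                         stable_phase_retrieval E'].
Proof.
move=> cE c0 sep; have C0 : 0 <= C by apply: le_trans C1.
pose B F : L := 2^-1 *: Lcomp k F.
apply: (@SPR_copy_retract _ _ E sum_along B (2 * C) c) => //.
- move=> a F G; rewrite /sum_along (Lcomp_linear ms C1 sC) (Lcomp_linear mt C1 tC).
  by rewrite scalerDr addrACA.
- move=> F G; rewrite /B -scalerBr; congr (_ *: _).
  have -> : F - G = -1 *: G + F by rewrite scaleN1r addrC.
  by rewrite (Lcomp_linear mk C1 kC) scaleN1r addrC.
- by rewrite mulr_ge0.
- move=> F; rewrite /sum_along; apply: le_trans (ler_normD _ _) _.
  rewrite -mulrA mulr_natl mulr2n.
  by apply: lerD; [exact: (Lcomp_norm ms C1 sC)|exact: (Lcomp_norm mt C1 tC)].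
- move=> F; rewrite /B normrZ; rewrite -mulrA; apply: ler_pM => //.
    by rewrite ger0_norm ?invr_ge0//; lra.
  exact: (Lcomp_norm mk C1 kC).
- move=> F; apply: Lspace_ext.
  apply: filterS3 (LreprZ 2^-1 (Lcomp k (sum_along F)))
    (filterI (LcompK mk C1 kC (sum_along F)) (ae_comp mk kC (sum_alongK F)))
    (filterI ks kt).
  by move=> x -> [-> ->] [sk tk]; rewrite /sums sk tk; lra.
Qed.

(** By [large_sums], both sums are at least [e / 3] on a common set of measure
    at least [e ^+ 2 / K], with a constant [K] depending on [C] alone. *)
Lemma Lspace_SPR_finite (r : R) (E : set L) (e : R) : p = r%:E ->
  closed_subspace E -> 0 < e ->
  (forall F, E F -> `|F| = 1 -> (e%:E <= mu (level e (Lrepr F)))%E) ->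
  exists E' : set L, [/\ closed_subspace E', isomorphic_subspaces E E' &
                         stable_phase_retrieval E'].
Proof.
move=> pr cE e0 Elev; have r1 : 1 <= r by move: p1; rewrite pr lee_fin.
pose K := C * (2 * C ^+ 2 + 1).
have K0 : 0 < K.
  have C0 : 0 < C by apply: lt_le_trans C1.
  by rewrite /K mulr_gt0// ltr_wpDl// mulr_ge0// exprn_ge0// ltW.
apply: (@Lspace_SPR_copy E (e / 3 * (e ^+ 2 / K))) => //.
  by rewrite !mulr_gt0// ?invr_gt0// exprn_gt0.
move=> F G EF EG F1 G1; have [h [mh hl] hN] := meet_sum_along_norm F G.
pose Q := level (e / 3) (sums (Lrepr F)) `&` level (e / 3) (sums (Lrepr G)).
have lev : (_ <= _ * mu Q)%E :=
  large_sums (ltW e0) (Lrepr_measurable F) (Lrepr_measurable G).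
have mQ : measurable Q.
  by apply: measurableI; apply: level_measurable; apply: sums_measurable;
    exact: Lrepr_measurable.
rewrite -lee_fin hN pr.
apply: le_trans (Lnorm_level_ge (A := Q) _ r1 mQ mh _ (hl (e / 3))); last 2 first.
- by rewrite divr_ge0// ltW.
- by apply: le_trans mu1; apply: le_measure; rewrite ?inE.
rewrite EFinM; apply: lee_wpmul2l; first by rewrite lee_fin divr_ge0// ltW.
have : ((e ^+ 2)%:E <= K%:E * mu Q)%E.
  apply: le_trans lev; rewrite expr2 EFinM.
  by apply: lee_pmul; rewrite ?lee_fin ?(ltW e0)//; exact: Elev.
rewrite -(fineK (fin mQ)) -EFinM !lee_fin => eK.
by rewrite ler_pdivrMr// mulrC.
Qed.

(** For [p = oo] positivity of those measures suffices, and a unit vector is at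
    least [1 / 2] on a set of positive measure. *)
Lemma Lspace_SPR_infinite (E : set L) : p = +oo%E -> closed_subspace E ->
  exists E' : set L, [/\ closed_subspace E', isomorphic_subspaces E E' &
                         stable_phase_retrieval E'].
Proof.
move=> py cE; have K0 : 0 < C * (2 * C ^+ 2 + 1).
  have C0 : 0 < C by apply: lt_le_trans C1.
  by rewrite mulr_gt0// ltr_wpDl// mulr_ge0// exprn_ge0// ltW.
have lev F : `|F| = 1 -> (0 < mu (level (1 / 2) (Lrepr F)))%E.
  move=> F1; rewrite lt0e measure_ge0 andbT; apply/eqP => l0.
  suff : `|F| <= 1 / 2 by rewrite F1; lra.
  rewrite -lee_fin Lspace_norm_Lrepr; apply: Lnorm_le_cst => //.
  exists (level (1 / 2) (Lrepr F)); split => //.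
    by apply: level_measurable; exact: Lrepr_measurable.
  by move=> x /= /negP; rewrite -ltNge => /ltW.
apply: (@Lspace_SPR_copy E (1 / 2 / 3)) => // F G _ _ F1 G1.
have [h [mh hl] hN] := meet_sum_along_norm F G.
have e0 : 0 <= (1 / 2 : R) by rewrite divr_ge0.
pose Q := level (1 / 2 / 3) (sums (Lrepr F)) `&` level (1 / 2 / 3) (sums (Lrepr G)).
have lQ : (_ <= _ * mu Q)%E :=
  large_sums e0 (Lrepr_measurable F) (Lrepr_measurable G).
have mQ : measurable Q.
  by apply: measurableI; apply: level_measurable; apply: sums_measurable;
    exact: Lrepr_measurable.
rewrite -lee_fin hN py; apply: (Lnormy_level_ge (A := Q)) => //.
- have := lt_le_trans (mule_gt0 (lev F F1) (lev G G1)) lQ.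
  by rewrite pmule_rgt0// lte_fin.
- exact: hl.
Qed.

End Lspace_SPR.

(** * The dichotomy of Kadec and Pelczynski *)

Section kadec_pelczynski.
Context d (T : measurableType d) (R : realType).
Variables (mu : {measure set T -> \bar R}) (p : \bar R) (p1 : (1 <= p)%E).
Hypothesis mu1 : (mu setT <= 1)%E.
Local Notation L := (LspaceType mu p1).
Implicit Types (F G : L) (A B D : set T).

Lemma Lrepr0 : {ae mu, forall x, Lrepr (0 : L) x = 0}.
Proof. by apply: filterS (LclassK (0 : LfunType mu p1)) => x /(_ I). Qed.

Definition Lrestr A F : L := Lof mu p1 (Lrepr F \* \1_A).

Lemma indic_norm_le A (f : T -> R) x : `|(f \* \1_A) x| <= `|f x|.
Proof.
by rewrite /= indicE; case: (x \in A); rewrite ?mulr1// mulr0 normr0.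
Qed.

Lemma Lgood_restr A F : measurable A -> Lgood mu p (Lrepr F \* \1_A).
Proof.
move=> mA; apply: (@Lgood_le _ _ _ mu p p1 _ (Lrepr F)).
- exact: Lgood_repr.
- by apply: measurable_funM; [exact: Lrepr_measurable|exact: measurable_indic].
- by apply: nearW => x; exact: indic_norm_le.
Qed.

Lemma LrestrK A F : measurable A ->
  {ae mu, forall x, Lrepr (Lrestr A F) x = Lrepr F x * \1_A x}.
Proof. by move=> mA; exact: LofK (Lgood_restr F mA). Qed.

Lemma Lrestr_norm A F : measurable A ->
  (`|Lrestr A F|%:E = 'N[mu]_p[EFin \o (Lrepr F \* \1_A)%R])%E.
Proof.
move=> mA; apply: Lspace_norm_repr; first by case: (Lgood_restr F mA).
exact: LrestrK.
Qed.

Lemma Lrestr_split A B F : measurable A -> measurable B ->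
  F - Lrestr (A `\` B) F = Lrestr (~` A) F + Lrestr (A `&` B) F.
Proof.
move=> mA mB; have mD := measurableD mA mB; have mC := measurableC mA.
have mI := measurableI _ _ mA mB; apply: Lspace_ext.
apply: filterS3 (filterI (LreprD F (- Lrestr (A `\` B) F)) (LreprN (Lrestr (A `\` B) F)))
  (filterI (LrestrK F mD) (LreprD (Lrestr (~` A) F) (Lrestr (A `&` B) F)))
  (filterI (LrestrK F mC) (LrestrK F mI)).
move=> x [-> ->] [-> ->] [-> ->]; rewrite !indicE in_setD in_setC in_setI.
by case: (x \in A); case: (x \in B); rewrite /= ?mulr1 ?mulr0; ring.
Qed.

Lemma Lrestr_disjoint A B F G : measurable A -> measurable B ->
  A `&` B = set0 ->
  lat_meet (modulus (Lrestr A F)) (modulus (Lrestr B G)) = 0.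
Proof.
move=> mA mB AB; apply: Lspace_ext.
apply: filterS3 (filterI (Lrepr_meet (modulus (Lrestr A F)) (modulus (Lrestr B G))) Lrepr0)
  (filterI (Lrepr_modulus (Lrestr A F)) (Lrepr_modulus (Lrestr B G)))
  (filterI (LrestrK F mA) (LrestrK G mB)).
move=> x [-> ->] [-> ->] [-> ->]; rewrite !indicE.
have [xA|xA] := boolP (x \in A); last by rewrite mulr0 normr0 min_l.
have [xB|xB] := boolP (x \in B); last by rewrite mulr0 normr0 min_r.
by exfalso; have : (A `&` B) x; [split; exact: set_mem|rewrite AB].
Qed.

(** If the normalized elements of [E] could be small off sets of arbitrarily
    small measure, a subsequence would be almost disjoint: each [F n] is cut down
    to the set [A n] where it is large, minus the later sets [A k], whose total
    measure [b n] is negligible for [F n] by absolute continuity. *)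
Lemma dispersed_levels (r : R) (E : set L) : p = r%:E -> dispersed_subspace E ->
  exists2 e : R, 0 < e &
    forall F, E F -> `|F| = 1 -> (e%:E <= mu (level e (Lrepr F)))%E.
Proof.
move=> pr [cE nE]; have r1 : 1 <= r by move: p1; rewrite pr lee_fin.
apply: contrapT => noe; apply: nE.
have /choice[pick pickP] : forall e : R, exists F, 0 < e ->
    [/\ E F, `|F| = 1 & (mu (level e (Lrepr F)) < e%:E)%E].
  move=> e; apply: contrapT => /forallNP nF; apply: noe; exists e.
    by apply: contrapT => e0; apply: (nF 0).
  move=> F EF F1; rewrite leNgt; apply/negP => lt.
  by apply: (nF F).
have /choice[del delP] : forall Fn : L * nat, exists c : R, 0 < c /\
    forall A, measurable A -> (mu A < c%:E)%E -> `|Lrestr A Fn.1| <= Fn.2.+1%:R^-1.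
  move=> [F n]; have [mF fF] := Lgood_repr F.
  have n0 : 0 < n.+1%:R^-1 :> R by rewrite invr_gt0.
  have small (f : T -> R) : measurable_fun [set: T] f -> finite_norm mu p f ->
      exists2 c : R, 0 < c & forall A, measurable A -> (mu A < c%:E)%E ->
      ('N[mu]_p[EFin \o (f \* \1_A)%R] <= (n.+1%:R^-1)%:E)%E.
    by rewrite /finite_norm pr; exact: Lnorm_small_set.
  have [c c0 cP] := small _ mF fF; exists c; split => // A mA Ac.
  by rewrite -lee_fin Lrestr_norm//; exact: cP.
(* [b n] is to bound the total measure of the exceptional sets after the [n]-th:
   the choice of [eps] makes the next of them at most half of [b n], and [b] at
   least halves at every step. *)
pose eps n b : R := Num.min n.+1%:R^-1 (b / 2).
pose b := fix b n := if n is n'.+1 then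
    Num.min (b n' / 2) (del (pick (eps n (b n')), n) / 2)
  else del (pick 1, 0%N) / 2.
pose e n := if n is n'.+1 then eps n (b n') else 1.
pose F n := pick (e n).
have bE n : b n.+1 = Num.min (b n / 2) (del (F n.+1, n.+1) / 2) by [].
have b0 n : 0 < b n.
  elim: n => [|n IH]; first by rewrite divr_gt0//; case: (delP (pick 1, 0%N)).
  rewrite bE lt_min !divr_gt0//; by case: (delP (F n.+1, n.+1)).
have e0 n : 0 < e n.
  by case: n => //= n; rewrite /eps lt_min invr_gt0 ltr0n divr_gt0.
have eS n : e n.+1 <= b n / 2 by rewrite /= /eps ge_min lexx orbT.
have en n : e n <= n.+1%:R^-1 by case: n => [|n]; rewrite /= ?invr1// /eps ge_min lexx.
have bdel n : b n <= del (F n, n) / 2.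
  by case: n => [|n]; [rewrite lexx|rewrite bE ge_min lexx orbT].
have bhalf n i : b (n + i)%N <= b n / (2 ^ i)%:R.
  elim: i => [|i IH]; first by rewrite addn0 divr1.
  rewrite addnS bE ge_min; apply/orP; left.
  rewrite expnSr natrM invfM mulrA ler_pM2r ?invr_gt0//.
have FP n := pickP (e n) (e0 n).
pose A n := level (e n) (Lrepr (F n)).
have mA n : measurable (A n) by apply: level_measurable; exact: Lrepr_measurable.
have A_small n : (mu (A n) <= (e n)%:E)%E by apply: ltW; case: (FP n).
pose U n := \bigcup_i A (n + i).+1.
have mU n : measurable (U n) by apply: bigcupT_measurable => i; exact: mA.
have U_small n : (mu (U n) <= (b n)%:E)%E.
  apply: le_trans (epsilon_trick0 xpredT (ltW (b0 n))).
  have : (mu (U n) <= \sum_(i <oo) mu (A (n + i).+1))%E.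
    by apply: measure_sigma_subadditive.
  move=> /le_trans; apply.
  apply: lee_nneseries => // i _; apply: le_trans (A_small _) _.
  rewrite lee_fin; apply: le_trans (eS _) _.
  by rewrite expnSr natrM invfM mulrA ler_pM2r ?invr_gt0.
exists F; first by move=> n; case: (FP n).
split; first by move=> n; case: (FP n).
exists (fun n => Lrestr (A n `\` U n) (F n)).
  have lt_disj n m : (n < m)%N -> (A n `\` U n) `&` (A m `\` U m) = set0.
    move=> nm; apply/seteqP; split=> // x [[_ nU] [Am _]]; apply: nU.
    by exists (m - n.+1)%N => //; rewrite -addSn subnKC.
  move=> n m nm; have mD k : measurable (A k `\` U k) by exact: measurableD.
  apply: Lrestr_disjoint => //; have [h|h|//] := ltngtP n m; first exact: lt_disj.
  by rewrite setIC; exact: lt_disj.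
have dist n : `|F n - Lrestr (A n `\` U n) (F n)| <= 2 * n.+1%:R^-1.
  rewrite Lrestr_split// mulr_natl mulr2n; apply: le_trans (ler_normD _ _) _.
  apply: lerD.
    apply: le_trans (en n); have mC := measurableC (mA n).
    rewrite -lee_fin Lrestr_norm//; apply: Lnorm_le_cst => //; first exact: ltW.
      by case: (Lgood_restr (F n) mC).
    apply: nearW => x; rewrite /= indicE in_setC.
    have [xA|/negP xA] := boolP (x \in A n); first by rewrite mulr0 normr0 ltW.
    rewrite mulr1 leNgt; apply/negP => lt; apply: xA.
    by apply/mem_set; exact: ltW.
  have mI : measurable (A n `&` U n) by exact: measurableI.
  apply: (delP (F n, n)).2 => //.
  apply: le_lt_trans (_ : (mu (U n) < _)%E); first by apply: le_measure; rewrite ?inE.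
  apply: le_lt_trans (U_small n) _; rewrite lte_fin.
  apply: le_lt_trans (bdel n) _; rewrite ltr_pdivrMr// ltr_pMr ?ltrDl//.
  by case: (delP (F n, n)).
have lim0 : (2 * n.+1%:R^-1 : R) @[n --> \oo] --> (0 : R).
  by rewrite -[X in _ --> X](mulr0 2); apply: cvgM (cvg_cst _) _; exact: cvg_harmonic.
apply: (squeeze_cvgr _ (cvg_cst 0) lim0).
by apply: nearW => n; rewrite normr_ge0 dist.
Qed.

End kadec_pelczynski.

(** * [L_p] of the unit interval *)

Section Lp_unit_interval.
Context (R : realType).
Local Notation T := (measurableTypeR R).
Local Notation mu := (@lebesgue01 R).

(** Half of the interval runs along the diagonal of the unit square, the other
    half along the Peano curve, so both coordinates preserve the measure and
    rectangles keep at least half of their area. *)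
Lemma lebesgue01_filling : exists s t k : T -> T, exists C : R,
  [/\ [/\ measurable_fun [set: T] s, measurable_fun [set: T] t,
          measurable_fun [set: T] k & 1 <= C],
      forall A, measurable A -> [/\ (mu (s @^-1` A) <= C%:E * mu A)%E,
        (mu (t @^-1` A) <= C%:E * mu A)%E & (mu (k @^-1` A) <= C%:E * mu A)%E],
      {ae mu, forall x, s (k x) = x}, {ae mu, forall x, t (k x) = x} &
      forall A B, measurable A -> measurable B ->
        (mu A * mu B <= C%:E * mu (s @^-1` A `&` t @^-1` B))%E].
Proof.
have [u [v [ru rv uE vE]]] := peano_curve R.
pose s : T -> T := diagonal_then u; pose t : T -> T := diagonal_then v.
pose k : T -> T := fun x : R => (2^-1 * x + 0 : R).
have ms : measurable_fun [set: T] s.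
  by apply: continuous_measurable_fun; exact: diagonal_then_continuous.
have mt : measurable_fun [set: T] t.
  by apply: continuous_measurable_fun; exact: diagonal_then_continuous.
have mk : measurable_fun [set: T] k by exact: affine_measurable.
have kE x : k x = x / 2 by rewrite /k addr0 mulrC.
have mu_ : measurable_fun [set: T] (u : T -> T).
  by apply: continuous_measurable_fun; case: ru.
have mv_ : measurable_fun [set: T] (v : T -> T).
  by apply: continuous_measurable_fun; case: rv.
have law A B : measurable A -> measurable B ->
    vol (s @^-1` A `&` t @^-1` B) = 2^-1 * (vol (A `&` B) + vol A * vol B).
  move=> mA mB; have mI : measurable (s @^-1` A `&` t @^-1` B).
    by apply: measurableI; [exact: (preimage_measurable ms mA)|
      exact: (preimage_measurable mt mB)].
  rewrite (vol_halves mI) -(peano_independent ru rv uE vE mA mB) /joint.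
  congr (_ * (_ + _)); apply: vol_congr => x x01.
    by rewrite /= /s /t (diagonal_thenE ru x).1// (diagonal_thenE rv x).1.
  by rewrite /= /s /t (diagonal_thenE ru x).2// (diagonal_thenE rv x).2.
have ae01 (P : set T) : (forall x : R, 0 <= x <= 1 -> P x) -> {ae mu, forall x, P x}.
  move=> P01; exists (~` `[0, 1]%classic); split.
  - by apply: measurableC; exact: measurable_itv.
  - by rewrite lebesgue01E setICl measure0.
  - by move=> x nP; apply: contra_not nP => /= ; rewrite in_itv/=; exact: P01.
have toE A B (c : R) : measurable A -> measurable B -> vol A <= c * vol B ->
    (mu A <= c%:E * mu B)%E.
  by move=> mA mB; rewrite -(volE mA) -(volE mB) -EFinM lee_fin.
exists s, t, k, 2; split.
- by split => //; lra.
- move=> A mA; have lA := law A setT mA measurableT.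
  have lB := law setT A measurableT mA.
  rewrite volT preimage_setT setIT setIT mulr1 in lA.
  rewrite volT preimage_setT setTI setTI mul1r in lB.
  have A0 := vol_ge0 mA.
  split; apply: toE => //.
  + exact: (preimage_measurable ms mA).
  + by rewrite lA; lra.
  + exact: (preimage_measurable mt mA).
  + by rewrite lB; lra.
  + exact: (preimage_measurable mk mA).
  + have -> : k @^-1` A = [set y : R | A (y / 2)].
      by apply/funext => y; rewrite /preimage/= kE.
    rewrite (vol_halves mA).
    have : 0 <= vol [set y : R | A (1 - y / 2)].
      have -> : [set y : R | A (1 - y / 2)] = (fun y => - 2^-1 * y + 1) @^-1` A.
        by apply/funext => y /=; congr A; ring.
      by apply: vol_ge0; apply: preimage_measurable mA; exact: affine_measurable.
    by set a := vol _; set b := vol _; lra.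
- by apply: ae01 => x x01; rewrite kE /s (diagonal_thenE ru x).1.
- by apply: ae01 => x x01; rewrite kE /t (diagonal_thenE rv x).1.
- move=> A B mA mB; have mI : measurable (s @^-1` A `&` t @^-1` B).
    by apply: measurableI; [exact: (preimage_measurable ms mA)|
      exact: (preimage_measurable mt mB)].
  rewrite -(volE mA) -(volE mB) -(volE mI) -!EFinM lee_fin law//.
  have := vol_ge0 (measurableI _ _ mA mB); set a := vol _; set b := vol _ * _; lra.
Qed.

Lemma Lp01_SPR_copies (p : \bar R) (p1 : (1 <= p)%E) :
  dispersed_have_SPR_copies (Lp01 p1).
Proof.
move=> E dE.
have [s [t [k [C [[ms mt mk C1] bound ks kt st]]]]] := lebesgue01_filling.
have mu1 : (mu setT <= 1)%E by rewrite lebesgue01_setT.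
have sC A (mA : measurable A) : (mu (s @^-1` A) <= C%:E * mu A)%E by case: (bound A mA).
have tC A (mA : measurable A) : (mu (t @^-1` A) <= C%:E * mu A)%E by case: (bound A mA).
have kC A (mA : measurable A) : (mu (k @^-1` A) <= C%:E * mu A)%E by case: (bound A mA).
have [py|pN] := eqVneq p +oo%E.
  exact: (@Lspace_SPR_infinite _ T R mu p p1 mu1 s t k C ms mt mk C1 sC tC kC ks kt st
    E py dE.1).
have pr : p = (fine p)%:E.
  by rewrite fineK// fin_numE pN andbT; apply: contraTneq (p1) => ->.
have [e e0 eP] := @dispersed_levels _ T R mu p p1 mu1 (fine p) E pr dE.
exact: (@Lspace_SPR_finite _ T R mu p p1 mu1 s t k C ms mt mk C1 sC tC kC ks kt st
  (fine p) E e pr dE.1 e0 eP).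
Qed.

End Lp_unit_interval.

(** * Disjointness and finite dimension *)

Section disjointness.
Context (R : realType) (X : normedLatticeType R).
Implicit Types (x y z a b : X).

Definition perp a : set X := [set x | lat_meet (modulus x) a = 0].

Lemma lat_meet_pos_eq0 x y : lat_le 0 x -> lat_le 0 y ->
  lat_le (lat_meet x y) 0 -> lat_meet x y = 0.
Proof. by move=> x0 y0 xy; apply: lat_le_anti => //; exact: lat_meet_ge0. Qed.

Lemma lat_meetD_le x y a : lat_le 0 x -> lat_le 0 y -> lat_le 0 a ->
  lat_le (lat_meet (x + y) a) (lat_meet x a + lat_meet y a).
Proof.
move=> x0 y0 a0; set w := lat_meet (x + y) a.
have [wxy wa] := lat_meet_le (x + y) a; rewrite -/w in wxy wa.
have sub z : lat_le 0 z -> lat_le (w - z) a.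
  move=> z0; apply: (lat_le_trans _ wa); apply/lat_leBlDr.
  by rewrite -[X in lat_le X _]addr0; exact: lat_leD2l.
rewrite addrC; apply/lat_leBlDr; apply/lat_meetP; split; last first.
  by apply: sub; exact: lat_meet_ge0.
apply/lat_leBlDr; rewrite addrC; apply/lat_leBlDr; apply/lat_meetP; split.
  by apply/lat_leBlDr.
exact: sub.
Qed.

Lemma perp_le a x y : lat_le 0 a -> perp a x -> lat_le (modulus y) (modulus x) ->
  perp a y.
Proof.
move=> a0 xa yx; apply: lat_meet_pos_eq0 => //; first exact: modulus_ge0.
rewrite -[X in lat_le _ X]xa; apply: lat_leS_meet => //; exact: lat_le_refl.
Qed.

Lemma perp0 a : lat_le 0 a -> perp a 0.
Proof.
move=> a0; apply: lat_meet_pos_eq0 => //; first exact: modulus_ge0.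
by rewrite (modulus_pos (lat_le_refl 0)); apply lat_meet_le.
Qed.

Lemma perpD a x y : lat_le 0 a -> perp a x -> perp a y -> perp a (x + y).
Proof.
move=> a0 xa ya; apply: lat_meet_pos_eq0 => //; first exact: modulus_ge0.
apply: lat_le_trans (lat_leS_meet (modulusD x y) (lat_le_refl a)) _.
apply: lat_le_trans (lat_meetD_le _ _ a0) _; try exact: modulus_ge0.
by rewrite xa ya addr0; exact: lat_le_refl.
Qed.

Lemma perpZ a (c : R) x : lat_le 0 a -> perp a x -> perp a (c *: x).
Proof.
move=> a0 xa; have xan n : perp a (x *+ n).
  by elim: n => [|n IH]; [rewrite mulr0n; exact: perp0|rewrite mulrS; exact: perpD].
apply: (perp_le a0 (xan (Num.truncn `|c|).+1)).
rewrite -scaler_nat !modulusZ; apply: lat_leZ2r; first exact: modulus_ge0.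
by rewrite normr_nat ltW// truncnS_gt.
Qed.

Lemma perpB a x y : lat_le 0 a -> perp a x -> perp a y -> perp a (x - y).
Proof.
by move=> a0 xa ya; apply: perpD => //; rewrite -scaleN1r; exact: perpZ.
Qed.

Lemma perp_sum a (I : Type) (s : seq I) (P : pred I) (x : I -> X) : lat_le 0 a ->
  (forall i, P i -> perp a (x i)) -> perp a (\sum_(i <- s | P i) x i).
Proof.
by move=> a0 xa; elim/big_ind: _ => //; [exact: perp0|move=> *; exact: perpD].
Qed.

Lemma perp_sym a b : lat_le 0 a -> lat_le 0 b -> perp a b -> perp b a.
Proof. by move=> a0 b0; rewrite /perp/= !modulus_pos// lat_meetC. Qed.

(** [|x|] is at most [|x + y| + |y|], and meets [|y|] in [0]. *)
Lemma modulus_perpD x y : lat_meet (modulus y) (modulus x) = 0 ->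
  lat_le (modulus x) (modulus (x + y)).
Proof.
move=> xy; have m0 := modulus_ge0.
have le1 : lat_le (modulus x) (modulus (x + y) + modulus y).
  by rewrite -{1}(addrK y x) -(modulusN y); exact: modulusD.
have : lat_le (modulus x) (lat_meet (modulus (x + y) + modulus y) (modulus x)).
  by apply/lat_meetP; split => //; exact: lat_le_refl.
move=> /lat_le_trans; apply; apply: lat_le_trans (lat_meetD_le _ _ _) _ => //.
by rewrite xy addr0; apply lat_meet_le.
Qed.

End disjointness.

Section finite_dimension.
Context (R : realType) (X : normedLatticeType R).

Definition lincomb n (e : 'I_n -> X) (c : 'rV[R]_n) : X := \sum_i c 0 i *: e i.

Lemma lincombD n (e : 'I_n -> X) (a : R) (c c' : 'rV[R]_n) :
  lincomb e (a *: c + c') = a *: lincomb e c + lincomb e c'.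
Proof.
rewrite /lincomb scaler_sumr -big_split; apply: eq_bigr => i _.
by rewrite !mxE scalerDl scalerA.
Qed.

Lemma lincombB n (e : 'I_n -> X) (c c' : 'rV[R]_n) :
  lincomb e (c - c') = lincomb e c - lincomb e c'.
Proof. by rewrite addrC -scaleN1r lincombD scaleN1r addrC. Qed.

Lemma lincombZ n (e : 'I_n -> X) (a : R) (c : 'rV[R]_n) :
  lincomb e (a *: c) = a *: lincomb e c.
Proof.
by rewrite /lincomb scaler_sumr; apply: eq_bigr => i _; rewrite mxE scalerA.
Qed.

Lemma coord_le_norm n (c : 'rV[R]_n) i : `|c 0 i| <= `|c|.
Proof.
rewrite [leRHS]mx_normrE; exact: (le_bigmax _ (fun ij => `|c ij.1 ij.2|) (0, i)).
Qed.

Lemma lincomb_norm_le n (e : 'I_n -> X) (c : 'rV[R]_n) :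
  `|lincomb e c| <= (\sum_i `|e i|) * `|c|.
Proof.
apply: le_trans (ler_norm_sum _ _ _) _; rewrite mulr_suml; apply: ler_sum => i _.
by rewrite normrZ mulrC ler_wpM2l// coord_le_norm.
Qed.

Lemma lincomb_continuous n (e : 'I_n -> X) : continuous (lincomb e).
Proof.
apply/continuous_subspace_setT.
apply: (@within_continuous_lipschitz _ _ _ _ _ (\sum_i `|e i|)) => c c' _ _.
by rewrite -lincombB; exact: lincomb_norm_le.
Qed.

Lemma closed_norm_preimage n (A : set R) : closed A ->
  closed [set c : 'rV[R]_n | A `|c|].
Proof.
move=> cA; have -> : [set c : 'rV[R]_n | A `|c|] = Num.norm @^-1` A by [].
have nc : continuous (Num.norm : 'rV[R]_n -> R) by exact: norm_continuous.
by move/continuous_closedP: nc; apply.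
Qed.

Lemma ball_rV_compact n (r : R) : compact [set c : 'rV[R]_n | `|c| <= r].
Proof.
apply: bounded_closed_compact.
  exists r; split; first exact: num_real.
  by move=> M rM c /= cr; apply: le_trans cr (ltW rM).
by apply: (@closed_norm_preimage n [set x | x <= r]); exact: closed_le.
Qed.

Definition independent n (e : 'I_n -> X) :=
  forall c : 'rV[R]_n, lincomb e c = 0 -> c = 0.

(** The sphere of the coordinate space is compact, so that the norm of the
    combination attains a minimum there, positive by independence. *)
Lemma independent_lower_bound n (e : 'I_n -> X) : independent e ->
  exists2 r : R, 0 < r & forall c, r * `|c| <= `|lincomb e c|.
Proof.
move=> ie; pose S := [set c : 'rV[R]_n | `|c| <= 1] `&` [set c | 1 <= `|c|].
have cS : compact S.
  apply: (@subclosed_compact _ _ [set c : 'rV[R]_n | `|c| <= 1]).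
  - apply: closedI.
      by apply: (@closed_norm_preimage n [set x | x <= 1]); exact: closed_le.
    by apply: (@closed_norm_preimage n [set x | 1 <= x]); exact: closed_ge.
  - exact: ball_rV_compact.
  - by move=> c [].
have unit_S (c : 'rV[R]_n) : c != 0 -> S (`|c|^-1 *: c).
  move=> c0; have -> : S = [set c | `|c| = 1].
    apply/seteqP; split=> c' /=; first by case=> h1 h2; apply/le_anti; rewrite h1.
    by move=> c1; split; rewrite /= c1.
  by rewrite /= mx_normZ normfV normr_id mulVf// normr_eq0.
have [S0|S0] := pselect (S !=set0); last first.
  exists 1 => // c; have [->|c0] := eqVneq c 0; first by rewrite normr0 mulr0.
  by exfalso; apply: S0; exists (`|c|^-1 *: c); exact: unit_S.
have [|c cS' cmin] := @EVT_min_rV R n (fun c => `|lincomb e c|) S S0 cS.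
  apply: continuous_subspaceT => c.
  apply: (@continuous_comp _ _ _ (lincomb e) (fun x : X => `|x|)).
    exact: lincomb_continuous.
  exact: norm_continuous.
exists `|lincomb e c|.
  rewrite normr_gt0; apply/eqP => /ie c0; move: cS'; rewrite c0 inE => -[_ /=].
  by rewrite normr0 ler10.
move=> c'; have [->|c'0] := eqVneq c' 0; first by rewrite normr0 mulr0.
have := cmin (`|c'|^-1 *: c') (mem_set (unit_S _ c'0)).
by rewrite lincombZ normrZ normfV normr_id ler_pdivlMl ?normr_gt0// mulrC.
Qed.

(** Near a point of the closure the combinations have bounded coordinates, and
    closed balls of the coordinate space are compact. *)
Lemma closed_lincomb_range n (e : 'I_n -> X) (r : R) : 0 < r ->
  (forall c, r * `|c| <= `|lincomb e c|) -> closed (range (lincomb e)).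
Proof.
move=> r0 rc y cly.
pose M := r^-1 * (`|y| + 1); pose B := [set c : 'rV[R]_n | `|c| <= M].
have cB : closed (lincomb e @` B).
  apply: compact_closed; first exact: norm_hausdorff.
  apply: continuous_compact; last exact: ball_rV_compact.
  by apply: continuous_subspaceT; exact: lincomb_continuous.
suff : (lincomb e @` B) y by case=> c _ <-; exists c.
apply: cB => U Uy.
have V : nbhs y (U `&` [set z | `|z| <= `|y| + 1]).
  apply: filterI => //; have yy : id z @[z --> y] --> y by exact: cvg_id.
  have lt : `|y| < `|y| + 1 by rewrite ltrDl.
  exact: (cvgr_norm_le y yy _ lt).
have [z [[c _ <-] [Uz zy]]] := cly _ V; exists (lincomb e c); split => //.
exists c => //; rewrite /B/= /M ler_pdivlMl//; apply: le_trans (rc c) zy.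
Qed.

End finite_dimension.

(** * Dispersed subspaces of finite dimension *)

Section finite_dimensional_copies.
Context (R : realType) (X : normedLatticeType R).
Implicit Types (E : set X) (x y : X).

Definition basis_of n (e : 'I_n -> X) E :=
  [/\ independent e, forall i, E (e i) & forall x, E x -> exists c, x = lincomb e c].

Lemma disjoint_sum_coef (I : finType) (b : I -> X) (r : I -> R) k :
  (forall i, lat_le 0 (b i)) -> (forall i j, i != j -> perp (b i) (b j)) ->
  lat_le (`|r k| *: b k) (modulus (\sum_i r i *: b i)).
Proof.
move=> b0 bd; rewrite (bigD1 k)//= -{1}(modulus_pos (b0 k)) -modulusZ.
set y := \sum_(i | _) _; apply: modulus_perpD.
have yk : perp (b k) y.
  by apply: perp_sum => // i ik; apply: perpZ => //; apply: bd; rewrite eq_sym.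
have : perp (modulus y) (b k).
  by rewrite /perp/= lat_meetC (modulus_pos (b0 k)).
by move=> /(perpZ (r k) (modulus_ge0 y)); rewrite /perp/= lat_meetC.
Qed.

(** In coordinates, [c] is sent to the vector of all sums [c i + c j] placed on
    disjoint vectors: the finite counterpart of summing along a filling path. *)
Lemma finite_dim_SPR_copy E n (e : 'I_n -> X) (a : nat -> X) :
  closed_subspace E -> basis_of e E ->
  (forall k, lat_le 0 (a k)) -> (forall k, `|a k| = 1) ->
  (forall k l, k != l -> perp (a k) (a l)) ->
  exists E' : set X, [/\ closed_subspace E', isomorphic_subspaces E E' &
                         stable_phase_retrieval E'].
Proof.
move=> cE [ie Ee Esp] a0 a1 ad.
pose b (k : 'I_n * 'I_n) := a (enum_rank k).
have b0 k : lat_le 0 (b k) by exact: a0.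
have b1 k : `|b k| = 1 by exact: a1.
have bd k l : k != l -> perp (b k) (b l).
  move=> kl; apply: ad; apply: contra kl => /eqP/val_inj/enum_rank_inj ->.
  exact: eqxx.
pose g (i : 'I_n) := \sum_k ((i == k.1)%:R + (i == k.2)%:R : R) *: b k.
have gE c : lincomb g c = \sum_k (c 0 k.1 + c 0 k.2) *: b k.
  rewrite /lincomb /g; under eq_bigr do rewrite scaler_sumr.
  rewrite exchange_big; apply: eq_bigr => k _.
  under eq_bigr do rewrite scalerA.
  rewrite -scaler_suml; congr (_ *: _).
  under eq_bigr do rewrite mulrDr.
  rewrite big_split; congr (_ + _).
    rewrite (bigD1 k.1)//= eqxx mulr1 big1 ?addr0// => i /negPf ->.
    by rewrite mulr0.
  rewrite (bigD1 k.2)//= eqxx mulr1 big1 ?addr0// => i /negPf ->.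
  by rewrite mulr0.
have coef (c : 'rV[R]_n) k : lat_le (`|c 0 k.1 + c 0 k.2| *: b k) (modulus (lincomb g c)).
  by rewrite gE; apply: (disjoint_sum_coef (fun k => c 0 k.1 + c 0 k.2) k).
have glow c : 1 * `|c| <= `|lincomb g c|.
  have [->|c0] := eqVneq c 0; first by rewrite normr0 mulr0.
  have [[z i] ci] : exists i, `|c| = `|c i.1 i.2|.
    by apply: mx_norm_neq0; rewrite -[mx_norm c]/(`|c|) normr_eq0.
  rewrite (ord1 z) /= in ci; rewrite mul1r ci.
  apply: le_trans (_ : `|c 0 i + c 0 i| <= _).
    by rewrite -mulr2n normrMn mulr2n lerDl.
  have := coef c (i, i); rewrite -[leRHS]lat_norm_modulus => /lat_norm_mono_pos.
  rewrite normrZ b1 mulr1 normr_id; apply.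
  by apply: lat_scale_ge0 => //; exact: normr_ge0.
have [r r0 er] := independent_lower_bound ie.
have /choice[co coP] : forall x, exists c, E x -> x = lincomb e c.
  move=> x; have [/Esp[c xc]|nEx] := pselect (E x); first by exists c.
  by exists 0.
have coD t x y : E x -> E y -> co (t *: x + y) = t *: co x + co y.
  move=> Ex Ey; apply/eqP; rewrite -subr_eq0; apply/eqP/ie.
  have Et : E (t *: x + y).
    by apply: closed_subspaceD => //; exact: closed_subspaceZ.
  by rewrite lincombB lincombD -!coP// subrr.
have co_le x : E x -> `|co x| <= r^-1 * `|x|.
  by move=> Ex; rewrite ler_pdivlMl// {2}(coP x Ex).
pose Me := \sum_i `|e i|; have Me0 : 0 <= Me by apply: sumr_ge0.
pose M := Me + 1; have M0 : 0 < M by rewrite ltr_wpDl.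
have colow x : E x -> `|x| = 1 -> exists i, M^-1 <= `|co x 0 i|.
  move=> Ex x1; have h : 1 <= M * `|co x|.
    rewrite -x1 {1}(coP x Ex); apply: le_trans (lincomb_norm_le _ _) _.
    by rewrite ler_wpM2r// lerDl.
  have c0 : co x != 0.
    by apply/eqP => c0; move: h; rewrite c0 normr0 mulr0 ler10.
  have [[z i] ci] : exists i, `|co x| = `|co x i.1 i.2|.
    by apply: mx_norm_neq0; rewrite -[mx_norm _]/(`|co x|) normr_eq0.
  rewrite (ord1 z) /= in ci; exists i; rewrite -ci.
  by rewrite -[leLHS]mulr1 ler_pdivrMl.
pose T x := lincomb g (co x).
apply: (@SPR_copy _ _ E T ((\sum_i `|g i|) * r^-1) (M^-1 / 3)) => //.
- by move=> t x y Ex Ey; rewrite /T coD// lincombD.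
- by rewrite mulr_ge0 ?sumr_ge0// invr_ge0 ltW.
- move=> x Ex; apply: le_trans (lincomb_norm_le _ _) _.
  by rewrite -mulrA ler_wpM2l ?sumr_ge0// co_le.
- by rewrite divr_gt0// invr_gt0.
- move=> u v Eu Ev /(colow u Eu)[i ui] /(colow v Ev)[j vj].
  have far k : M^-1 / 3 <= `|co u 0 k.1 + co u 0 k.2| ->
      M^-1 / 3 <= `|co v 0 k.1 + co v 0 k.2| ->
      M^-1 / 3 <= `|lat_meet (modulus (T u)) (modulus (T v))|.
    have c0 : 0 <= M^-1 / 3 by rewrite divr_ge0// invr_ge0 ltW.
    have nb : M^-1 / 3 = `|(M^-1 / 3) *: b k| by rewrite normrZ b1 mulr1 ger0_norm.
    move=> uk vk; rewrite [leLHS]nb.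
    apply: lat_norm_mono_pos; first exact: lat_scale_ge0.
    apply/lat_meetP; split.
      by apply: lat_le_trans (coef (co u) k); exact: lat_leZ2r.
    by apply: lat_le_trans (coef (co v) k); exact: lat_leZ2r.
  have diag l : M^-1 / 3 <= `|co u 0 l| -> M^-1 / 3 <= `|co v 0 l| ->
      M^-1 / 3 <= `|lat_meet (modulus (T u)) (modulus (T v))|.
    move=> ul vl; apply: (far (l, l)) => /=.
      by rewrite -mulr2n normrMn mulr2n; have := normr_ge0 (co u 0 l); lra.
    by rewrite -mulr2n normrMn mulr2n; have := normr_ge0 (co v 0 l); lra.
  have Mi0 : 0 < M^-1 by rewrite invr_gt0.
  have [h|h|[h1 h2]] := large_on_pair (co u 0 j) (co v 0 i) ui vj.
  + by apply: (diag i) => //; lra.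
  + by apply: (diag j) => //; lra.
  + exact: (far (i, j)).
- have -> : T @` E = range (lincomb g).
    apply/seteqP; split=> [_ [x Ex <-]|_ [c _ <-]]; first by exists (co x).
    have Ec : E (lincomb e c).
      have E0 : E 0 by case: (cE) => [[+ _] _]; rewrite inE.
      rewrite /lincomb; elim/big_ind: _ => //.
        by move=> x y; exact: closed_subspaceD.
      by move=> i _; exact: closed_subspaceZ.
    exists (lincomb e c) => //; rewrite /T; congr lincomb.
    by apply/eqP; rewrite -subr_eq0; apply/eqP/ie; rewrite lincombB -coP// subrr.
  exact: closed_lincomb_range ltr01 glow.
Qed.

(** Subspaces of codimension at most one. *)
Definition hyperplane (H : set X) :=
  (forall (a : R) x y, H x -> H y -> H (a *: x + y)) /\
  (forall x y, ~ H x -> exists r : R, H (y - r *: x)).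

(** Each hyperplane of the list leaves at most one new basis vector. *)
Lemma hyperplanes_basis (I : eqType) (H : I -> set X) (s : seq I) E :
  (forall a x y, E x -> E y -> E (a *: x + y)) ->
  (forall i, i \in s -> hyperplane (H i)) ->
  (forall x, E x -> (forall i, i \in s -> H i x) -> x = 0) ->
  exists n (e : 'I_n -> X), basis_of e E.
Proof.
elim: s E => [|h s IH] E Elin Hs Etriv.
  exists 0%N, (fun=> 0); split=> [c _|[]//|x Ex].
    by apply/rowP => -[].
  by exists 0; rewrite (Etriv x Ex)// /lincomb big_ord0.
have [Hlin Hcodim] := Hs h (mem_head _ _).
have [|||n [e [ie Ee Esp]]] := IH (E `&` H h).
- by move=> a x y [Ex Hx] [Ey Hy]; split; [exact: Elin|exact: Hlin].
- by move=> i si; apply: Hs; rewrite inE si orbT.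
- move=> x [Ex Hx] sx; apply: Etriv => // i; rewrite inE => /predU1P[->//|]; exact: sx.
have [[x0 Ex0 nHx0]|allH] := pselect (exists2 x, E x & ~ H h x); last first.
  exists n, e; split=> //; first by move=> i; case: (Ee i).
  move=> x Ex; apply: Esp; split => //; apply: contrapT => nHx.
  by apply: allH; exists x.
pose e' (i : 'I_n.+1) := if unlift ord0 i is Some j then e j else x0.
pose tl (c : 'rV[R]_n.+1) : 'rV[R]_n := \row_j c 0 (lift ord0 j).
have e'E c : lincomb e' c = c 0 ord0 *: x0 + lincomb e (tl c).
  rewrite /lincomb big_ord_recl /e' unlift_none; congr (_ + _).
  by apply: eq_bigr => j _; rewrite liftK mxE.
have H0 : H h 0.
  have [Hx0|//] := pselect (exists x, H h x).
    by have [x Hx] := Hx0; have := Hlin (-1) x x Hx Hx; rewrite scaleN1r addNr.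
  move=> nH; have [r Hr] := Hcodim x0 x0 nHx0.
  by exfalso; apply: nH; exists (x0 - r *: x0).
have Hlc c : H h (lincomb e c).
  rewrite /lincomb; elim/big_rec: _ => // i x _ Hx; apply: Hlin => //.
  by case: (Ee i).
exists n.+1, e'; split.
- move=> c; rewrite e'E => c0; have c00 : c 0 ord0 = 0.
    apply: contrapT => /eqP nz; apply: nHx0.
    have -> : x0 = - (c 0 ord0)^-1 *: lincomb e (tl c) + 0.
      rewrite addr0; apply/eqP; rewrite scaleNr -addr_eq0; apply/eqP.
      by rewrite -[x0](scalerK nz) -scalerDr c0 scaler0.
    exact: Hlin.
  have /ie tl0 : lincomb e (tl c) = 0 by rewrite -c0 c00 scale0r add0r.
  apply/rowP => i; rewrite mxE; case: (unliftP ord0 i) => [j|] ->//.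
  by have := congr1 (fun M : 'rV[R]_n => M 0 j) tl0; rewrite !mxE.
- move=> i; rewrite /e'; case: (unlift _ _) => // j; by case: (Ee j).
- move=> x Ex; have [r Hr] := Hcodim x0 x nHx0.
  have [|c xc] := Esp (x - r *: x0).
    split => //; rewrite addrC -scaleNr; exact: Elin.
  pose c' : 'rV[R]_n.+1 := \row_i if unlift ord0 i is Some j then c 0 j else r.
  have tlc : tl c' = c by apply/rowP => j; rewrite !mxE liftK.
  by exists c'; rewrite e'E tlc mxE unlift_none -xc subrKC.
Qed.

(** Gliding hump. [H j] is a decreasing family of tails: any element of a tail is
    nearly equal to some [d] it dominates, such that [d] is disjoint from
    everything dominated by a further tail. *)
Lemma gliding_hump (J : Type) (H : J -> set X) (j0 : J) E :
  (forall a x, E x -> E (a *: x)) -> (forall j a x, H j x -> H j (a *: x)) ->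
  (forall j x (e : R), H j x -> 0 < e -> exists j' d, [/\ `|x - d| < e,
     lat_le (modulus d) (modulus x), H j' `<=` H j &
     forall y d', H j' y -> lat_le (modulus d') (modulus y) ->
       lat_meet (modulus d) (modulus d') = 0]) ->
  (~ exists2 x, (forall n, E (x n)) & normalized_almost_disjoint x) ->
  exists j, forall x, E x -> H j x -> x = 0.
Proof.
move=> EZ HZ step noE; apply: contrapT => nj; apply: noE.
have /choice[x xP] : forall j, exists x, [/\ E x, H j x & `|x| = 1].
  move=> j; apply: contrapT => nx; apply: nj; exists j => x Ex Hx.
  apply/eqP; apply: contrapT => /negP x0; apply: nx.
  exists (`|x|^-1 *: x); split; [exact: EZ|exact: HZ|].
  by rewrite normrZ normfV normr_id mulVf// normr_eq0.
have /choice[st stP] : forall jn : J * nat, exists st : J * X,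
    [/\ `|x jn.1 - st.2| < jn.2.+1%:R^-1,
        lat_le (modulus st.2) (modulus (x jn.1)), H st.1 `<=` H jn.1 &
        forall y d', H st.1 y -> lat_le (modulus d') (modulus y) ->
          lat_meet (modulus st.2) (modulus d') = 0].
  move=> [j n]; have [_ Hx _] := xP j.
  have n0 : 0 < n.+1%:R^-1 :> R by rewrite invr_gt0.
  by have [j' [d dP]] := step j (x j) _ Hx n0; exists (j', d).
pose js := fix js n := if n is n'.+1 then (st (js n', n')).1 else j0.
pose d n := (st (js n, n)).2.
have jsub n m : (n <= m)%N -> H (js m) `<=` H (js n).
  elim: m => [|m IH]; first by rewrite leqn0 => /eqP ->.
  rewrite leq_eqVlt => /predU1P[->//|/IH nm].
  by apply: subset_trans nm; have [_ _ + _] := stP (js m, m).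
exists (fun n => x (js n)); first by move=> n; case: (xP (js n)).
split; first by move=> n; case: (xP (js n)).
exists d.
  have lt_disj n m : (n < m)%N -> lat_meet (modulus (d n)) (modulus (d m)) = 0.
    move=> nm; have [_ _ _ disj] := stP (js n, n).
    apply: (disj (x (js m)) (d m)); last by have [_ + _ _] := stP (js m, m).
    by apply: (jsub n.+1 m nm); case: (xP (js m)).
  move=> n m nm; have [h|h|//] := ltngtP n m; first exact: lt_disj.
  by rewrite lat_meetC; exact: lt_disj.
apply: (squeeze_cvgr _ (cvg_cst 0) (@cvg_harmonic R)).
by apply: nearW => n; rewrite normr_ge0/= ltW//; have [+ _ _ _] := stP (js n, n).
Qed.

End finite_dimensional_copies.

(** * Convergent sequences *)

Lemma hyperplane_ker (R : realType) (X : normedLatticeType R) (phi : X -> R) :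
  (forall a x y, phi (a *: x + y) = a * phi x + phi y) ->
  hyperplane [set x | phi x = 0].
Proof.
move=> philin; split=> [a x y /= x0 y0|x y /= /eqP x0].
  by rewrite philin x0 y0 mulr0 addr0.
exists (phi y / phi x); rewrite /= addrC -scaleNr philin mulNr.
by rewrite divfK// addNr.
Qed.

Section convergent_sequences.
Context (R : realType).
Local Notation c := (c_space R).
Implicit Types x y d : c.

Lemma c_space_cvg x : cvgn (x : nat -> R).
Proof. by have /set_mem := sup_funP x. Qed.

Lemma eventually0_cvg (u : nat -> R) N :
  (forall n, (N <= n)%N -> u n = 0) -> u \in supl_pred (cvg_lattice R).
Proof.
move=> uN; apply/mem_set; suff : cvgn u by [].
apply/cvg_ex; exists 0; apply: cvg_near_cst.
by exists N => // n /= /uN.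
Qed.

Lemma truncate_subproof x N :
  (fun n => if (n < N)%N then x n else 0) \in supl_pred (cvg_lattice R).
Proof. by apply: (eventually0_cvg (N := N)) => n Nn; rewrite ltnNge Nn. Qed.

Definition truncate x N : c := SupSpace (truncate_subproof x N).

Lemma truncateE x N n : truncate x N n = if (n < N)%N then x n else 0.
Proof. by []. Qed.

Lemma unit_seq_subproof k :
  (fun n => (n == k)%:R : R) \in supl_pred (cvg_lattice R).
Proof. by apply: (eventually0_cvg (N := k.+1)) => n kn; rewrite gtn_eqF. Qed.

Definition unit_seq k : c := SupSpace (unit_seq_subproof k).

Lemma unit_seqE k n : unit_seq k n = (n == k)%:R.
Proof. by []. Qed.

Lemma unit_seq_ge0 k : lat_le 0 (unit_seq k).
Proof. by suff h n : 0 <= unit_seq k n by []; rewrite unit_seqE. Qed.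

(** The limit comes first, so that the common kernels of initial segments of
    these functionals consist of sequences with small tails. *)
Definition functional n x : R :=
  if n is i.+1 then x i else limn (x : nat -> R).

Lemma functional_linear n (a : R) x y :
  functional n (a *: x + y) = a * functional n x + functional n y.
Proof.
case: n => [|i] //=.
apply: cvg_lim => //; apply: cvgD; last exact: c_space_cvg.
by apply: (@cvgZl_tmp _ R^o); exact: c_space_cvg.
Qed.

Lemma c_disjoint x y : (forall n, x n = 0 \/ y n = 0) ->
  lat_meet (modulus x) (modulus y) = 0.
Proof.
move=> xy; apply: sup_spaceP => n; rewrite meet_supE !modulus_supE.
by have [->|->] := xy n; rewrite normr0; [apply: min_l|apply: min_r].
Qed.

(** A dispersed subspace of [c] is finite-dimensional: otherwise it has unit
    vectors with limit 0 vanishing on arbitrarily long initial segments. *)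
Lemma c_space_SPR_copies : dispersed_have_SPR_copies c.
Proof.
move=> E [cE ndE].
pose H N : set c := [set x | forall n, n \in iota 0 N.+1 -> functional n x = 0].
have fZ n (a : R) x : functional n x = 0 -> functional n (a *: x) = 0.
  move=> x0; rewrite -[a *: x]addr0 functional_linear x0 mulr0 add0r.
  have := functional_linear n (-1) x x.
  by rewrite scaleN1r addNr mulN1r addNr.
have [||N x e Hx e0|N HN] := gliding_hump (H := H) 0%N _ _ _ ndE.
- by move=> a x; exact: closed_subspaceZ.
- by move=> N a x Hx n /Hx; exact: fZ.
- have x0 : x n @[n --> \oo] --> (0 : R).
    by rewrite -(Hx 0%N)//; exact: c_space_cvg.
  have e20 : 0 < e / 2 by rewrite divr_gt0.
  have /cvgr0_norm_lt/(_ _ e20)[M _ xM] := x0.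
  pose N' := maxn M N; exists N', (truncate x N'); split.
  + apply: (@le_lt_trans _ _ (e / 2)); last lra.
    apply: sup_norm_le => [|n]; first exact: ltW.
    rewrite [X in `|X|](_ : _ = x n - truncate x N' n)// truncateE.
    case: ltnP => [_|nN']; first by rewrite subrr normr0 ltW.
    by rewrite subr0 ltW//; apply: xM; rewrite /= (leq_trans _ nN')// leq_maxl.
  + move=> n; rewrite !modulus_supE truncateE.
    by case: ifP => // _; rewrite normr0.
  + move=> y Hy n nN; apply: Hy; move: nN; rewrite !mem_iota !add0n !ltnS /=.
    by move=> /leq_trans; apply; exact: leq_maxr.
  + move=> y d' Hy d'y; apply: c_disjoint => n; rewrite truncateE.
    case: ltnP => [nN'|_]; [right|by left].
    have yn : y n = 0 by apply: (Hy n.+1); rewrite mem_iota add0n.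
    by have := d'y n; rewrite !modulus_supE yn normr0 normr_le0 => /eqP.
- have [||n [e eE]] := @hyperplanes_basis R c nat (fun n => [set x | functional n x = 0])
    (iota 0 N.+1) E _ _ HN.
  + by move=> a x y Ex Ey; apply: closed_subspaceD => //; exact: closed_subspaceZ.
  + by move=> i _; apply: hyperplane_ker => a x y; exact: functional_linear.
  + apply: (finite_dim_SPR_copy (a := unit_seq) cE eE).
    * exact: unit_seq_ge0.
    * move=> k; apply/eqP; rewrite eq_le; apply/andP; split.
        apply: sup_norm_le => // m; rewrite unit_seqE.
        by case: eqP => _; rewrite ?normr1// normr0.
      by have := sup_norm_ubound (unit_seq k) k; rewrite unit_seqE eqxx normr1.
    * move=> k l kl; rewrite /perp/=.
      rewrite -[X in lat_meet _ X]modulus_pos; last exact: unit_seq_ge0.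
      apply: c_disjoint => m; rewrite !unit_seqE.
      by have [->|_] := eqVneq m l; [right; rewrite eq_sym (negPf kl)|left].
Qed.

End convergent_sequences.

(** * Order continuous atomic lattices *)

Section atomic_lattices.
Context (R : realType) (X : normedLatticeType R).
Implicit Types (x y z a b : X) (t : seq X).

Definition pos_part x : X := lat_join 0 x.

Lemma pos_part_ge0 x : lat_le 0 (pos_part x).
Proof. by apply lat_le_join. Qed.

Lemma pos_part_le x y : lat_le 0 y -> lat_le x y -> lat_le (pos_part x) y.
Proof. by move=> y0 xy; apply/lat_joinP. Qed.

Lemma pos_part_le_modulus x : lat_le (pos_part x) (modulus x).
Proof. by apply: pos_part_le; [exact: modulus_ge0|apply le_modulus]. Qed.

Lemma pos_partB x : pos_part x - pos_part (- x) = x.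
Proof.
apply/eqP; rewrite subr_eq -[pos_part (- x)]/(lat_join 0 (- x)) -lat_joinDl.
by rewrite addr0 subrr lat_joinC.
Qed.

(** The norm of the positive part of [x] is at most [d * `|b|] for all [d > 0]. *)
Lemma lat_archimedean x b : lat_le 0 b ->
  (forall d : R, 0 < d -> lat_le x (d *: b)) -> lat_le x 0.
Proof.
move=> b0 xb; have [_ xp] := lat_le_join 0 x.
suff -> : 0 = pos_part x by [].
apply/eqP; rewrite eq_sym -normr_eq0 -(@normr_id R^o); apply/eqP.
apply: contrapT => /eqP; rewrite normr_id => px0.
have p0 : 0 < `|pos_part x| by rewrite lt_def px0 normr_ge0.
have b1 : 0 < 2 * (`|b| + 1) by rewrite mulr_gt0// ltr_wpDl.
have d0 : 0 < `|pos_part x| / (2 * (`|b| + 1)) by rewrite divr_gt0.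
have : `|pos_part x| <= `|(`|pos_part x| / (2 * (`|b| + 1))) *: b|.
  apply: lat_norm_mono_pos; first exact: pos_part_ge0.
  by apply: pos_part_le; [apply: lat_scale_ge0 => //; exact: ltW|exact: xb].
rewrite normrZ (ger0_norm (ltW d0)) -mulrA mulrC ler_pMl//.
rewrite ler_pdivlMl// mulr1 => h; have := normr_ge0 b; lra.
Qed.

(** An atom or zero; unlike atoms, these are stable under nonnegative
    multiples and under passing to a smaller positive element. *)
Definition quasi_atom b :=
  lat_le 0 b /\
  forall y, lat_le 0 y -> lat_le y b -> exists r : R, y = r *: b.

Lemma atom_quasi a : atom a -> quasi_atom a.
Proof. by case. Qed.

Lemma quasi_atom_le b y : quasi_atom b -> lat_le 0 y -> lat_le y b ->
  quasi_atom y.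
Proof.
move=> [b0 bq] y0 yb; split=> // z z0 zy.
have [r yr] := bq y y0 yb; have [s zs] := bq z z0 (lat_le_trans zy yb).
have [r0|r0] := eqVneq r 0; last first.
  by exists (s / r); rewrite yr scalerA divfK.
exists 0; rewrite scale0r; apply: lat_le_anti => //.
by move: zy; rewrite yr r0 scale0r.
Qed.

Lemma quasi_atomZ b (r : R) : quasi_atom b -> 0 < r -> quasi_atom (r *: b).
Proof.
move=> [b0 bq] r0; split; first by apply: lat_scale_ge0 => //; exact: ltW.
have rn0 := lt0r_neq0 r0; have ri0 : 0 <= r^-1 by rewrite invr_ge0 ltW.
move=> y y0 yb; have [|s ys] := bq (r^-1 *: y) (lat_scale_ge0 ri0 y0).
  by rewrite -[X in lat_le _ X](scalerK rn0); exact: lat_leZ2l.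
by exists s; rewrite scalerA mulrC -scalerA -ys scalerKV.
Qed.

(** The coefficient is the largest [r] with [r *: b] below [x]: the meet of the
    remainder and [b] is a multiple of [b], and no positive one. *)
Lemma quasi_atom_coef_pos b x : quasi_atom b -> lat_le 0 x ->
  exists r : R, perp b (x - r *: b).
Proof.
move=> [b0 bq] x0; have [->|bn0] := eqVneq b 0.
  exists 0; rewrite /perp/=; apply: lat_meet_pos_eq0; first exact: modulus_ge0.
    exact: lat_le_refl.
  by apply lat_meet_le.
pose A := [set r : R | 0 <= r /\ lat_le (r *: b) x].
have supA : has_sup A.
  split; first by exists 0; split=> //; rewrite scale0r.
  exists (`|x| / `|b|) => r [r0 rx]; rewrite ler_pdivlMr ?normr_gt0//.
  rewrite -{1}(ger0_norm r0) -normrZ; apply: lat_norm_mono_pos => //.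
  exact: lat_scale_ge0.
pose r := sup A; have rx : lat_le (r *: b) x.
  apply/lat_subr_ge0; rewrite -[x - _]opprB -[X in lat_le X _]oppr0.
  apply/lat_leN2; apply: (lat_archimedean b0) => d d0.
  have [r' [r'0 r'x] rr'] := sup_adherent d0 supA.
  apply/lat_leBlDr; apply: (lat_le_trans _ (lat_leD2l _ r'x)).
  by rewrite -scalerDl; apply: lat_leZ2r => //; move: rr'; rewrite -/r; lra.
have r0 : 0 <= r by apply: sup_upper_bound => //; split; rewrite ?scale0r.
have z0 : lat_le 0 (x - r *: b) by apply/lat_subr_ge0.
exists r; rewrite /perp/= modulus_pos//.
have [mz mb] := lat_meet_le (x - r *: b) b.
apply: lat_meet_pos_eq0 => //.
have [c mc] := bq _ (lat_meet_ge0 z0 b0) mb; rewrite mc in mz *.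
rewrite -(scale0r b); apply: lat_leZ2r => //.
rewrite leNgt; apply/negP => c0.
suff : r + c <= r by lra.
apply: sup_upper_bound => //; split; first by rewrite addr_ge0// ltW.
by rewrite addrC scalerDl; apply/lat_leBrDr.
Qed.

Lemma quasi_atom_coef b x : quasi_atom b -> exists r : R, perp b (x - r *: b).
Proof.
move=> qb; have b0 := qb.1.
have [r rx] := quasi_atom_coef_pos qb (pos_part_ge0 x).
have [s sx] := quasi_atom_coef_pos qb (pos_part_ge0 (- x)).
exists (r - s); rewrite -{1}(pos_partB x) scalerBl opprB.
have -> : pos_part x - pos_part (- x) + (s *: b - r *: b) =
    (pos_part x - r *: b) - (pos_part (- x) - s *: b).
  by rewrite opprB [RHS]addrAC -!addrA; congr (_ + _); rewrite addrCA addrA addrC.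
exact: perpB.
Qed.

Lemma perp_hyperplane b : quasi_atom b -> hyperplane (perp b).
Proof.
move=> qb; have b0 := qb.1; split=> [a x y xb yb|x y nx].
  by apply: perpD => //; exact: perpZ.
have [r xr] := quasi_atom_coef x qb; have [s ys] := quasi_atom_coef y qb.
have r0 : r != 0 by apply/eqP => r0; apply: nx; move: xr; rewrite r0 scale0r subr0.
exists (s / r).
have -> : y - (s / r) *: x = (y - s *: b) - (s / r) *: (x - r *: b).
  by rewrite scalerBr scalerA divfK// opprB addrA subrK.
by apply: perpB => //; exact: perpZ.
Qed.

Definition quasi_atoms t := forall b, b \in t -> quasi_atom b.

Lemma quasi_atoms_cons b t : quasi_atom b -> quasi_atoms t -> quasi_atoms (b :: t).
Proof. by move=> qb qt c; rewrite inE => /predU1P[->|/qt]. Qed.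

Lemma quasi_atoms_cat t1 t2 : quasi_atoms t1 -> quasi_atoms t2 ->
  quasi_atoms (t1 ++ t2).
Proof. by move=> q1 q2 b; rewrite mem_cat => /orP[/q1|/q2]. Qed.

Definition atomic_sum x := exists2 t, quasi_atoms t & x = \sum_(b <- t) b.

Lemma atomic_sumD x y : atomic_sum x -> atomic_sum y -> atomic_sum (x + y).
Proof.
move=> [t qt ->] [t' qt' ->]; exists (t ++ t'); last by rewrite big_cat.
exact: quasi_atoms_cat.
Qed.

(** Riesz decomposition: the part of [y] below the first summand is again an atom
    or zero, and the rest of [y] is below the remaining sum. *)
Lemma atomic_sum_le x y : atomic_sum x -> lat_le 0 y -> lat_le y x ->
  atomic_sum y.
Proof.
move=> [t + ->]; elim: t y => [|b t IH] y qt y0.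
  by rewrite big_nil => yle; exists [::] => //; rewrite big_nil; exact: lat_le_anti.
have qt' : quasi_atoms t by move=> c tc; apply: qt; rewrite inE tc orbT.
have qb : quasi_atom b by apply: qt; rewrite mem_head.
have S0 : lat_le 0 (\sum_(c <- t) c).
  rewrite big_seq; elim/big_ind: _ => [|u v u0 v0|c /qt'[]//]; first exact: lat_le_refl.
  by rewrite -(addr0 0); exact: lat_leD.
rewrite big_cons => yle; have [uy ub] := lat_meet_le y b.
have u0 := lat_meet_ge0 y0 qb.1.
rewrite -(subrKC (lat_meet y b) y); apply: atomic_sumD.
  exists [:: lat_meet y b]; last by rewrite big_seq1.
  by move=> c; rewrite inE => /eqP ->; exact: quasi_atom_le u0 ub.
apply: IH => //; first by apply/lat_subr_ge0.
apply/lat_leBlDr; rewrite addrC; apply/lat_leBlDr; apply/lat_meetP; split.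
  by apply/lat_leBlDr; rewrite -[X in lat_le X _]addr0; exact: lat_leD2l.
by apply/lat_leBlDr.
Qed.

(** The finite atomic sums below [x] are directed upwards; a lower bound of the
    remainders dominates no atom, as all multiples of the atom would lie
    below [x]. *)
Lemma atomic_approximation x (e : R) : order_continuous X -> atomic X ->
  lat_le 0 x -> 0 < e ->
  exists t, [/\ quasi_atoms t, lat_le (\sum_(b <- t) b) x &
                `|x - \sum_(b <- t) b| < e].
Proof.
move=> oc at_ x0 e0.
pose P y := [/\ lat_le 0 y, lat_le y x & atomic_sum y].
pose le (i j : {y | P y}) := lat_le (projT1 i) (projT1 j).
have P0 : P 0.
  split=> //; first exact: lat_le_refl.
  by exists [::] => //; rewrite big_nil.
have dir : directed le.
  split=> [|i|i j k|[y1 [y10 y1x s1]] [y2 [y20 y2x s2]]].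
  - by constructor; exists 0.
  - exact: lat_le_refl.
  - exact: lat_le_trans.
  - have [le1 le2] := lat_le_join y1 y2.
    suff Pj : P (lat_join y1 y2) by exists (exist _ _ Pj).
    split; first exact: lat_le_trans le1.
      by apply/lat_joinP.
    rewrite -[y1 in lat_join y1 _]addr0 -[y2](subrKC y1) lat_joinDl.
    apply: atomic_sumD => //; apply: (atomic_sum_le s2).
      by rewrite -/(pos_part _); exact: pos_part_ge0.
    rewrite -/(pos_part _); apply: pos_part_le => //; apply/lat_leBlDr.
    by rewrite -[X in lat_le X _]addr0; exact: lat_leD2l.
have dec : decreasing_to0 le (fun i => x - projT1 i).
  split=> [i j ij|[y [? ? ?]]|z zx].
  - by apply: lat_leD2l; apply/lat_leN2.
  - by apply/lat_subr_ge0.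
  - have [_ zp] := lat_le_join 0 z; apply: (lat_le_trans zp).
    rewrite -/(pos_part z); apply: contrapT => nz.
    have pz : pos_part z <> 0 by move=> h; apply: nz; rewrite h; exact: lat_le_refl.
    have [a [an0 a0 aq] az] := at_ _ pz (pos_part_ge0 z).
    have na n : P (a *+ n).
      elim: n => [|n IH]; first by rewrite mulr0n.
      have [na0 nax ns] := IH; rewrite mulrSr; split.
      + by rewrite -(addr0 0); exact: lat_leD.
      + rewrite addrC; apply/lat_leBrDr; apply: (lat_le_trans az).
        by apply: pos_part_le (zx (exist _ _ IH)); apply/lat_subr_ge0.
      + apply: atomic_sumD => //; exists [:: a]; last by rewrite big_seq1.
        by move=> c; rewrite inE => /eqP ->.
    have a_gt0 : 0 < `|a| by rewrite normr_gt0; apply/eqP.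
    have [_ nax _] := na (Num.truncn (`|x| / `|a|)).+1.
    have := lat_norm_mono_pos (let: And3 h _ _ := na _ in h) nax.
    by rewrite normrMn -mulr_natl -ler_pdivlMr// leNgt truncnS_gt.
have [i iP] := oc _ _ _ dir dec e e0.
have := iP i (lat_le_refl _); case: i {iP} => /= y [_ yx [t qt yt]] xy.
by exists t; rewrite -yt.
Qed.

(** If the disjoint complements of the members of [t] had intersection [0], the
    whole lattice would have a finite basis by [hyperplanes_basis]. *)
Lemma disjoint_atom t : infinite_dimensional X -> atomic X -> quasi_atoms t ->
  exists a, [/\ quasi_atom a, `|a| = 1 & forall b, b \in t -> perp b a].
Proof.
move=> inf at_ qt.
have [x xn0 xt] : exists2 x, x <> 0 & forall b, b \in t -> perp b x.
  apply: contrapT => nx.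
  have [|b bt|x _ xt|n [e [_ _ span]]] := @hyperplanes_basis R X X (@perp R X) t setT.
  - by [].
  - exact: perp_hyperplane (qt b bt).
  - by apply: contrapT => xn0; apply: nx; exists x.
  - have [x xP] := inf n e; have [//|c xc] := span x.
    by apply: (xP (fun i => c 0 i)).
have m0 : modulus x <> 0.
  by move=> m0; apply/xn0/eqP; rewrite -normr_eq0 -lat_norm_modulus m0 normr0.
have [a at_a ax] := at_ _ m0 (modulus_ge0 x); have [an0 a0 _] := at_a.
have i0 : 0 < `|a|^-1 by rewrite invr_gt0 normr_gt0; apply/eqP.
exists (`|a|^-1 *: a); split; first exact: quasi_atomZ (atom_quasi at_a) i0.
  by rewrite normrZ normfV normr_id mulVf// normr_eq0; apply/eqP.
move=> b bt; have [b0 _] := qt b bt; apply: perpZ => //.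
by apply: perp_le b0 (xt b bt) _; rewrite modulus_pos.
Qed.

Lemma disjoint_unit_sequence : infinite_dimensional X -> atomic X ->
  exists a : nat -> X, [/\ forall k, lat_le 0 (a k), forall k, `|a k| = 1 &
                           forall k l, k != l -> perp (a k) (a l)].
Proof.
move=> inf at_.
have /choice[f fP] : forall t, exists a, quasi_atoms t ->
    [/\ quasi_atom a, `|a| = 1 & forall b, b \in t -> perp b a].
  move=> t; have [/(disjoint_atom inf at_)[a aP]|nqt] := pselect (quasi_atoms t).
    by exists a.
  by exists 0.
pose l := fix l n := if n is n'.+1 then f (l n') :: l n' else [::].
have lq n : quasi_atoms (l n).
  elim: n => [|n IH]//=; apply: quasi_atoms_cons => //.
  by have [+ _ _] := fP _ IH.
have fl n m : (n < m)%N -> f (l n) \in l m.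
  elim: m => // m IH; rewrite ltnS leq_eqVlt => /predU1P[->|/IH fm] /=.
    by rewrite mem_head.
  by rewrite inE fm orbT.
have a0 n : lat_le 0 (f (l n)) by have [[]] := fP _ (lq n).
have lt_perp n m : (n < m)%N -> perp (f (l n)) (f (l m)).
  by move=> /fl nm; have [_ _] := fP _ (lq m); apply.
exists (fun n => f (l n)); split=> //.
  by move=> n; have [] := fP _ (lq n).
move=> n m; case: ltngtP => // [/lt_perp//|/lt_perp mn] _.
exact: perp_sym.
Qed.

(** The tails of the gliding hump are the disjoint complements of finite sets of
    atoms, which are intersections of finitely many hyperplanes. *)
Lemma atomic_SPR_copies : infinite_dimensional X -> order_continuous X ->
  atomic X -> dispersed_have_SPR_copies X.
Proof.
move=> inf oc at_ E [cE ndE].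
have [a [a0 a1 ad]] := disjoint_unit_sequence inf at_.
pose H (t : {t | quasi_atoms t}) : set X :=
  [set x | forall b, b \in projT1 t -> perp b x].
have q0 : quasi_atoms [::] by [].
have [||[t qt] x e Hx e0|[t qt] Ht] := gliding_hump (H := H) (exist _ _ q0) _ _ _ ndE.
- by move=> c x; exact: closed_subspaceZ.
- move=> [t qt] c x Hx b bt; apply: perpZ; first by case: (qt b bt).
  exact: Hx.
- have e20 : 0 < e / 2 by rewrite divr_gt0.
  have [t1 [q1 le1 lt1]] := atomic_approximation oc at_ (pos_part_ge0 x) e20.
  have [t2 [q2 le2 lt2]] := atomic_approximation oc at_ (pos_part_ge0 (- x)) e20.
  have q12 := quasi_atoms_cat q1 q2.
  have sum_perp y s : lat_le 0 y -> quasi_atoms s ->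
      (forall b, b \in s -> perp b y) -> perp y (\sum_(b <- s) b).
    move=> y0 qs sy; rewrite big_seq; apply: perp_sum => // b bs.
    by apply: perp_sym => //; [case: (qs b bs)|exact: sy].
  have sum_ge0 s : quasi_atoms s -> lat_le 0 (\sum_(b <- s) b).
    move=> qs; rewrite big_seq; elim/big_ind: _ => [|u v u0 v0|c /qs[]//].
      exact: lat_le_refl.
    by rewrite -(addr0 0); exact: lat_leD.
  exists (exist _ _ (quasi_atoms_cat q12 qt)).
  exists (\sum_(b <- t1) b - \sum_(b <- t2) b); split.
  + rewrite -{1}(pos_partB x).
    set u := pos_part x; set v := pos_part (- x).
    have -> : u - v - (\sum_(b <- t1) b - \sum_(b <- t2) b) =
        (u - \sum_(b <- t1) b) - (v - \sum_(b <- t2) b).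
      by rewrite !opprB [RHS]addrAC -!addrA; congr (_ + _); rewrite addrCA addrA addrC.
    by apply: le_lt_trans (ler_normB _ _) _; lra.
  + apply/modulusP; rewrite opprB; split.
      apply: lat_le_trans (pos_part_le_modulus x); apply: lat_le_trans le1.
      by apply/lat_leBlDr; rewrite -{1}[\sum_(b <- t1) b]addr0;
        apply: lat_leD2l; exact: sum_ge0.
    rewrite -(modulusN x); apply: lat_le_trans (pos_part_le_modulus (- x)).
    apply: lat_le_trans le2.
    by apply/lat_leBlDr; rewrite -{1}[\sum_(b <- t2) b]addr0;
        apply: lat_leD2l; exact: sum_ge0.
  + by move=> y Hy b bt; apply: Hy; rewrite /= mem_cat bt orbT.
  + move=> y d' Hy d'y; have m0 := modulus_ge0 d'.
    have bperp b : b \in t1 ++ t2 -> perp b (modulus d').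
      move=> bt; have [b0 _] := q12 b bt.
      apply: (perp_le b0 (Hy b _)); last by rewrite modulus_pos.
      by rewrite /= mem_cat bt.
    apply: (perpB m0); apply: sum_perp => // b bt; apply: bperp.
      by rewrite mem_cat bt.
    by rewrite mem_cat bt orbT.
- have [|b bt|n [e eE]] := @hyperplanes_basis R X X (@perp R X) t E _ _ Ht.
  + by move=> c x y Ex Ey; apply: closed_subspaceD => //; exact: closed_subspaceZ.
  + exact: perp_hyperplane (qt b bt).
  + exact: (finite_dim_SPR_copy (a := a) cE eE).
Qed.

End atomic_lattices.

Theorem corollary4p8 (R : realType) :
  (forall (p : \bar R) (p1 : (1 <= p)%E), dispersed_have_SPR_copies (Lp01 p1))
  /\ dispersed_have_SPR_copies (C01 R)
  /\ dispersed_have_SPR_copies (CCantor R)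
  /\ dispersed_have_SPR_copies (c_space R)
  /\ (forall X : banachLatticeType R,
        infinite_dimensional X -> order_continuous X -> atomic X ->
        dispersed_have_SPR_copies X).
Proof.
split; first exact: Lp01_SPR_copies.
split; first exact: C01_SPR_copies.
split; first exact: CCantor_SPR_copies.
split; first exact: c_space_SPR_copies.
by move=> X; exact: atomic_SPR_copies.
Qed.
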